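(* Let $m,r\in\mathbb{N}$, $\sigma\ge 0$, and consider the system $$y^{(r)}(t)=f\big(d(t),\mathbf{T}(y,\dot y,\ldots,y^{(r-1)})(t),u(t)\big),\qquad y|_{[-\sigma,0]}=y^0,$$ with $(d,f,\mathbf{T})\in\mathcal{N}^{m,r}$ and initial data $y^0\in\mathcal{C}^{r-1}([-\sigma,0];\mathbb{R}^m)$. Let $T>0$ and let $y_{\rm ref}\in\mathcal{W}^{r,\infty}([0,T);\mathbb{R}^m)$. Let $c>0$, let $\varphi(t)=\frac1c\,\frac1{T-t}$ for $t\in[0,T)$, let $\alpha\in\mathcal{C}^{r-1}([0,1);[c(r+1),\infty))$ be a bijection, and let $N\in\mathcal{C}([0,\infty);\mathbb{R})$ be a surjection. Put $e^{(i)}(t)=y^{(i)}(t)-y_{\rm ref}^{(i)}(t)$ for $i=0,\ldots,r-1$ (so $e=e^{(0)}=y-y_{\rm ref}$), and for $k=1,\ldots,r$ define recursively $$e_k(t)=\varphi(t)e^{(k-1)}(t)+\varphi(t)\sum_{i=1}^{k-1}\gamma_i^{(k-1-i)}(t),\qquad \gamma_k(t)=\alpha(\|e_k(t)\|^2)\,e_k(t).$$ Assume that the initial conditions $$\|e_k(0)\|<1\qquad\text{for all }k=1,\ldots,r$$ are satisfied. Then the feedback $$u(t)=(N\circ\alpha)(\|e_r(t)\|^2)\,e_r(t)$$ applied to the system yields an initial value problem which has a solution, and every maximal solution $y:[-\sigma,\omega)\to\mathbb{R}^m$ satisfies: i) $\omega=T$; ii) $u\in\mathcal{L}^\infty([0,T);\mathbb{R}^m)$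 and $y\in\mathcal{W}^{r,\infty}([-\sigma,T);\mathbb{R}^m)$; iii) the tracking error $e(t)=y(t)-y_{\rm ref}(t)$ evolves within the performance funnel $\mathcal{F}_\varphi=\{(t,e)\in[0,T)\times\mathbb{R}^m : \varphi(t)\|e\|<1\}$, i.e., $\varphi(t)\|e(t)\|<1$ for all $t\in[0,T)$; iv) the tracking of the reference and its derivatives is exact at $t=T$, i.e., $\lim_{t\to T}\|e^{(i)}(t)\|=0$ for all $i=0,\ldots,r-1$.
   Context: Notation. $\|\cdot\|$ is the Euclidean norm and $\langle\cdot,\cdot\rangle$ the Euclidean inner product. $\mathcal{L}^\infty(I;\mathbb{R}^p)$ (resp. $\mathcal{L}^\infty_{\rm loc}$) denotes (locally) essentially bounded functions on the interval $I$; $\mathcal{W}^{k,\infty}(I;\mathbb{R}^p)$ denotes $k$-times weakly differentiable functions $g:I\to\mathbb{R}^p$ with $g,\dot g,\ldots,g^{(k)}\in\mathcal{L}^\infty(I;\mathbb{R}^p)$; $\mathcal{C}^k(I;\mathbb{R}^p)$ denotes $k$-times continuously differentiable functions, and $\mathcal{C}=\mathcal{C}^0$. If $\sigma=0$, the initial data is understood as the vector $(y(0),\dot y(0),\ldots,y^{(r-1)}(0))\in\mathbb{R}^{rm}$. High-gain property. For $p,q,m\in\mathbb{N}$, a function $f\in\mathcal{C}(\mathbb{R}^p\times\mathbb{R}^q\times\mathbb{R}^m;\mathbb{R}^m)$ satisfies the high-gain property if there exists $\rho\in(0,1)$ such that, for every compact $K_p\subset\mathbb{R}^p$ and compact $K_q\subset\mathbb{R}^q$,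 the continuous function $\chi:\mathbb{R}\to\mathbb{R}$, $$\chi(s)=\min\{\langle v,f(\delta,z,-sv)\rangle : (\delta,z)\in K_p\times K_q,\ v\in\mathbb{R}^m,\ \rho\le\|v\|\le1\},$$ satisfies $\sup_{s\in\mathbb{R}}\chi(s)=\infty$. Operator class $\mathcal{T}^{n,q}_\sigma$. For $n,q\in\mathbb{N}$ and $\sigma\ge0$, an operator $\mathbf{T}:\mathcal{C}([-\sigma,\infty);\mathbb{R}^n)\to\mathcal{L}^\infty_{\rm loc}([0,\infty);\mathbb{R}^q)$ belongs to $\mathcal{T}^{n,q}_\sigma$ if: (a) for all $c_1>0$ there exists $c_2>0$ such that for all $\xi\in\mathcal{C}([-\sigma,\infty);\mathbb{R}^n)$: $\sup_{t\in[-\sigma,\infty)}\|\xi(t)\|\le c_1$ implies $\sup_{t\in[0,\infty)}\|\mathbf{T}(\xi)(t)\|\le c_2$; (b) (causality) for all $t\ge0$ and all $\zeta,\xi\in\mathcal{C}([-\sigma,\infty);\mathbb{R}^n)$: $\zeta|_{[-\sigma,t)}=\xi|_{[-\sigma,t)}$ implies $\mathbf{T}(\zeta)|_{[0,t)}=\mathbf{T}(\xi)|_{[0,t)}$ almost everywhere; (c) for all $t\ge0$ and all $\xi\in\mathcal{C}([-\sigma,t];\mathbb{R}^n)$ there exist $\Delta,\delta,c>0$ such that for all $\zeta_1,\zeta_2\in\mathcal{C}([-\sigma,\infty);\mathbb{R}^n)$ with $\zeta_1|_{[-\sigma,t]}=\zeta_2|_{[-\sigma,t]}=\xi$ and $\|\zeta_1(s)-\xi(t)\|<\delta$,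 $\|\zeta_2(s)-\xi(t)\|<\delta$ for all $s\in[t,t+\Delta]$, one has $$\operatorname*{ess\,sup}_{s\in[t,t+\Delta]}\|\mathbf{T}(\zeta_1)(s)-\mathbf{T}(\zeta_2)(s)\|\le c\sup_{s\in[t,t+\Delta]}\|\zeta_1(s)-\zeta_2(s)\|.$$ System class. $(d,f,\mathbf{T})\in\mathcal{N}^{m,r}$ means that for some $p,q\in\mathbb{N}$: $d\in\mathcal{L}^\infty([0,\infty);\mathbb{R}^p)$, $f\in\mathcal{C}(\mathbb{R}^p\times\mathbb{R}^q\times\mathbb{R}^m;\mathbb{R}^m)$ satisfies the high-gain property, and $\mathbf{T}\in\mathcal{T}^{rm,q}_\sigma$, where $\sigma\ge0$ is the constant in the system's initial condition. Meaning of the derivatives $\gamma_i^{(j)}$. They are functions of $t$ and the instantaneous values $y(t),\ldots,y^{(r-1)}(t)$, as follows. Let $\mathcal{D}_0=\{\zeta\in\mathbb{R}^m:\|\zeta\|<1\}$ and $\Gamma_0(t,\zeta)=\Gamma_0(\zeta)=\alpha(\|\zeta\|^2)\zeta$ for $\zeta\in\mathcal{D}_0$. For $k=1,\ldots,r-1$ let, for $t\in[0,T)$, $\zeta_1,\ldots,\zeta_k\in\mathcal{D}_0$, $\zeta_{k+1}\in\mathbb{R}^m$, $$\Gamma_k(t,\zeta_1,\ldots,\zeta_{k+1})=\frac{\partial\Gamma_{k-1}(t,\zeta_1,\ldots,\zeta_k)}{\partial t}+\sum_{i=1}^k\frac{\partial\Gamma_{k-1}(t,\zeta_1,\ldots,\zeta_k)}{\partial\zeta_i}\Big(\varphi(t)\big(c\zeta_i-\Gamma_0(\zeta_i)\big)+\zeta_{i+1}\Big).$$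 Then $\gamma_k^{(j)}(t)=\Gamma_j(t,e_k(t),\ldots,e_{k+j}(t))$ for $0\le j\le r-k$, so that $$e_k(t)=\varphi(t)\Big(e^{(k-1)}(t)+\sum_{i=1}^{k-1}\Gamma_{k-1-i}\big(t,e_i(t),\ldots,e_{k-1}(t)\big)\Big),\quad k=1,\ldots,r.$$ In particular $e_k(0)$ is determined by $y^{(i)}(0)$ and $y_{\rm ref}^{(i)}(0)$, $i=0,\ldots,k-1$. Empty sums are zero. Solutions. Since $\alpha$ is defined only on $[0,1)$, the feedback is defined at those $(t,y(t),\ldots,y^{(r-1)}(t))$, $t\in[0,T)$, for which $\|e_k(t)\|<1$ for $k=1,\ldots,r$. A solution of the closed-loop initial value problem (system with the feedback inserted) is understood in the sense of Carathéodory: a function $x=(x_1,\ldots,x_r):[-\sigma,\omega)\to\mathbb{R}^{rm}$, $0<\omega\le T$, with $x|_{[-\sigma,0]}=(y^0,\dot y^0,\ldots,(y^0)^{(r-1)})$, such that $x|_{[0,\omega)}$ is absolutely continuous (on compact subintervals), the feedback is defined along $x$ on $[0,\omega)$, and $\dot x_i(t)=x_{i+1}(t)$ for $i=1,\ldots,r-1$ and $\dot x_r(t)=f(d(t),\mathbf{T}(x)(t),u(t))$ for almost all $t\in[0,\omega)$; here $y=x_1$, and $\mathbf{T}(x)$ on $[0,\omega)$ is well defined by causality. A solution is maximal if it has no right extension that is also a solution.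
   Formalization: In ii), since y^0 is only C^{r-1}, y in W^{r,∞}([-σ,T)) can fail (e.g. y^0(t)=√(-t), r=1); it is claimed only when y^0 is in W^{r,∞}([-σ,0]), while y in W^{r,∞}([0,T)) and y in W^{r-1,∞}([-σ,T)) are claimed unconditionally. *)

(* Defs.v *)
From HB Require Import structures.
From mathcomp Require Import all_boot all_order all_algebra.
From mathcomp Require Import all_classical all_reals all_analysis.
Set Implicit Arguments.
Unset Strict Implicit.
Unset Printing Implicit Defensive.
Import Order.TTheory GRing.Theory Num.Theory.
Import numFieldNormedType.Exports.
Local Open Scope classical_set_scope.
Local Open Scope ring_scope.

(** The library norm on ['rV[R]_n] is the maximum norm; it induces the same
topology as [enorm], so it is used for limits and continuity only. *)

Definition dotp (R : realType) (n : nat) (v w : 'rV[R]_n) : R :=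
  \sum_(i < n) v 0 i * w 0 i.

Definition enorm (R : realType) (n : nat) (v : 'rV[R]_n) : R :=
  Num.sqrt (dotp v v).

(** In the function spaces below, functions are total, the domain [A] is an
interval and only the values on [A] matter.  The sigma-algebra on
[R] is the Borel one, so Lebesgue measurability is expressed as almost
everywhere equality with a Borel function. *)
Definition Linf (R : realType) (n : nat) (A : set R) (g : R -> 'rV[R]_n) : Prop :=
  (exists h : R -> 'rV[R]_n,
     (forall j, measurable_fun A (fun t => h t 0 j)) /\
     {ae lebesgue_measure, forall t, A t -> g t = h t}) /\
  (exists M : R, {ae lebesgue_measure, forall t, A t -> enorm (g t) <= M}).

Definition Linf_loc (R : realType) (n : nat) (A : set R) (g : R -> 'rV[R]_n) :
    Prop :=
  forall a b : R, `[a, b] `<=` A -> Linf `[a, b] g.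

(** [Ck_jet k A G]: [G 0] is of class C^k on [A] and its successive derivatives
are [G 1], ..., [G k]; derivatives at end points of [A] are one-sided.  When [A]
is a singleton the punctured filter below is improper, the derivative condition
is void and a jet is an arbitrary list of [k + 1] vectors. *)
Definition Ck_jet (R : realType) (V : normedModType R) (k : nat) (A : set R)
    (G : nat -> R -> V) : Prop :=
  (forall i, (i <= k)%N -> {within A, continuous (G i)}) /\
  (forall i, (i < k)%N -> forall t, A t ->
     (fun s => (s - t)^-1 *: (G i s - G i t)) @ within A t^' --> G i.+1 t).

Definition Ck (R : realType) (V : normedModType R) (k : nat) (A : set R)
    (g : R -> V) : Prop :=
  exists G : nat -> R -> V, Ck_jet k A G /\ (forall t, A t -> G 0%N t = g t).

(** As in Brezis' definition of W^{1,p}(I), weak derivatives are tested against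
C^1 functions with compact support in the interior of [A]. *)
Definition test_fun (R : realType) (A : set R) (psi : R -> R) : Prop :=
  [/\ forall t, derivable psi t 1,
      continuous (derive1 psi)
    & exists K : set R, [/\ compact K, K `<=` interior A
                          & forall t, ~ K t -> psi t = 0]].

Definition weak_deriv (R : realType) (n : nat) (A : set R)
    (g g' : R -> 'rV[R]_n) : Prop :=
  forall psi : R -> R, test_fun A psi -> forall j : 'I_n,
    \int[lebesgue_measure]_(t in A) (g t 0 j * derive1 psi t) =
    - \int[lebesgue_measure]_(t in A) (g' t 0 j * psi t).

(** [Winf_jet k A G]: [G 0] belongs to W^{k,oo}(A) and [G 1], ..., [G k] are its
weak derivatives; the functions [G i] with [i < k] are the continuous
representatives. *)
Definition Winf_jet (R : realType) (n k : nat) (A : set R)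
    (G : nat -> R -> 'rV[R]_n) : Prop :=
  [/\ forall i, (i < k)%N -> {within A, continuous (G i)},
      forall i, (i <= k)%N -> Linf A (G i)
    & forall i, (i < k)%N -> weak_deriv A (G i) (G i.+1)].

Definition Winf (R : realType) (n k : nat) (A : set R) (g : R -> 'rV[R]_n) :
    Prop :=
  exists G : nat -> R -> 'rV[R]_n,
    Winf_jet k A G /\ (forall t, A t -> G 0%N t = g t).

Definition abs_continuous (R : realType) (n : nat) (a b : R)
    (g : R -> 'rV[R]_n) : Prop :=
  forall eps : R, 0 < eps -> exists2 delta : R, 0 < delta &
    forall (k : nat) (lo hi : nat -> R),
      (forall i, (i < k)%N -> a <= lo i /\ lo i <= hi i /\ hi i <= b) ->
      (forall i, (i.+1 < k)%N -> hi i <= lo i.+1) ->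
      \sum_(i < k) (hi i - lo i) < delta ->
      \sum_(i < k) enorm (g (hi i) - g (lo i)) < eps.

(** The infimum defining [high_gain_chi] is a minimum when [Kp] and [Kq] are
compact and nonempty and the annulus is nonempty. *)
Definition high_gain_chi (R : realType) (p q m : nat)
    (f : 'rV[R]_p * 'rV[R]_q * 'rV[R]_m -> 'rV[R]_m)
    (rho : R) (Kp : set 'rV[R]_p) (Kq : set 'rV[R]_q) (s : R) : R :=
  inf [set a | exists delta z v,
         [/\ Kp delta, Kq z, rho <= enorm v, enorm v <= 1
           & a = dotp v (f (delta, z, - (s *: v)))]].

Definition high_gain (R : realType) (p q m : nat)
    (f : 'rV[R]_p * 'rV[R]_q * 'rV[R]_m -> 'rV[R]_m) : Prop :=
  exists rho : R, [/\ 0 < rho, rho < 1 &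
    forall (Kp : set 'rV[R]_p) (Kq : set 'rV[R]_q),
      compact Kp -> Kp !=set0 -> compact Kq -> Kq !=set0 ->
      ereal_sup [set (high_gain_chi f rho Kp Kq s)%:E | s in [set: R]] = +oo%E].

(** [Top] is only meaningful on functions continuous on [-sigma, oo), and its
values are only meaningful on [0, oo).  By causality, [Top xi] depends, up to null
sets, only on the restriction of [xi] to [-sigma, oo). *)
Definition op_class (R : realType) (n q : nat) (sigma : R)
    (Top : (R -> 'rV[R]_n) -> R -> 'rV[R]_q) : Prop :=
  let C := [set xi : R -> 'rV[R]_n | {within `[- sigma, +oo[, continuous xi}] in
  [/\ forall xi, C xi -> Linf_loc `[0, +oo[ (Top xi),
      forall c1 : R, 0 < c1 -> exists2 c2 : R, 0 < c2 &
        forall xi, C xi ->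
          (forall t, - sigma <= t -> enorm (xi t) <= c1) ->
          forall t, 0 <= t -> enorm (Top xi t) <= c2,
      forall (t : R) zeta xi, 0 <= t -> C zeta -> C xi ->
        (forall s, - sigma <= s < t -> zeta s = xi s) ->
        {ae lebesgue_measure, forall s, 0 <= s < t -> Top zeta s = Top xi s}
    & forall (t : R) (xi : R -> 'rV[R]_n), 0 <= t ->
        {within `[- sigma, t], continuous xi} ->
        exists Delta delta c : R, [/\ 0 < Delta, 0 < delta, 0 < c &
          forall zeta1 zeta2, C zeta1 -> C zeta2 ->
            (forall s, - sigma <= s <= t -> zeta1 s = xi s /\ zeta2 s = xi s) ->
            (forall s, t <= s <= t + Delta ->
               enorm (zeta1 s - xi t) < delta /\
               enorm (zeta2 s - xi t) < delta) ->
            {ae lebesgue_measure, forall s, t <= s <= t + Delta ->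
               enorm (Top zeta1 s - Top zeta2 s) <=
               c * sup [set enorm (zeta1 s' - zeta2 s')
                       | s' in `[t, t + Delta]]}]].

Definition sys_class (R : realType) (m r p q : nat) (sigma : R)
    (d : R -> 'rV[R]_p) (f : 'rV[R]_p * 'rV[R]_q * 'rV[R]_m -> 'rV[R]_m)
    (Top : (R -> 'rV[R]_(r * m)) -> R -> 'rV[R]_q) : Prop :=
  [/\ Linf `[0, +oo[ d, continuous f, high_gain f & op_class sigma Top].

Definition phi (R : realType) (c T t : R) : R := c^-1 * (T - t)^-1.

Definition Gamma0 (R : realType) (m : nat) (alpha : R -> R) (z : 'rV[R]_m) :
    'rV[R]_m :=
  alpha (enorm z ^+ 2) *: z.

Definition upd (V : Type) (zeta : nat -> V) (i : nat) (z : V) : nat -> V :=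
  fun j => if j == i then z else zeta j.

(** [Gamma k t zeta] is Gamma_k(t, zeta 0, ..., zeta k): indices of the vector
arguments start at 0, and [zeta j] is irrelevant for [j > k].  The partial
derivative in [t] is two-sided also at [t = 0], since [phi c T] is given by the
same formula for negative times.  ['d g z w] is the Jacobian of [g] at [z]
applied to [w]. *)
Fixpoint Gamma (R : realType) (m : nat) (alpha : R -> R) (c T : R) (k : nat)
    (t : R) (zeta : nat -> 'rV[R]_m) {struct k} : 'rV[R]_m :=
  match k with
  | 0%N => Gamma0 alpha (zeta 0%N)
  | k'.+1 =>
      derive1 (fun s : R => Gamma alpha c T k' s zeta) t +
      \sum_(i < k'.+1)
        'd (fun z : 'rV[R]_m => Gamma alpha c T k' t (upd zeta i z)) (zeta i)
          (phi c T t *: (c *: zeta i - Gamma0 alpha (zeta i)) + zeta i.+1)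
  end.

(** [errs alpha c T t e k] is the list [e_1(t); ...; e_k(t)], where [e i] stands
for the i-th derivative of the tracking error at time [t]. *)
Fixpoint errs (R : realType) (m : nat) (alpha : R -> R) (c T t : R)
    (e : nat -> 'rV[R]_m) (k : nat) {struct k} : seq 'rV[R]_m :=
  match k with
  | 0%N => [::]
  | k'.+1 =>
      let prev := errs alpha c T t e k' in
      rcons prev
        (phi c T t *: e k' +
         phi c T t *:
           \sum_(i < k')
             Gamma alpha c T (k' - i.+1) t (fun j => nth 0 prev (i + j)))
  end.

(** e_k(t) for [k >= 1], where [x i] and [yref i] are the i-th derivatives of the
output and of the reference. *)
Definition err (R : realType) (m : nat) (alpha : R -> R) (c T : R)
    (yref x : nat -> R -> 'rV[R]_m) (k : nat) (t : R) : 'rV[R]_m :=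
  nth 0 (errs alpha c T t (fun i => x i t - yref i t) k) k.-1.

Definition feedback (R : realType) (m r : nat) (alpha N : R -> R) (c T : R)
    (yref x : nat -> R -> 'rV[R]_m) (t : R) : 'rV[R]_m :=
  let er := err alpha c T yref x r t in N (alpha (enorm er ^+ 2)) *: er.

(** (x 0, ..., x (r-1)) as one vector of length rm *)
Definition stack (R : realType) (m r : nat) (x : nat -> R -> 'rV[R]_m) (t : R) :
    'rV[R]_(r * m) :=
  mxvec (\matrix_(i < r) x i t).

(** [x 0], ..., [x r.-1] on [-sigma, omega) is a Caratheodory solution.  Since [x]
lives on [-sigma, omega) only, the restriction of T(x) to [0, tau), for
[tau < omega], is by causality that of T applied to an arbitrary continuous
extension of [x] restricted to [-sigma, tau]; the extension that is constant
after [tau] is used. *)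
Definition is_solution (R : realType) (m r p q : nat) (sigma : R)
    (d : R -> 'rV[R]_p) (f : 'rV[R]_p * 'rV[R]_q * 'rV[R]_m -> 'rV[R]_m)
    (Top : (R -> 'rV[R]_(r * m)) -> R -> 'rV[R]_q)
    (y0 : nat -> R -> 'rV[R]_m) (alpha N : R -> R) (c T : R)
    (yref : nat -> R -> 'rV[R]_m)
    (omega : R) (x : nat -> R -> 'rV[R]_m) : Prop :=
  [/\ 0 < omega <= T,
      forall i t, (i < r)%N -> - sigma <= t <= 0 -> x i t = y0 i t,
      forall i b, (i < r)%N -> b < omega -> abs_continuous 0 b (x i),
      forall k t, (0 < k <= r)%N -> 0 <= t < omega ->
        enorm (err alpha c T yref x k t) < 1
    & forall tau, 0 < tau < omega ->
        {ae lebesgue_measure, forall t : R, 0 <= t < tau ->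
           (forall i, (i.+1 < r)%N -> is_derive t 1 (x i) (x i.+1 t)) /\
           is_derive t 1 (x r.-1)
             (f (d t,
                 Top (fun s => stack r x (Num.min s tau)) t,
                 feedback r alpha N c T yref x t))}].

Definition is_maximal_solution (R : realType) (m r p q : nat) (sigma : R)
    (d : R -> 'rV[R]_p) (f : 'rV[R]_p * 'rV[R]_q * 'rV[R]_m -> 'rV[R]_m)
    (Top : (R -> 'rV[R]_(r * m)) -> R -> 'rV[R]_q)
    (y0 : nat -> R -> 'rV[R]_m) (alpha N : R -> R) (c T : R)
    (yref : nat -> R -> 'rV[R]_m)
    (omega : R) (x : nat -> R -> 'rV[R]_m) : Prop :=
  is_solution sigma d f Top y0 alpha N c T yref omega x /\
  ~ (exists omega' x',
       [/\ omega < omega',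
           is_solution sigma d f Top y0 alpha N c T yref omega' x'
         & forall i t, (i < r)%N -> - sigma <= t < omega -> x' i t = x i t]).

(* Main.v *)
Require Import Defs.
From HB Require Import structures.
From mathcomp Require Import all_boot all_order all_algebra.
From mathcomp Require Import all_classical all_reals all_analysis.
From mathcomp Require Import measurable_realfun ring lra zify.
Set Implicit Arguments.
Unset Strict Implicit.
Unset Printing Implicit Defensive.
Import Order.TTheory GRing.Theory Num.Theory.
Import numFieldNormedType.Exports.
Local Open Scope classical_set_scope.
Local Open Scope ring_scope.

(** Write [r = n + 1], count the errors from 0, and let [z k] be e_(k+1).

The functions Gamma are built from phi, coordinates and derivatives of alpha by sums
and products ([GammaE]), so the errors depend continuously on time and on the tracking
error ([ee_cvg]) and are Lipschitz along Lipschitz trajectories.  For [k < n] the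
gamma_i are arranged such that (z k)' = phi (c - alpha(|z k|^2)) z k + z (k + 1), and
(z n)' is phi times the sum of the input term [f] and of quantities that will turn out
to be bounded ([ee_derive], [dotp_zrhs]).

Along a solution on [0, om), with constants valid on the whole interval:
alpha is unbounded at 1, so that the damping keeps |z k| away from 1 for [k < n]
([z_le_q]).  As alpha >= c (r + 1), the damping also beats the growth rate [c phi] of
phi, and downward induction on [k] gives z k = O(phi^(k-n)) ([z_decay]).  All terms in
the functions Gamma are homogeneous for the weights thus given to the variables, each
time derivative costing one power of phi, so that the derivatives of the tracking error
up to order [n] are O(1/phi) = O(T - t) ([e_bigOphi]): they are bounded and vanish at
[T].  Hence the state and the memory term T(x) are bounded.  The high-gain property and
the surjectivity of [N] yield a band of values of |z n|^2 in which the input term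
dominates everything else ([high_gain_level]); the band cannot be crossed
([barrier]), so |z n| stays away from 1 as well ([last_z]), the feedback is
bounded and the state is Lipschitz ([sol_global]).

Existence: the memory term is handled by Tonelli's delayed approximations, equicontinuity
and condition (c) of the operator class ([peano], [locex]); truncation to compact boxes
reduces the closed loop to this case ([extend]).  A solution on [0, om) with [om < T] has
a limit at [om], where the errors still lie in the open unit ball; it can be continued
([continue_solution]), hence is not maximal ([maximal_omega]).

Regularity: a function that is absolutely continuous with an almost everywhere bounded
derivative is Lipschitz ([acs_lipon]), its almost everywhere derivative is its weak
derivative ([lip_sweak]), and conversely a continuous function with a bounded weak
derivative is Lipschitz ([weak_lip]); this converts between the solution concept and
the spaces W^(k,oo) of the reference and of the output. *)

(** * Absolutely continuous functions *)

Section RealAnalysis.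
Context {R : realType}.
Notation mu := (@lebesgue_measure R).

Lemma compact_bounded_fun (T : topologicalType) (K : set T) (g : T -> R) : compact K ->
  {within K, continuous g} -> exists2 M, 0 <= M & forall y, K y -> `|g y| <= M.
Proof.
move=> cK cg; have [M [_ HM]] : bounded_set (g @` K).
  by apply: compact_bounded; exact: continuous_compact.
exists (`|M| + 1) => [|y Ky]; first by rewrite addr_ge0.
apply: HM; first by rewrite (le_lt_trans (ler_norm M)) ?ltrDl.
by exists y.
Qed.

Lemma segment_bounded (a b : R) (g : R -> R) : {within `[a, b], continuous g} ->
  exists2 M, 0 <= M & forall t, a <= t <= b -> `|g t| <= M.
Proof.
move=> cg; have [M M0 HM] := compact_bounded_fun (@segment_compact R a b) cg.
by exists M => // t tab; apply: HM; rewrite /= in_itv.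
Qed.

Lemma uniform_bound (I : finType) (S : Type) (P : S -> Prop) (g : I -> S -> R) :
  (forall i, exists C, forall s, P s -> g i s <= C) ->
  exists2 C, 0 <= C & forall i s, P s -> g i s <= C.
Proof.
move=> /choice[C HC]; exists (\sum_i `|C i|); first exact: sumr_ge0.
move=> i s Ps; rewrite (le_trans (HC i s Ps))// (le_trans (ler_norm _))//.
by rewrite (bigD1 i)//= lerDl; apply: sumr_ge0.
Qed.

Lemma uniform_bound_nat (n : nat) (S : Type) (P : S -> Prop) (g : nat -> S -> R) :
  (forall i, (i <= n)%N -> exists C, forall s, P s -> g i s <= C) ->
  exists2 C, 0 <= C & forall i s, (i <= n)%N -> P s -> g i s <= C.
Proof.
move=> H; have [i|C C0 HC] := @uniform_bound 'I_n.+1 S P (fun i => g i).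
  by apply: H; rewrite -ltnS.
by exists C => // i s ni; exact: (HC (Ordinal (ni : (i < n.+1)%N))).
Qed.

Lemma within_itv_glue (T : topologicalType) (a b c : R) (g : R -> T) : a <= b -> b <= c ->
  {within `[a, b], continuous g} -> {within `[b, c], continuous g} ->
  {within `[a, c], continuous g}.
Proof.
move=> ab bc; have -> : `[a, c]%classic = `[a, b] `|` `[b, c].
  apply/seteqP; split => t /=; rewrite !in_itv/=.
    by move=> /andP[-> ->]; have [tb|tb] := leP t b; [left|right; rewrite ltW].
  move=> [/andP[-> tb]|/andP[bt ->]]; first by rewrite (le_trans tb).
  by rewrite andbT (le_trans ab).
by apply: withinU_continuous; exact: interval_closed.
Qed.

Lemma near_neq (t T : R) : t != T -> \forall s \near t, s != T.
Proof.
move=> tT; have : nbhs t [set~ T].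
  apply: open_nbhs_nbhs; split; last exact/eqP.
  by apply: closed_openC; exact: closed_eq.
by apply: filterS => s /eqP.
Qed.

(** Cousin's principle.  The step allows [u] and [v] on both sides of [s], so that it
can be applied at the supremum [s] of the points already reached. *)
Lemma interval_induction (a b : R) (P : R -> Prop) : a <= b -> P a ->
  (forall s, a <= s <= b -> exists2 eta, 0 < eta &
     forall u v, a <= u -> u <= s -> s <= v -> v <= b ->
       s - eta < u -> v < s + eta -> P u -> P v) ->
  P b.
Proof.
move=> ab Pa step.
pose S := [set s | a <= s <= b /\ P s].
have Sa : S a by split => //; rewrite lexx ab.
have hS : has_sup S by split; [exists a|exists b => s [/andP[]]].
set s := sup S.
have as_ : a <= s by apply: ub_le_sup => //; case: hS.
have sb : s <= b by apply: ge_sup; [exists a|move=> x [/andP[]]].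
have [|eta eta0 H] := step s; first by rewrite as_.
have [u [/andP[au ub] Pu] su] := sup_adherent eta0 hS.
have us : u <= s by apply: ub_le_sup; [case: hS|split => //; rewrite au].
have eta2 : 0 < eta / 2 by rewrite divr_gt0.
pose v := Num.min b (s + eta / 2).
have sv : s <= v by rewrite /v le_min sb lerDl ltW.
have vb : v <= b by rewrite /v ge_min lexx.
have Pv : P v.
  apply: (H u v) => //; rewrite /v gt_min; apply/orP; right.
  by rewrite ltrD2l ltr_pdivrMr// mulr_natr mulr2n ltrDl.
have : v <= s by apply: ub_le_sup; [case: hS|split => //; rewrite (le_trans as_)].
rewrite /v ge_min => /orP[bs|]; last by rewrite gerDl leNgt eta2.
suff -> : b = v by [].
by apply/eqP; rewrite eq_le vb andbT (le_trans bs).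
Qed.

(** One coordinate of [abs_continuous]. *)
Definition acs (a b : R) (g : R -> R) : Prop :=
  forall eps : R, 0 < eps -> exists2 delta : R, 0 < delta &
    forall (k : nat) (lo hi : nat -> R),
      (forall i, (i < k)%N -> a <= lo i /\ lo i <= hi i /\ hi i <= b) ->
      (forall i, (i.+1 < k)%N -> hi i <= lo i.+1) ->
      \sum_(i < k) (hi i - lo i) < delta ->
      \sum_(i < k) `|g (hi i) - g (lo i)| < eps.

(** The quotient of [g] over an interval containing [s] is a convex combination of
the two one-sided quotients at [s], which are at most [l + eps]. *)
Lemma derive_straddle (g : R -> R) (s l eps : R) : is_derive s 1 g l ->
  l <= 0 -> 0 < eps -> exists2 eta, 0 < eta &
    forall u v, u <= s -> s <= v -> s - eta < u -> v < s + eta ->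
      g v - g u <= eps * (v - u).
Proof.
move=> [dg gl] l0 e0.
have : (fun h => h^-1 *: (g (h *: 1 + s) - g s)) @ 0^' --> l.
  by rewrite -gl; exact: dg.
move=> /cvgrPdist_lt /(_ _ e0) /nbhs_ballP[eta /= eta0 H].
have key h : `|h| < eta -> h != 0 -> h^-1 * (g (h + s) - g s) <= eps.
  move=> he h0; have := H h; rewrite /ball/= sub0r normrN => /(_ he h0).
  rewrite /GRing.scale/= mulr1 distrC => /(le_lt_trans (ler_norm _)) /ltW.
  by rewrite lerBlDr => /le_trans; apply; rewrite gerDl.
exists eta => // u v us sv su sve.
have h1 : g v - g s <= eps * (v - s).
  move: sv; rewrite le_eqVlt => /orP[/eqP ->|sv]; first by rewrite !subrr mulr0.
  have vs0 : 0 < v - s by rewrite subr_gt0.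
  have := key (v - s); rewrite gtr0_norm// ltrBlDl => /(_ sve).
  by rewrite gt_eqF// => /(_ isT); rewrite subrK mulrC ler_pdivrMr.
have h2 : g s - g u <= eps * (s - u).
  move: us; rewrite le_eqVlt => /orP[/eqP ->|us]; first by rewrite !subrr mulr0.
  have vs0 : u - s < 0 by rewrite subr_lt0.
  have := key (u - s); rewrite ltr0_norm// opprB ltrBlDr -ltrBlDl => /(_ su).
  rewrite lt_eqF// => /(_ isT); rewrite subrK mulrC ler_ndivrMr//.
  by rewrite -lerN2 opprB -mulrN opprB.
by rewrite -[g v](subrK (g s)) -addrA (le_trans (lerD h1 h2))// -mulrDr addrA subrK.
Qed.

(** Points of differentiability are passed by [derive_straddle].  The exceptional
null set is covered by an open set of measure less than [delta], so that absolute
continuity controls the increments spent on it; interval induction adds up both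
contributions. *)
Lemma acs_le (a b : R) (g : R -> R) : a <= b -> acs a b g ->
  {ae mu, forall t, a < t < b -> exists2 l, is_derive t 1 g l & l <= 0} ->
  g b <= g a.
Proof.
move=> ab acg [Z [mZ Z0 hZ]].
apply/ler_addgt0Pr => e0 e00.
have [delta d0 Hd] := acg _ (divr_gt0 e00 (ltr0n R 2)).
pose eps := e0 / 2 / (b - a + 1).
have ba1 : 0 < b - a + 1 by rewrite ltr_wpDl ?subr_ge0.
have eps0 : 0 < eps by rewrite divr_gt0 // divr_gt0.
pose E := Z `|` [set a] `|` [set b].
have mE : measurable E by apply: measurableU => //; apply: measurableU.
have E0 : mu.-negligible E.
  apply: negligibleU; first apply: negligibleU.
  - exact/negligibleP.
  - by apply/negligibleP => //; exact: lebesgue_measure_set1.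
  - by apply/negligibleP => //; exact: lebesgue_measure_set1.
have [U [oU EU Ud]] : exists U, [/\ open U, E `<=` U & (mu U < delta%:E)%E].
  have muE : mu E = 0%E by apply/negligibleP.
  have [|U [oU EU mUE]] := @lebesgue_regularity_outer _ E delta mE _ d0.
    by move: muE => /= ->; rewrite ltry.
  exists U; split => //.
  have -> : U = U `\` E `|` E by rewrite setUC setDUK.
  apply: le_lt_trans (measureU2 _ _ _) _ => //.
    by apply: measurableD => //; exact: open_measurable.
  by move: muE => /= ->; rewrite adde0.
have mU : measurable U by exact: open_measurable.
(* The intervals [lo i, hi i] are those spent on the exceptional set up to s. *)
pose P s := exists k (lo hi : nat -> R),
  [/\ forall i, (i < k)%N -> [/\ a <= lo i, lo i <= hi i & hi i <= s],
      forall i, (i.+1 < k)%N -> hi i <= lo i.+1,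
      ((\sum_(i < k) (hi i - lo i))%:E <= mu (U `&` `[a, s[))%E
    & g s - g a <= eps * (s - a) + \sum_(i < k) `|g (hi i) - g (lo i)|].
suff [k [lo [hi [H1 H2 H3 H4]]]] : P b.
  have H : \sum_(i < k) `|g (hi i) - g (lo i)| < e0 / 2.
    apply: Hd => //.
      by move=> i /H1[? ? ?].
    rewrite -lte_fin (le_lt_trans H3)// (le_lt_trans _ Ud)//.
    by apply: le_measure; rewrite ?inE//; apply: measurableI.
  rewrite -lerBlDl (le_trans H4)// [leRHS](splitr e0) lerD ?(ltW H)//.
  rewrite /eps -mulrA ger_pMr ?divr_gt0// ler_pdivrMl// mulr1.
  by rewrite lerDl.
apply: (@interval_induction a b) => //.
  exists 0%N, (fun=> a), (fun=> a); split => //.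
    by rewrite big_ord0.
  by rewrite !subrr mulr0 big_ord0 addr0.
move=> s /andP[as_ sb].
have [Es|nEs] := pselect (E s).
  have [eta /= eta0 He] : nbhs_ball s U by apply/nbhs_ballP; apply: oU; apply: EU.
  exists eta => // u v au us sv vb su sve [k [lo [hi [H1 H2 H3 H4]]]].
  have uvU : `[u, v[ `<=` U.
    move=> z /=; rewrite in_itv/= => /andP[uz zv]; apply: He.
    by rewrite /ball/= ltr_distlC; apply/andP; split;
      [apply: lt_le_trans uz|apply: lt_trans sve].
  exists k.+1, (fun i => if i == k then u else lo i), (fun i => if i == k then v else hi i).
  have uv : u <= v by exact: le_trans sv.
  have E1 : \sum_(i < k) ((if (i == k :> nat) then v else hi i) -
      (if (i == k :> nat) then u else lo i)) = \sum_(i < k) (hi i - lo i).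
    by apply: eq_bigr => i _; rewrite (ltn_eqF (ltn_ord i)).
  have E2 : \sum_(i < k) `|g (if (i == k :> nat) then v else hi i) -
      g (if (i == k :> nat) then u else lo i)| = \sum_(i < k) `|g (hi i) - g (lo i)|.
    by apply: eq_bigr => i _; rewrite (ltn_eqF (ltn_ord i)).
  split.
  - move=> i; case: eqP => [->//|ik]; rewrite ltnS leq_eqVlt => /orP[/eqP//|/H1[? ? ?]].
    by split => //; apply: le_trans uv.
  - move=> i; rewrite ltnS => ik; rewrite (ltn_eqF ik).
    case: eqP => [ik1|/eqP ik1]; first by have [] := H1 _ ik.
    by apply: H2; rewrite ltn_neqAle ik1.
  - rewrite big_ord_recr/= eqxx E1.
    have -> : U `&` `[a, v[ = (U `&` `[a, u[) `|` `[u, v[.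
      rewrite -(setIidr uvU) -setIUr; congr (_ `&` _).
      apply/seteqP; split => z /=; rewrite !in_itv/=.
        by case: (leP u z) => [uz /andP[az zv]|uz /andP[-> _]]; [right|left].
      move=> [/andP[-> zu]|/andP[uz ->]]/=; first exact: lt_le_trans uv.
      by rewrite (le_trans au).
    rewrite measureU//; last 2 first.
    + by apply: measurableI.
    + apply/seteqP; split => // z [[_ /=]]; rewrite !in_itv/= => /andP[_ zu].
      by rewrite leNgt zu.
    rewrite EFinD leeD//; move: (@lebesgue_measure_itv R `[u, v[) => /= ->; rewrite lte_fin.
    move: uv; rewrite le_eqVlt => /orP[/eqP ->|->]; last by rewrite EFinB.
    by rewrite ltxx subrr.
  - rewrite big_ord_recr/= eqxx E2.
    have := ler_norm (g v - g u); have := mulr_ge0 (ltW eps0) (_ : 0 <= v - u).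
    rewrite subr_ge0 => /(_ uv) H5 H6; rewrite mulrBr in H5; rewrite mulrBr in H4.
    rewrite mulrBr; set S1 := \sum_(i < _) _ in H4 *; lra.
have [sa|sa] := eqVneq s a; first by exfalso; apply: nEs; left; right.
have [sb'|sb'] := eqVneq s b; first by exfalso; apply: nEs; right.
have [l dl l0] : exists2 l, is_derive s 1 g l & l <= 0.
  apply: contrapT => nd; apply: nEs; left; left; apply: hZ => /=; apply: contra_not nd.
  by apply; rewrite !lt_neqAle as_ sb sb' eq_sym sa.
have [eta eta0 He] := derive_straddle dl l0 eps0.
exists eta => // u v au us sv vb su sve [k [lo [hi [H1 H2 H3 H4]]]].
exists k, lo, hi; split => //.
- by move=> i /H1[? ? ?]; split => //; apply: le_trans (le_trans us sv).
- apply: le_trans H3 _; apply: le_measure; rewrite ?inE; try by apply: measurableI.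
  apply: setIS => z /=; rewrite !in_itv/= => /andP[-> zu].
  exact: lt_le_trans (le_trans us sv).
- have := He _ _ us sv su sve; rewrite !mulrBr in H4 *; lra.
Qed.
End RealAnalysis.

Section Lip.
Context {R : realType}.
Notation mu := (@lebesgue_measure R).

Lemma aeS (P Q : R -> Prop) : (forall t, P t -> Q t) ->
  {ae mu, forall t, P t} -> {ae mu, forall t, Q t}.
Proof.
move=> PQ [N [mN N0 PN]]; exists N; split => // t nQ; apply: PN => Pt.
exact/nQ/PQ.
Qed.

Lemma aeI (P Q : R -> Prop) :
  {ae mu, forall t, P t} -> {ae mu, forall t, Q t} -> {ae mu, forall t, P t /\ Q t}.
Proof.
move=> [N [mN N0 PN]] [M [mM M0 QM]]; exists (N `|` M); split.
- exact: measurableU.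
- exact: null_set_setU.
- move=> t /not_andP[nP|nQ]; [left; exact: PN|right; exact: QM].
Qed.

Lemma aeS2 (P Q S : R -> Prop) : (forall t, P t -> Q t -> S t) ->
  {ae mu, forall t, P t} -> {ae mu, forall t, Q t} -> {ae mu, forall t, S t}.
Proof. by move=> H /aeI/[apply]; apply: aeS => t [/H]; apply. Qed.

(** The constant is explicit: it is what survives when the interval grows. *)
Definition lipon (a b L : R) (g : R -> R) : Prop :=
  forall s t, a <= s <= b -> a <= t <= b -> `|g t - g s| <= L * `|t - s|.

Lemma liponP (a b L : R) (g : R -> R) :
  (forall s t, a <= s -> s <= t -> t <= b -> `|g t - g s| <= L * (t - s)) ->
  lipon a b L g.
Proof.
move=> H s t /andP[as_ sb] /andP[at_ tb]; have [st|/ltW ts] := leP s t.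
  by rewrite (ger0_norm (_ : 0 <= t - s)) ?subr_ge0// H.
by rewrite distrC (distrC t) (ger0_norm (_ : 0 <= s - t)) ?subr_ge0// H.
Qed.

Lemma lipon_sub (a b L a' b' : R) g : a <= a' -> b' <= b -> lipon a b L g ->
  lipon a' b' L g.
Proof.
move=> aa bb H s t /andP[? ?] /andP[? ?].
by apply: H; apply/andP; split; [exact: le_trans aa _|exact: le_trans bb|
  exact: le_trans aa _|exact: le_trans bb].
Qed.

Lemma lipon_le (a b L L' : R) g : L <= L' -> lipon a b L g -> lipon a b L' g.
Proof.
move=> LL H s t hs ht; apply: le_trans (H _ _ hs ht) _.
by rewrite ler_wpM2r.
Qed.

Lemma lipon_eq (a b L : R) f g : (forall t, a <= t <= b -> f t = g t) ->
  lipon a b L f -> lipon a b L g.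
Proof. by move=> fg H s t hs ht; rewrite -!fg// H. Qed.

Lemma acs_sub (a b a' b' : R) g : a <= a' -> b' <= b -> acs a b g -> acs a' b' g.
Proof.
move=> aa bb H e /H[d d0 Hd]; exists d => // k lo hi H1 H2 H3; apply: Hd => //.
move=> i /H1[? [? ?]]; split; [exact: le_trans aa _|split => //; exact: le_trans bb].
Qed.

Lemma lipon_acs (a b L : R) g : lipon a b L g -> acs a b g.
Proof.
move=> H e e0; pose K := `|L| + 1.
have K0 : 0 < K by rewrite /K ltr_wpDl.
exists (e / K); first by rewrite divr_gt0.
move=> k lo hi H1 _; rewrite ltr_pdivlMr// mulrC => H3; apply: le_lt_trans H3.
rewrite mulr_sumr; apply: ler_sum => i _.
have [l1 [l2 l3]] := H1 i (ltn_ord i).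
apply: le_trans (H (lo i) (hi i) _ _) _.
- by rewrite l1 (le_trans l2).
- by rewrite l3 andbT (le_trans l1).
- rewrite ger0_norm ?subr_ge0// ler_wpM2r ?subr_ge0//.
  by rewrite /K (le_trans (ler_norm _))// lerDl.
Qed.

Lemma acs_affine (a b s M : R) g : acs a b g -> acs a b (fun t => s * g t - M * t).
Proof.
move=> H e e0; pose K := `|s| + 1; pose K' := `|M| + 1.
have K0 : 0 < K by rewrite /K ltr_wpDl.
have K0' : 0 < K' by rewrite /K' ltr_wpDl.
have e2 : 0 < e / 2 by rewrite divr_gt0.
have [d d0 Hd] := H _ (divr_gt0 e2 K0).
exists (Num.min d (e / 2 / K')); first by rewrite lt_min d0 !divr_gt0.
move=> k lo hi H1 H2; rewrite lt_min => /andP[/(Hd _ _ _ H1 H2) H3 H4].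
have : \sum_(i < k) `|s * g (hi i) - M * hi i - (s * g (lo i) - M * lo i)| <=
  K * (\sum_(i < k) `|g (hi i) - g (lo i)|) + K' * (\sum_(i < k) (hi i - lo i)).
  rewrite !mulr_sumr -big_split/=; apply: ler_sum => i _.
  have [l1 [l2 l3]] := H1 i (ltn_ord i).
  have -> : s * g (hi i) - M * hi i - (s * g (lo i) - M * lo i) =
    s * (g (hi i) - g (lo i)) - M * (hi i - lo i) by ring.
  rewrite (le_trans (ler_normB _ _))// !normrM lerD//.
    by rewrite ler_wpM2r// lerDl.
  by rewrite (@ger0_norm _ (hi i - lo i)) ?subr_ge0// ler_wpM2r ?subr_ge0// lerDl.
move=> /le_lt_trans; apply; rewrite [ltRHS]splitr ltrD//.
  by move: H3; rewrite ltr_pdivlMr// mulrC.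
by move: H4; rewrite ltr_pdivlMr// mulrC.
Qed.

Lemma is_derive_affine (t s M l : R) (g : R -> R) : is_derive t 1 g l ->
  is_derive t 1 (fun t => s * g t - M * t) (s * l - M).
Proof.
move=> gl; have : is_derive t (1:R) ((s \*: g) - (M \*: id)) (s *: l - M *: 1).
  by apply: is_deriveB.
by rewrite /GRing.scale/= mulr1.
Qed.

(** [acs_le] for [g - M t] and [- g - M t]. *)
Lemma acs_lipon (a b M : R) g : acs a b g ->
  {ae mu, forall t, a < t < b -> exists2 l, is_derive t 1 g l & `|l| <= M} ->
  lipon a b M g.
Proof.
move=> H1 H2; apply: liponP => s t as_ st tb.
have H3 : forall sg : R, sg = 1 \/ sg = -1 -> sg * g t - M * t <= sg * g s - M * s.
  move=> sg sg1; apply: (@acs_le _ _ _ (fun t => sg * g t - M * t)) => //.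
    by apply: acs_affine; apply: acs_sub H1.
  apply: aeS H2 => z H2 /andP[sz zt].
  have [|l l1 l2] := H2; first by rewrite (le_lt_trans as_)//= (lt_le_trans zt).
  exists (sg * l - M); first exact: is_derive_affine.
  rewrite subr_le0 (le_trans _ l2)//.
  case: sg1 => ->; rewrite ?mul1r ?mulN1r ?ler_norm//.
  by rewrite -normrN ler_norm.
have := H3 1 (or_introl erefl); have := H3 (-1) (or_intror erefl).
rewrite !mul1r !mulN1r ler_norml => ? ?; lra.
Qed.

(** After the last time before [t1] at which [V <= B], the function [V] would have to
cross the band between [B] and [B'], in which it decreases. *)
Lemma barrier (om B B' : R) (V : R -> R) : B < B' ->
  (forall b, 0 <= b < om -> exists L, lipon 0 b L V) ->
  {ae mu, forall t, 0 < t < om -> B < V t < B' ->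
     exists2 l, is_derive t 1 V l & l <= 0} ->
  V 0 <= B -> forall t, 0 <= t < om -> V t <= B.
Proof.
move=> BB lipV dV V0 t1 /andP[t10 t1om].
have [//|Vt1] := leP (V t1) B; exfalso.
have [|L hL] := lipV t1; first by rewrite t10.
pose S := [set s | 0 <= s <= t1 /\ V s <= B].
have S0 : S 0 by split => //; rewrite lexx t10.
have hS : has_sup S by split; [exists 0|exists t1 => s [/andP[]]].
pose t0 := sup S.
have t00 : 0 <= t0 by apply: ub_le_sup => //; case: hS.
have t01 : t0 <= t1 by apply: ge_sup; [exists 0|move=> x [/andP[]]].
pose K := `|L| + 1.
have K0 : 0 < K by rewrite /K ltr_wpDl.
have lipK : lipon 0 t1 K V.
  by apply: lipon_le hL; rewrite (le_trans (ler_norm L))// lerDl.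
have Vt0 : V t0 <= B.
  apply/ler_addgt0Pr => e e0.
  have [u [/andP[u0 ut1] Vu] tu] := sup_adherent (divr_gt0 e0 K0) hS.
  have ut0 : u <= t0 by apply: ub_le_sup; [case: hS|split => //; rewrite u0].
  have := lipK u t0; rewrite u0 ut1 t00 t01 => /(_ isT isT).
  rewrite (ger0_norm (_ : 0 <= t0 - u)) ?subr_ge0//.
  move=> /(le_trans (ler_norm _)); rewrite -/t0 in tu.
  have : t0 - u < e / K by rewrite ltrBlDr addrC -ltrBlDr.
  rewrite ltr_pdivlMr// mulrC => h1 h2.
  by rewrite -lerBlDl (le_trans _ (ltW h1))// (le_trans _ h2)// lerB.
have lt01 : t0 < t1.
  rewrite lt_neqAle t01 andbT; apply/eqP => E; by rewrite E leNgt Vt1 in Vt0.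
have gtB s : t0 < s -> s <= t1 -> B < V s.
  move=> ts st; rewrite ltNge; apply/negP => Vs.
  have : s <= t0 by apply: ub_le_sup; [case: hS|split => //; rewrite (le_trans t00) ?(ltW ts)].
  by rewrite leNgt ts.
pose t2 := Num.min t1 (t0 + (B' - B) / K / 2).
have h0 : 0 < (B' - B) / K / 2 by rewrite !divr_gt0 ?subr_gt0.
have t02 : t0 < t2 by rewrite /t2 lt_min lt01 ltrDl.
have t21 : t2 <= t1 by rewrite /t2 ge_min lexx.
have ltB' s : t0 <= s -> s <= t2 -> V s < B'.
  move=> ts st; have := lipK t0 s; rewrite t00 t01 (le_trans t00)//= (le_trans st)//.
  move=> /(_ isT isT); rewrite (ger0_norm (_ : 0 <= s - t0)) ?subr_ge0//.
  move=> /(le_trans (ler_norm _)) h1.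
  have : s <= t0 + (B' - B) / K / 2 by rewrite (le_trans st)// /t2 ge_min lexx orbT.
  rewrite -lerBlDl => h2.
  have : K * (s - t0) <= (B' - B) / 2.
    rewrite (le_trans (ler_wpM2l (ltW K0) h2))//.
    by rewrite mulrA mulrCA divff ?mulr1 ?gt_eqF.
  lra.
have : V t2 <= V t0.
  apply: acs_le (ltW t02) _ _.
    by apply: (@lipon_acs _ _ K); apply: lipon_sub lipK.
  apply: aeS dV => s dV /andP[ts st]; apply: dV.
    by rewrite (le_lt_trans t00)//= (lt_le_trans st)// (le_trans t21)// ltW.
  rewrite gtB ?ltB' ?(ltW st) ?(ltW ts)//.
  by rewrite (le_trans (ltW st)).
by move=> /le_trans /(_ Vt0); rewrite leNgt gtB.
Qed.

Lemma lipon_cont (a b L : R) g : lipon a b L g -> {within `[a, b], continuous g}.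
Proof.
move=> H; apply/subspace_continuousP => /= x; rewrite in_itv/= => xab.
apply/cvgrPdist_le => /= e e0; pose K := `|L| + 1.
have K0 : 0 < K by rewrite /K ltr_wpDl.
rewrite near_withinE; near=> t => tI.
have tab : a <= t <= b by move: tI; rewrite /= in_itv.
rewrite (le_trans (H t x _ _))//.
apply: (@le_trans _ _ (K * `|x - t|)).
  by rewrite ler_wpM2r// (le_trans (ler_norm L))// lerDl.
rewrite -ler_pdivlMl// mulrC; near: t; apply: cvgr_dist_le; last by rewrite divr_gt0.
exact: cvg_id.
Unshelve. all: by end_near. Qed.

End Lip.

(** * Primitives and derivatives almost everywhere *)

Import HBNNSimple.

Section Integral.
Context {R : realType}.
Notation mu := (@lebesgue_measure R).
Implicit Types (f : R -> R) (A : set R).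

Lemma bdd_integrable (A : set R) (M : R) (f : R -> R) : measurable A -> (mu A < +oo)%E ->
  measurable_fun A f -> (forall t, A t -> `|f t| <= M) ->
  mu.-integrable A (EFin \o f).
Proof.
move=> mA Aoo mf fM; apply: measurable_bounded_integrable => //.
exists M; split; first exact: num_real.
by move=> x Mx t /fM /le_trans; apply; exact: ltW.
Qed.

Lemma mu_itv (b1 b2 : bool) (s t : R) : s <= t ->
  mu [set` Interval (BSide b1 s) (BSide b2 t)] = (t - s)%:E.
Proof.
move=> st; rewrite lebesgue_measure_itv/= lte_fin.
by move: st; rewrite le_eqVlt => /orP[/eqP ->|->//]; rewrite ltxx subrr.
Qed.

Lemma Rintegral_le_bound (A : set R) (M : R) (f : R -> R) : measurable A -> (mu A < +oo)%E ->
  measurable_fun A f -> (forall t, A t -> `|f t| <= M) ->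
  `|\int[mu]_(t in A) f t| <= M * fine (mu A).
Proof.
move=> mA Aoo mf fM; have fi := bdd_integrable mA Aoo mf fM.
rewrite (le_trans (le_normr_Rintegral _ fi))// -Rintegral_cst//.
apply: le_Rintegral => //; last exact: (@bdd_integrable _ `|M|).
by apply: (@bdd_integrable _ M) => //; [exact: measurableT_comp|move=> t /fM; rewrite normr_id].
Qed.

Section Primitive.
Variables (f : R -> R) (a M : R).
Hypotheses (mf : measurable_fun setT f) (fM : forall t, `|f t| <= M).

Definition prim (x : R) := \int[mu]_(t in `[a, x]) f t.

Lemma bdd_integrable_itv (b1 b2 : bool) (s t : R) :
  mu.-integrable [set` Interval (BSide b1 s) (BSide b2 t)] (EFin \o f).
Proof.
apply: (@bdd_integrable _ M) => //.
- rewrite lebesgue_measure_itv/=; case: ifP => _; last exact: ltry.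
  by rewrite -EFinB ltry.
- exact: measurable_funTS.
Qed.

Lemma primB (s t : R) : a <= s -> s <= t ->
  prim t - prim s = \int[mu]_(u in `]s, t]) f u.
Proof.
by move=> as_ st; rewrite /prim Rintegral_itvB//; exact: bdd_integrable_itv.
Qed.

Lemma prim_lipon (b : R) : lipon a b M prim.
Proof.
apply: liponP => s t as_ st tb; rewrite primB//.
apply: le_trans (Rintegral_le_bound _ _ _ _) _.
- by [].
- by rewrite mu_itv// ltry.
- exact: measurable_funTS.
- by move=> u _; exact: fM.
- by rewrite mu_itv.
Qed.

Lemma prim_id : prim a = 0.
Proof. by rewrite /prim set_itv1 Rintegral_set1. Qed.

Lemma prim_derive : {ae mu, forall x, a < x -> is_derive x 1 prim (f x)}.
Proof.
have lf : locally_integrable [set: R] f.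
  split; [exact: mf|exact: openT|] => K _ cK.
  have mK := compact_measurable cK.
  have : mu.-integrable K (EFin \o f).
    apply: (@bdd_integrable _ M) => //; last exact: measurable_funTS.
    exact: compact_finite_measure.
  by move/integrableP => [].
have := @FTC1 R f (BLeft a) (fun y => bdd_integrable_itv true false a y) lf.
apply: aeS => x Hx ax; have [|d1 d2] := Hx; first by rewrite /= lte_fin.
split; [exact: d1|by rewrite -derive1E].
Qed.

End Primitive.

(** A nonnegative simple function below [f] stays below [g] once it is multiplied by
the indicator of the complement of [Z], and keeps its integral.  This covers the
non-measurable functions that are almost everywhere equal to a Borel one. *)
Lemma integral_null_set (f g : R -> \bar R) (Z : set R) : measurable Z -> mu Z = 0%E ->
  (forall t, ~ Z t -> f t = g t) -> (\int[mu]_t f t = \int[mu]_t g t)%E.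
Proof.
move=> mZ Z0.
have key (f1 g1 : R -> \bar R) : (forall t, 0 <= f1 t)%E -> (forall t, 0 <= g1 t)%E ->
  (forall t, ~ Z t -> f1 t = g1 t) -> (\int[mu]_t f1 t <= \int[mu]_t g1 t)%E.
  move=> f0 g0 fg; rewrite [leLHS]ge0_integralTE//.
  apply: ge_ereal_sup => _ [h hf <-].
  pose h' := proj_nnsfun h (measurableC mZ).
  have h'E t : h' t = (h t * \1_(~` Z) t :> R)%R by rewrite /h' /= mindicE indicE.
  have -> : sintegral mu h = sintegral mu h'.
    rewrite -2!integralT_nnsfun; apply: ge0_ae_eq_integral => //.
    - exact/measurable_EFinP.
    - exact/measurable_EFinP.
    - by move=> t _; rewrite lee_fin.
    - by move=> t _; rewrite lee_fin.
    exists Z; split => // t /= H; apply: contrapT => nZ; apply: H => _.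
    by apply: (congr1 EFin); apply: esym; apply: (etrans (h'E t)); rewrite indicE mem_set// mulr1.
  rewrite ge0_integralTE//; apply: ereal_sup_ubound; exists h' => // t.
  rewrite [X in X%:E](h'E t) indicE; have [Zt|nZ] := pselect (Z t).
    by rewrite memNset ?mulr0//; apply/not_notP.
  by rewrite mem_set// mulr1 -fg.
move=> fg.
rewrite integralE [RHS]integralE; congr (_ - _)%E; apply/eqP; rewrite eq_le; apply/andP; split;
  apply: key => // t /fg E; by rewrite ?funeposE ?funenegE E.
Qed.

Lemma Rintegral_ae_eq (A : set R) (f g : R -> R) :
  {ae mu, forall t, A t -> f t = g t} ->
  \int[mu]_(t in A) f t = \int[mu]_(t in A) g t.
Proof.
move=> [Z [mZ Z0 fg]]; rewrite Rintegral_mkcond [RHS]Rintegral_mkcond /Rintegral; congr fine.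
apply: (integral_null_set mZ Z0) => t nZ; rewrite !patchE; case: ifPn => // At.
congr EFin; apply: contrapT => nfg; apply: nZ; apply: fg => /= H.
by apply: nfg; apply: H; exact: set_mem.
Qed.

(** The derivative of a continuous function, where it exists, is a limit of
difference quotients. *)
Lemma derive_measurable (g k : R -> R) (A : set R) : continuous g ->
  {ae mu, forall t, A t -> is_derive t 1 g (k t)} -> measurable A ->
  exists k' : R -> R, [/\ measurable_fun setT k', {ae mu, forall t, A t -> k t = k' t}
    & forall t, k' t = 0 \/ (A t /\ is_derive t 1 g (k' t))].
Proof.
move=> cg [Z [mZ Z0 H]] mA.
pose k' := k \_ (A `\` Z); exists k'.
have k'P t : k' t = 0 \/ (A t /\ is_derive t 1 g (k' t)).
  rewrite /k' patchE; case: ifPn => [/set_mem[At nZ]|]; [right|by left].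
  split => //; apply: contrapT => nd; apply: nZ; apply: H => /= H'.
  exact/nd/H'.
split => //; last first.
  exists Z; split => // t /= nE; apply: contrapT => nZ; apply: nE => At.
  by rewrite /k' patchE mem_set.
pose h (n : nat) : R := n.+1%:R^-1.
have h0 n : 0 < h n by rewrite invr_gt0.
pose q n := (fun t => (h n)^-1 * (g (h n + t) - g t)) \_ (A `\` Z).
have mAZ : measurable (A `\` Z) by exact: measurableD.
apply: (@measurable_fun_cvg _ _ R setT q).
  move=> n; apply/(measurable_restrictT _ mAZ); apply: measurable_funTS.
  apply: measurable_funM => //; apply: measurable_funB.
    apply: continuous_measurable_fun => x; apply: continuous_comp; last exact: cg.
    by apply: cvgD; [exact: cvg_cst|exact: cvg_id].
  exact: continuous_measurable_fun.
move=> t _; rewrite /q /k' /=.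
have [AZ|nAZ] := pselect ((A `\` Z) t); last first.
  rewrite [X in _ --> X]patchE memNset//.
  under eq_fun do rewrite patchE memNset//.
  exact: cvg_cst.
rewrite [X in _ --> X]patchE mem_set//.
under eq_fun do rewrite patchE mem_set//.
have [dg gk] : is_derive t 1 g (k t).
  case: AZ => At nZ; apply: contrapT => nd; apply: nZ; apply: H => /= H'.
  exact/nd/H'.
have hh : h @ \oo --> (0:R)^'.
  move=> P /nbhs_ballP[e /= e0 eP].
  have /cvgrPdist_lt /(_ _ e0) := @cvg_harmonic R.
  by apply: filterS => n He; apply: eP => //; rewrite gt_eqF// h0.
have : (fun h => h^-1 *: (g (h *: 1 + t) - g t)) @ 0^' --> k t.
  by rewrite -gk; exact: dg.
move=> /(cvg_comp _ _ hh); rewrite /comp/= /GRing.scale/=.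
by under eq_fun do rewrite mulr1.
Unshelve. all: by end_near. Qed.

End Integral.

Section LipFTC.
Context {R : realType}.
Notation mu := (@lebesgue_measure R).

Definition lipx (a b : R) (g : R -> R) := exists L, lipon a b L g.

Lemma lipx_ge0 (a b : R) g : lipx a b g -> exists2 L, 0 <= L & lipon a b L g.
Proof.
by move=> [L HL]; exists `|L| => //; apply: lipon_le HL; exact: ler_norm.
Qed.

Lemma lipx_cst (a b k : R) : lipx a b (fun=> k).
Proof. by exists 0 => s t _ _; rewrite subrr normr0 mul0r. Qed.

Lemma lipx_eq (a b : R) f g : (forall t, a <= t <= b -> f t = g t) ->
  lipx a b f -> lipx a b g.
Proof. by move=> fg [L HL]; exists L; exact: lipon_eq HL. Qed.

Lemma lipx_sub (a b a' b' : R) g : a <= a' -> b' <= b -> lipx a b g -> lipx a' b' g.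
Proof. by move=> aa bb [L HL]; exists L; exact: lipon_sub HL. Qed.

Lemma lipx_bdd (a b : R) g : lipx a b g ->
  exists2 M, 0 <= M & forall t, a <= t <= b -> `|g t| <= M.
Proof.
move=> /lipx_ge0[L L0 HL]; exists (`|g a| + L * `|b - a|).
  by rewrite addr_ge0// mulr_ge0.
move=> t /andP[at_ tb]; have ab := le_trans at_ tb.
rewrite -[g t](subrK (g a)) addrC (le_trans (ler_normD _ _))// lerD//.
apply: le_trans (HL _ _ _ _) _; rewrite ?lexx ?at_ ?ab//.
by rewrite ler_wpM2l// !ger0_norm ?subr_ge0// lerB.
Qed.

Lemma lipx_add (a b : R) f g : lipx a b f -> lipx a b g ->
  lipx a b (fun t => f t + g t).
Proof.
move=> [L HL] [K HK]; exists (L + K) => s t hs ht.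
rewrite opprD addrACA (le_trans (ler_normD _ _))// mulrDl lerD//; [exact: HL|exact: HK].
Qed.

Lemma lipx_mul (a b : R) f g : lipx a b f -> lipx a b g ->
  lipx a b (fun t => f t * g t).
Proof.
move=> lf lg; have [M M0 HM] := lipx_bdd lf; have [M' M0' HM'] := lipx_bdd lg.
have [L L0 HL] := lipx_ge0 lf; have [K K0 HK] := lipx_ge0 lg.
exists (M * K + M' * L) => s t hs ht.
have -> : f t * g t - f s * g s = f t * (g t - g s) + g s * (f t - f s) by ring.
rewrite (le_trans (ler_normD _ _))// !normrM mulrDl -!mulrA.
by rewrite lerD// ler_pM// ?HM ?HM' ?HL ?HK.
Qed.

Lemma lipx_opp (a b : R) f : lipx a b f -> lipx a b (fun t => - f t).
Proof.
by move=> [L HL]; exists L => s t hs ht; rewrite -opprD normrN HL.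
Qed.

Lemma lipx_sum (a b : R) (I : Type) (r : seq I) (F : I -> R -> R) :
  (forall i, lipx a b (F i)) -> lipx a b (fun t => \sum_(i <- r) F i t).
Proof.
move=> H; elim: r => [|i r IH].
  by apply: lipx_eq (lipx_cst a b 0) => t _; rewrite big_nil.
apply: lipx_eq (lipx_add (H i) IH) => t _; by rewrite big_cons.
Qed.

Lemma lipx_comp (a b c d : R) (f h : R -> R) : lipx a b f -> lipx c d h ->
  (forall t, a <= t <= b -> c <= f t <= d) -> lipx a b (fun t => h (f t)).
Proof.
move=> [L HL] /lipx_ge0[K K0 HK] fcd; exists (K * L) => s t hs ht.
rewrite (le_trans (HK _ _ (fcd _ hs) (fcd _ ht)))// -mulrA ler_wpM2l//.
exact: HL.
Qed.

Lemma lipx_C1 (a b M : R) (g k : R -> R) : {within `[a, b], continuous g} ->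
  (forall t, a < t < b -> is_derive t 1 g (k t)) ->
  (forall t, a <= t <= b -> `|k t| <= M) -> lipx a b g.
Proof.
move=> cg dg kM; exists M; apply: liponP => s t as_ st tb.
have [||c] := @MVT_segment R g k s t st.
- move=> x; rewrite in_itv/= => /andP[sx xt]; apply: dg.
  by rewrite (le_lt_trans as_)//= (lt_le_trans xt).
- apply: continuous_subspaceW cg => z /=; rewrite !in_itv/= => /andP[sz zt].
  by rewrite (le_trans as_)//= (le_trans zt).
rewrite in_itv/= => /andP[sc ct] ->.
rewrite normrM (ger0_norm (_ : 0 <= t - s)) ?subr_ge0// ler_wpM2r ?subr_ge0//.
by apply: kM; rewrite (le_trans as_)//= (le_trans ct).
Qed.

Lemma derive_lip_bound (a b L t l : R) g : lipon a b L g -> a < t < b ->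
  is_derive t 1 g l -> `|l| <= L.
Proof.
move=> HL /andP[at_ tb] [dg gl].
have : (fun h => h^-1 *: (g (h *: 1 + t) - g t)) @ 0^' --> l.
  by rewrite -gl; exact: dg.
move=> /cvgrPdist_lt H; apply/ler_addgt0Pr => e e0.
have [h [[/= h0 ha hb] H1]] : exists h, [/\ h != 0, a < h + t & h + t < b] /\
    `|l - h^-1 *: (g (h *: 1 + t) - g t)| < e.
  have /nbhs_ballP[eta /= eta0 H1] := H _ e0.
  pose h := Num.min (eta / 2) ((b - t) / 2).
  have h0 : 0 < h by rewrite /h lt_min !divr_gt0// subr_gt0.
  have h1 : h <= eta / 2 by rewrite /h ge_min lexx.
  have h2 : h <= (b - t) / 2 by rewrite /h ge_min lexx orbT.
  exists h; split; first by split; [rewrite gt_eqF|lra|lra].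
  apply: H1; last by rewrite gt_eqF.
  rewrite /ball/= sub0r normrN gtr0_norm//; lra.
have -> : l = (l - h^-1 *: (g (h *: 1 + t) - g t)) + h^-1 *: (g (h *: 1 + t) - g t).
  by rewrite subrK.
rewrite (le_trans (ler_normD _ _))// addrC lerD ?(ltW H1)//.
rewrite /GRing.scale/= mulr1 normrM normfV ler_pdivrMl ?normr_gt0// mulrC.
have := HL t (h + t); rewrite addrK; apply; by rewrite !ltW.
Qed.

(** Projection onto a segment, by which functions on the segment are extended to the
line without losing continuity. *)
Definition clampr (a b t : R) := Num.max a (Num.min b t).

Lemma clamp_itv (a b t : R) : a <= b -> a <= clampr a b t <= b.
Proof. by move=> ab; rewrite /clampr le_max lexx ge_max ab ge_min lexx. Qed.

Lemma clamp_id (a b t : R) : a <= t <= b -> clampr a b t = t.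
Proof. by move=> /andP[? ?]; rewrite /clampr min_r// max_r. Qed.

Lemma clamp_continuous (a b : R) : continuous (clampr a b).
Proof.
move=> t; apply: (@continuous_max _ _ (fun=> a) (fun t => Num.min b t)).
  exact: cvg_cst.
by apply: (@continuous_min _ _ (fun=> b) id); [exact: cvg_cst|exact: cvg_id].
Qed.

Lemma within_clamp_continuous (T : topologicalType) (a b : R) (g : R -> T) : a <= b ->
  {within `[a, b], continuous g} -> continuous (g \o clampr a b).
Proof.
move=> ab /subspace_continuousP cg t; have tab := clamp_itv t ab.
have := cg (clampr a b t); rewrite /= in_itv/= => /(_ tab) H.
apply: cvg_trans H => /= P; rewrite /within/= => HP.
have H3 : \forall s \near t, clampr a b s \in `[a, b] -> P (g (clampr a b s)).
  exact: (@clamp_continuous a b t _ HP).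
by apply: filterS H3 => s; apply; rewrite in_itv/= clamp_itv.
Qed.

(** [g] and the primitive of a measurable version [k'] of its derivative differ by a
Lipschitz function with derivative 0 almost everywhere, hence by a constant
([acs_lipon] with bound 0). *)
Lemma lip_ftc (a b L : R) (g k : R -> R) : a <= b -> lipon a b L g ->
  {ae mu, forall t, a < t < b -> is_derive t 1 g (k t)} ->
  \int[mu]_(t in `[a, b]) k t = g b - g a /\
  exists k' : R -> R, [/\ measurable_fun setT k', forall t, `|k' t| <= `|L|
    & {ae mu, forall t, a < t < b -> k t = k' t}].
Proof.
move=> ab; rewrite le_eqVlt in ab; case/predU1P: ab => [<-|ab] HL dg.
  rewrite set_itv1 Rintegral_set1 subrr; split => //.
  exists (fun=> 0); split => //; first by move=> t; rewrite normr0.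
  by apply: aeW => t /andP[/lt_trans/[apply]]; rewrite ltxx.
have near_eq (h : R -> R) t : a < t < b -> \near t, (h \o clampr a b) t = h t.
  move=> /andP[at_ tb]; near=> s; rewrite /= clamp_id//.
  by apply/andP; split; apply: ltW; near: s; [exact: lt_nbhsr|exact: lt_nbhsl].
have cg : continuous (g \o clampr a b).
  by apply: within_clamp_continuous (ltW ab) _; exact: lipon_cont HL.
have dg' : {ae mu, forall t, `]a, b[%classic t -> is_derive t 1 (g \o clampr a b) (k t)}.
  apply: aeS dg => t H; rewrite /= in_itv/= => tab.
  apply: near_eq_is_derive (H tab).
  by apply: filterS (near_eq g _ tab) => s ->.
have [k' [mk' kk' k'P]] := derive_measurable cg dg' (measurable_itv _).
have k'L t : `|k' t| <= `|L|.
  have [->|[/=]] := k'P t; first by rewrite normr0.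
  rewrite in_itv/= => tab dk; apply: le_trans (ler_norm L).
  apply: (derive_lip_bound HL tab).
  by apply: near_eq_is_derive dk; exact: (near_eq g).
have kk'2 : {ae mu, forall t, a < t < b -> k t = k' t}.
  by apply: aeS kk' => t H tab; apply: H; rewrite /= in_itv.
split; last by exists k'.
have -> : \int[mu]_(t in `[a, b]) k t = prim k' a b.
  apply: Rintegral_ae_eq.
  have aea (x : R) : {ae mu, forall t, t <> x}.
    exists [set x]; split => //; first exact: lebesgue_measure_set1.
    by move=> t /= /contrapT.
  have : {ae mu, forall t, t <> a /\ t <> b} by apply: aeI; exact: aea.
  apply: aeS2 kk'2 => t H [/eqP ta /eqP tb]; rewrite /= in_itv/= => /andP[at_ tb'].
  by apply: H; rewrite !lt_neqAle at_ tb' tb eq_sym ta.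
have lw : lipon a b 0 (fun t => g t + - prim k' a t).
  have [K HK] : lipx a b (fun t => g t + - prim k' a t).
    apply: lipx_add; first by exists L.
    by apply: lipx_opp; exists `|L|; exact: prim_lipon.
  apply: acs_lipon (lipon_acs HK) _.
  have := @prim_derive R k' a `|L| mk' k'L.
  apply: aeS2 (aeI dg kk'2) => t [H1 H2] H3 tab.
  exists 0; last by rewrite normr0.
  have at_ : a < t by case/andP: tab.
  have -> : (0:R) = k t + - k' t by rewrite H2// subrr.
  by apply: is_deriveD (H1 tab) (is_deriveN (H3 at_)).
have := lw a b; rewrite !lexx (ltW ab) mul0r prim_id subr0 => /(_ isT isT).
rewrite normr_le0 subr_eq0 subr_eq => /eqP ->.
by rewrite addrC addKr.
Unshelve. all: by end_near. Qed.

End LipFTC.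

(** * Weak derivatives *)

Section Weak.
Context {R : realType}.
Notation mu := (@lebesgue_measure R).

(** One coordinate of [weak_deriv]. *)
Definition sweak (A : set R) (g k : R -> R) := forall psi : R -> R, test_fun A psi ->
  \int[mu]_(t in A) (g t * derive1 psi t) = - \int[mu]_(t in A) (k t * psi t).

Lemma interior_sub_itv (A : set R) (a b t : R) : A `<=` `[a, b] -> interior A t -> a < t < b.
Proof.
move=> Aab /nbhs_ballP[e /= e0 eA].
have e2 : 0 < e / 2 by rewrite divr_gt0.
have e2e : e / 2 < e by lra.
have /= := Aab _ (eA (t - e / 2) _).
have /= := Aab _ (eA (t + e / 2) _).
rewrite /ball/= opprD !addrA subrr sub0r normrN opprB addrCA subrr addr0.
rewrite gtr0_norm// => /(_ e2e); rewrite in_itv/= => /andP[? ?] /(_ e2e).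
by rewrite in_itv/= => /andP[? ?]; apply/andP; split; lra.
Qed.

Lemma test_fun_props (A : set R) (a b : R) (psi : R -> R) : A `<=` `[a, b] ->
  test_fun A psi ->
  [/\ forall t : R, is_derive t 1 psi (derive1 psi t), lipx a b psi,
      forall t, ~ A t -> psi t = 0 /\ derive1 psi t = 0, psi a = 0 & psi b = 0].
Proof.
move=> Aab [dpsi cpsi [K [cK KA psi0]]].
have D (t : R) : is_derive t 1 psi (derive1 psi t) by rewrite derive1E; exact: derivableP.
have Kab t : K t -> a < t < b by move=> /KA; exact: interior_sub_itv.
split => //.
- have [M _ HM] := segment_bounded (@continuous_subspaceT _ _ `[a, b]%classic _ cpsi).
  apply: (@lipx_C1 _ a b M psi (derive1 psi)) => //.
  apply: continuous_subspaceT => t; apply: differentiable_continuous.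
  exact/derivable1_diffP.
- move=> t nA; have nK : ~ K t by move=> /KA /interior_subset.
  split; first exact: psi0.
  have := D t; suff : is_derive t 1 psi 0.
    by move=> [_ <-] [_ <-].
  have oK : open (~` K) by apply: closed_openC; exact: compact_closed.
  apply: (@near_eq_is_derive _ _ _ (fun=> 0) psi t 1 0).
    have : \near t, (~` K) t by exact: oK.
    by apply: filterS => s /psi0 ->.
- by apply: psi0 => /Kab; rewrite ltxx.
- by apply: psi0 => /Kab; rewrite ltxx andbF.
Qed.

Lemma Rintegral_sub (A B : set R) (F : R -> R) : A `<=` B ->
  (forall t, ~ A t -> F t = 0) -> \int[mu]_(t in A) F t = \int[mu]_(t in B) F t.
Proof.
move=> AB F0; rewrite Rintegral_mkcond [RHS]Rintegral_mkcond; congr Rintegral.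
apply/funext => t; rewrite !patchE; have [At|nA] := pselect (A t).
  by rewrite !mem_set//; exact: AB.
by rewrite memNset// F0//; case: ifP.
Qed.

Lemma within_integrable (a b : R) (g : R -> R) : {within `[a, b], continuous g} ->
  mu.-integrable `[a, b] (EFin \o g).
Proof. by move=> cg; apply: continuous_compact_integrable => //; exact: segment_compact. Qed.

Lemma within_contM (A : set R) (f g : R -> R) : {within A, continuous f} ->
  {within A, continuous g} -> {within A, continuous (fun t => f t * g t)}.
Proof. by move=> cf cg t; apply: cvgM; [exact: cf|exact: cg]. Qed.

(** Integration by parts, that is, [lip_ftc] for [g * psi], which vanishes at both
ends of the segment. *)
Lemma lip_sweak (A : set R) (a b : R) (g k : R -> R) : a <= b -> A `<=` `[a, b] ->
  lipx a b g -> {ae mu, forall t, a < t < b -> is_derive t 1 g (k t)} ->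
  sweak A g k.
Proof.
move=> ab Aab lg dg psi tpsi.
have [D lpsi psi0 psia psib] := test_fun_props Aab tpsi.
have [L HL] := lg.
have [_ [k' [mk' k'L kk']]] := lip_ftc ab HL dg.
have aeAB : {ae mu, forall t, t <> a /\ t <> b}.
  have aea (x : R) : {ae mu, forall t, t <> x}.
    exists [set x]; split => //; first exact: lebesgue_measure_set1.
    by move=> t /= /contrapT.
  by apply: aeI; exact: aea.
rewrite (Rintegral_sub Aab); last by move=> t /psi0[_ ->]; rewrite mulr0.
rewrite (@Rintegral_sub A _ (fun t => k t * psi t) Aab); last first.
  by move=> t /psi0[-> _]; rewrite mulr0.
have -> : \int[mu]_(t in `[a, b]) (k t * psi t) = \int[mu]_(t in `[a, b]) (k' t * psi t).
  apply: Rintegral_ae_eq; apply: aeS2 aeAB kk' => t [/eqP ta /eqP tb] H.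
  rewrite /= in_itv/= => /andP[at_ tb']; rewrite H//.
  by rewrite !lt_neqAle at_ tb' tb eq_sym ta.
have cpsi' : {within `[a, b], continuous (derive1 psi)}.
  by apply: continuous_subspaceT; case: tpsi.
have cg : {within `[a, b], continuous g} by exact: lipon_cont HL.
have [K HK] := lpsi.
have [M M0 HM] := lipx_bdd lpsi.
have i2 : mu.-integrable `[a, b] (EFin \o (fun t => k' t * psi t)).
  apply: (@bdd_integrable _ _ (`|L| * M)) => //.
  - by rewrite mu_itv// ltry.
  - apply: measurable_funM; first exact: measurable_funTS.
    apply: subspace_continuous_measurable_fun => //; exact: lipon_cont HK.
  - by move=> t /=; rewrite in_itv/= => tab; rewrite normrM ler_pM// HM.
have i1 : mu.-integrable `[a, b] (EFin \o (fun t => g t * derive1 psi t)).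
  by apply: within_integrable; exact: within_contM.
apply/eqP; rewrite -subr_eq0 opprK -RintegralD//.
have [J HJ] := lipx_mul lg lpsi.
have [|-> _] := @lip_ftc _ a b J (fun t => g t * psi t)
   (fun t => g t * derive1 psi t + k' t * psi t) ab HJ.
  apply: aeS2 dg kk' => t H1 H2 tab.
  have := is_deriveM (H1 tab) (D t); rewrite /GRing.scale/= H2// => H.
  by rewrite [k' t * _]mulrC.
by rewrite psia psib !mulr0 subrr.
Qed.

End Weak.

Section DuBoisReymond.
Context {R : realType}.
Notation mu := (@lebesgue_measure R).

Definition posp (y : R) : R := Num.max 0 y.

Lemma is_derive_posp2 (y : R) : is_derive y 1 (fun y => posp y ^+ 2) (2 * posp y).
Proof.
have key h : `|posp (y + h) ^+ 2 - posp y ^+ 2 - 2 * posp y * h| <= h ^+ 2.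
  rewrite /posp ler_norml; apply/andP.
  by case: (leP 0 y) => y0; case: (leP 0 (y + h)) => yh; split; nra.
have cv : (fun h => h^-1 *: (posp (h *: 1 + y) ^+ 2 - posp y ^+ 2)) @ 0^' --> 2 * posp y.
  apply/cvgrPdist_le => e e0; apply/nbhs_ballP; exists e => //= h.
  rewrite /ball/= sub0r normrN => he h0.
  have := key h; rewrite /GRing.scale/= mulr1 (addrC h).
  set X := posp (y + h) ^+ 2; set Y := posp y => H.
  have -> : 2 * Y - h^-1 * (X - Y ^+ 2) = - h^-1 * (X - Y ^+ 2 - 2 * Y * h) by field.
  rewrite normrM normrN normfV ler_pdivrMl ?normr_gt0//.
  rewrite (le_trans H)// -real_normK ?num_real// expr2.
  by rewrite ler_wpM2l// ltW.
split; first by apply/cvg_ex; exists (2 * posp y); exact: cv.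
by apply/cvg_lim => //; exact: cv.
Qed.

(** A quadratic spline rising from 0 to [2 * eta ^+ 2] on [0, 2 * eta]; its derivative
is a tent. *)
Definition ramp (eta y : R) : R :=
  posp y ^+ 2 - 2 * posp (y - eta) ^+ 2 + posp (y - 2 * eta) ^+ 2.
Definition tent (eta y : R) : R :=
  2 * (posp y - 2 * posp (y - eta) + posp (y - 2 * eta)).

Lemma is_derive_shiftr (f : R -> R) (c y l : R) : is_derive (y - c) 1 f l ->
  is_derive y 1 (fun y => f (y - c)) l.
Proof.
move=> [df dl].
have Q : (fun h : R => h^-1 *: (((fun y => f (y - c)) \o shift y) (h *: 1) - f (y - c))) =
         (fun h => h^-1 *: ((f \o shift (y - c)) (h *: 1) - f (y - c))).
  by apply/funext => h /=; rewrite addrA.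
by split; [rewrite /derivable Q; exact: df|rewrite /derive Q; exact: dl].
Qed.

Lemma is_derive_ramp (eta y : R) : is_derive y 1 (ramp eta) (tent eta y).
Proof.
have d1 := is_derive_posp2 y.
have d2 := is_derive_shiftr (is_derive_posp2 (y - eta)).
have d3 := is_derive_shiftr (is_derive_posp2 (y - 2 * eta)).
have := is_deriveD (is_deriveB d1 (is_deriveZ 2 d2)) d3.
rewrite /GRing.scale/= /tent => H.
have -> : 2 * (posp y - 2 * posp (y - eta) + posp (y - 2 * eta)) =
  2 * posp y - 2 * (2 * posp (y - eta)) + 2 * posp (y - 2 * eta) by ring.
exact: H.
Qed.

Lemma ramp_le0 (eta y : R) : 0 < eta -> y <= 0 -> ramp eta y = 0.
Proof.
move=> e0 y0; rewrite /ramp /posp !max_l//; lra.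
Qed.

Lemma ramp_ge (eta y : R) : 0 < eta -> 2 * eta <= y -> ramp eta y = 2 * eta ^+ 2.
Proof.
by move=> e0 y0; rewrite /ramp /posp !max_r; [ring|lra|lra|lra].
Qed.

Lemma tent_ge0 (eta y : R) : 0 < eta -> 0 <= tent eta y.
Proof.
move=> e0; rewrite /tent /posp.
case: (leP 0 y) => ?; case: (leP 0 (y - eta)) => ?; case: (leP 0 (y - 2 * eta)) => ?; lra.
Qed.

Lemma tent_out (eta y : R) : 0 < eta -> (y <= 0) || (2 * eta <= y) -> tent eta y = 0.
Proof.
move=> e0; rewrite /tent /posp => /orP[] y0.
  rewrite !max_l//; try lra.
by rewrite !max_r; lra.
Qed.

Lemma tent_continuous (eta : R) : continuous (tent eta).
Proof.
have cp : continuous posp.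
  by move=> y; apply: (@continuous_max _ _ (fun=> 0) id); [exact: cvg_cst|exact: cvg_id].
have cs (c : R) : continuous (fun y => posp (y - c)).
  move=> y; apply: (@continuous_comp _ _ _ (fun y => y - c) posp); last exact: cp.
  by apply: cvgB; [exact: cvg_id|exact: cvg_cst].
move=> y; apply: cvgM; first exact: cvg_cst.
apply: cvgD; last exact: cs.
apply: cvgB; first exact: cp.
by apply: cvgM; [exact: cvg_cst|exact: cs].
Qed.

(** Du Bois-Reymond's lemma.  If [w s < w t], let the derivative of [psi] be a tent
at [s] minus a tent at [t]: on the first tent [w] is less than [mid - eps], on the
second one greater than [mid + eps], and the integral of [w psi'] is negative. *)
Lemma weak_cst_le (a b s t : R) (w : R -> R) : {within `[a, b], continuous w} ->
  (forall psi, test_fun `[a, b] psi ->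
     \int[mu]_(x in `[a, b]) (w x * derive1 psi x) = 0) ->
  a < s -> s < t -> t < b -> w t <= w s.
Proof.
move=> cw Hw as_ st tb; rewrite leNgt; apply/negP => wst.
pose mid := (w s + w t) / 2; pose eps := (w t - w s) / 4.
have e4 : 4 * eps = w t - w s by rewrite /eps; field.
have m2 : 2 * mid = w s + w t by rewrite /mid; field.
have eps0 : 0 < eps by lra.
clearbody eps mid.
have near_ x : a < x < b -> exists2 d, 0 < d & forall y, `|y - x| < d -> a <= y <= b ->
    `|w x - w y| < eps.
  move=> /andP[ax xb]; have /subspace_continuousP /(_ x) := cw.
  rewrite /= in_itv/= !ltW// => /(_ isT) /cvgrPdist_lt /(_ _ eps0) /nbhs_ballP[d /= d0 H].
  exists d => // y yx yab; apply: H; last by rewrite /= in_itv.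
  by rewrite /ball/= distrC.
have [|d1 d10 H1] := near_ s; first by rewrite as_ (lt_trans st).
have [|d2 d20 H2] := near_ t; first by rewrite tb (lt_trans as_).
have [eta [eta0 etas etat etad1 [etad2 etast]]] : exists eta, [/\ 0 < eta, a < s - eta, t + eta < b,
    eta < d1 & eta < d2 /\ s + eta < t - eta].
  exists (Num.min (Num.min (s - a) (b - t)) (Num.min (t - s) (Num.min d1 d2)) / 3).
  have : 0 < Num.min (Num.min (s - a) (b - t)) (Num.min (t - s) (Num.min d1 d2)).
    by rewrite !lt_min !subr_gt0 as_ tb st d10 d20.
  set m := Num.min _ _ => m0.
  have : m <= Num.min (Num.min (s - a) (b - t)) (Num.min (t - s) (Num.min d1 d2)) by [].
  by rewrite !le_min -!andbA => /and5P[*]; split; [| | | |split]; lra.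
pose psi x := ramp eta (x - (s - eta)) - ramp eta (x - (t - eta)).
pose psi' x := tent eta (x - (s - eta)) - tent eta (x - (t - eta)).
have dpsi (x : R) : is_derive x 1 psi (psi' x).
  by apply: is_deriveB; apply: is_derive_shiftr; exact: is_derive_ramp.
have psiE : derive1 psi = psi'.
  by apply/funext => x; rewrite derive1E; have [] := dpsi x.
have ctent c : continuous (fun x => tent eta (x - c)).
  move=> x; apply: (@continuous_comp _ _ _ (fun x => x - c) (tent eta)); last exact: tent_continuous.
  by apply: cvgB; [exact: cvg_id|exact: cvg_cst].
have cpsi' : continuous psi' by move=> x; apply: cvgB; exact: ctent.
have tpsi : test_fun `[a, b] psi.
  split.
  - by move=> x; have [] := dpsi x.
  - by rewrite psiE.
  - exists (`[s - eta, t + eta]%classic); split.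
    + exact: segment_compact.
    + rewrite interior_itv_bnd => x /=; rewrite !in_itv/= => /andP[? ?].
      by apply/andP; split; lra.
    + move=> x /=; rewrite in_itv/= => /negP; rewrite negb_and -!ltNge => /orP[] xs.
        by rewrite /psi !ramp_le0 ?subrr//; lra.
      by rewrite /psi !ramp_ge ?subrr//; lra.
have ab : a <= b by lra.
have lramp c : lipx a b (fun x => ramp eta (x - c)).
  have [M _ HM] := segment_bounded (@continuous_subspaceT _ _ `[a, b]%classic _ (ctent c)).
  apply: (@lipx_C1 _ a b M _ (fun x => tent eta (x - c))) => //.
    apply: continuous_subspaceT => x; apply: differentiable_continuous.
    apply/derivable1_diffP.
    by have [] := is_derive_shiftr (is_derive_ramp eta (x - c)).
  by move=> x _; apply: is_derive_shiftr; exact: is_derive_ramp.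
have int_tent c : a < c - eta -> c + eta < b ->
    \int[mu]_(x in `[a, b]) tent eta (x - (c - eta)) = 2 * eta ^+ 2.
  move=> ac cb; have [L HL] := lramp (c - eta).
  have [|-> _] := @lip_ftc _ a b L _ (fun x => tent eta (x - (c - eta))) ab HL.
    by apply: aeW => x _; apply: is_derive_shiftr; exact: is_derive_ramp.
  by rewrite (@ramp_le0 _ (a - _)) ?ramp_ge ?subr0//; lra.
have iw f : continuous f -> mu.-integrable `[a, b] (EFin \o f).
  by move=> cf; apply: within_integrable; exact: continuous_subspaceT.
have i1 : mu.-integrable `[a, b] (EFin \o (fun x => w x * psi' x)).
  by apply: within_integrable; apply: within_contM => //; exact: continuous_subspaceT.
have i2 := iw _ (ctent (s - eta)).
have i3 := iw _ (ctent (t - eta)).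
have i4 : mu.-integrable `[a, b]
    (EFin \o (fun x => mid * tent eta (x - (s - eta)) - mid * tent eta (x - (t - eta)))).
  by apply: iw => x; apply: cvgB; apply: cvgM; (try exact: cvg_cst); exact: ctent.
have i5 : mu.-integrable `[a, b]
    (EFin \o (fun x => eps * tent eta (x - (s - eta)) + eps * tent eta (x - (t - eta)))).
  by apply: iw => x; apply: cvgD; apply: cvgM; (try exact: cvg_cst); exact: ctent.
have iZ c x : mu.-integrable `[a, b] (EFin \o (fun y => c * tent eta (y - x))).
  by apply: iw => y; apply: cvgM; (try exact: cvg_cst); exact: ctent.
have E1 := Hw psi tpsi; rewrite psiE in E1.
have T1 := int_tent s etas (ltac:(lra) : s + eta < b).
have T2 := int_tent t (ltac:(lra) : a < t - eta) etat.
have E2 : \int[mu]_(x in `[a, b])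
   (mid * tent eta (x - (s - eta)) - mid * tent eta (x - (t - eta))) = 0.
  by rewrite RintegralB// RintegralZl// RintegralZl// T1 T2 subrr.
have E3 : \int[mu]_(x in `[a, b])
   (eps * tent eta (x - (s - eta)) + eps * tent eta (x - (t - eta))) = 4 * eps * eta ^+ 2.
  by rewrite RintegralD// RintegralZl// RintegralZl// T1 T2; ring.
have : \int[mu]_(x in `[a, b])
    (eps * tent eta (x - (s - eta)) + eps * tent eta (x - (t - eta))) <=
  \int[mu]_(x in `[a, b]) ((mid * tent eta (x - (s - eta)) - mid * tent eta (x - (t - eta)))
     - w x * psi' x).
  apply: le_Rintegral => //.
    have := integrableB _ i4 i1. by apply.
  move=> x /=; rewrite in_itv/= => xab; rewrite /psi'.
  have t1 := tent_ge0 (x - (s - eta)) eta0.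
  have t2 := tent_ge0 (x - (t - eta)) eta0.
  have [xs|xs] := boolP (`|x - s| < eta).
    have -> : tent eta (x - (t - eta)) = 0.
      apply: tent_out => //; apply/orP; left; move: xs; clear -etast; rewrite ltr_norml => /andP[? ?]; lra.
    have := H1 x (lt_trans xs etad1) xab; rewrite ltr_norml => /andP[? ?].
    rewrite !mulr0 !subr0 addr0 -mulrBl ler_wpM2r//.
    by clear H1 H2; lra.
  have -> : tent eta (x - (s - eta)) = 0.
    apply: tent_out => //; move: xs; clear; rewrite -leNgt ler_normr => /orP[] ?; apply/orP; [right|left]; lra.
  have [xt|xt] := boolP (`|x - t| < eta).
    have := H2 x (lt_trans xt etad2) xab; rewrite ltr_norml => /andP[? ?].
    rewrite !mulr0 !sub0r add0r mulrN opprK -mulNr -mulrDl ler_wpM2r//.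
    by lra.
  have -> : tent eta (x - (t - eta)) = 0.
    apply: tent_out => //; move: xt; clear; rewrite -leNgt ler_normr => /orP[] ?; apply/orP; [right|left]; lra.
  by rewrite !mulr0 !subr0 mulr0 addr0.
rewrite E3 RintegralB// E2 E1 subrr leNgt => /negP; apply.
by rewrite mulr_gt0 ?exprn_gt0// mulr_gt0.
Qed.

End DuBoisReymond.

Section WeakLip.
Context {R : realType}.
Notation mu := (@lebesgue_measure R).

(** [weak_cst_le] for [w] and [- w]; the end points follow by continuity. *)
Lemma weak_cst (a b s : R) (w : R -> R) : {within `[a, b], continuous w} ->
  (forall psi, test_fun `[a, b] psi ->
     \int[mu]_(x in `[a, b]) (w x * derive1 psi x) = 0) ->
  a <= s <= b -> w s = w a.
Proof.
move=> cw Hw.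
have cwN : {within `[a, b], continuous (fun x => - w x)} by move=> x; apply: cvgN; exact: cw.
have HwN psi : test_fun `[a, b] psi ->
     \int[mu]_(x in `[a, b]) (- w x * derive1 psi x) = 0.
  move=> tpsi; have [D lpsi _ _ _] := test_fun_props (@subset_refl _ `[a, b]%classic) tpsi.
  have i1 : mu.-integrable `[a, b] (EFin \o (fun t => w t * derive1 psi t)).
    apply: within_integrable; apply: within_contM => //.
    by apply: continuous_subspaceT; case: tpsi.
  transitivity (\int[mu]_(x in `[a, b]) (-1 * (w x * derive1 psi x))).
    by apply: eq_Rintegral => x _; rewrite mulN1r mulNr.
  by rewrite RintegralZl// Hw// mulr0.
have eqin x y : a < x -> x < y -> y < b -> w y = w x.
  move=> ax xy yb; apply/eqP; rewrite eq_le (weak_cst_le cw)//=.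
  by rewrite -lerN2 (weak_cst_le cwN).
move=> /andP[as_ sb].
move: as_; rewrite le_eqVlt => /predU1P[->//|as_].
have ab : a < b by exact: lt_le_trans sb.
pose mid := (a + b) / 2.
have midab : a < mid < b by rewrite /mid; apply/andP; split; lra.
have eqmid x : a < x < b -> w x = w mid.
  move=> /andP[ax xb]; move: midab => /andP[am mb].
  by have [xm|mx|->//] := ltgtP x mid; [rewrite (eqin x mid)|rewrite (eqin mid x)].
have lim x : a <= x <= b -> w x = w mid.
  move=> xab; apply/eqP; rewrite -subr_eq0 -normr_le0; apply/ler_addgt0Pr => e e0.
  rewrite add0r; have /subspace_continuousP /(_ x) := cw.
  rewrite /= in_itv/= => /(_ xab) /cvgrPdist_lt /(_ _ e0) /nbhs_ballP[d /= d0 H].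
  pose h := Num.min (d / 2) ((b - a) / 4).
  have h0 : 0 < h by rewrite /h lt_min !divr_gt0// subr_gt0.
  have h1 : h <= d / 2 by rewrite /h ge_min lexx.
  have h2 : h <= (b - a) / 4 by rewrite /h ge_min lexx orbT.
  have hd : h < d by lra.
  move: xab => /andP[ax xb].
  have [xm|mx] := leP x mid.
    have xh : a < x + h < b by move: xm; rewrite /mid; clear -ax h0 h2 ab; move=> ?; apply/andP; split; lra.
    have := H (x + h); rewrite /ball/= opprD addrA subrr sub0r normrN gtr0_norm//.
    move=> /(_ hd); rewrite in_itv/= (_ : (a <= x + h <= b) = true); last first.
      by case/andP: xh => *; rewrite !ltW.
    by move=> /(_ isT) /ltW; rewrite -(eqmid _ xh).
  have xh : a < x - h < b by move: mx; rewrite /mid; clear -xb h0 h2 ab; move=> ?; apply/andP; split; lra.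
  have := H (x - h); rewrite /ball/= opprB addrCA subrr addr0 gtr0_norm//.
  move=> /(_ hd); rewrite in_itv/= (_ : (a <= x - h <= b) = true); last first.
    by case/andP: xh => *; rewrite !ltW.
  by move=> /(_ isT) /ltW; rewrite -(eqmid _ xh).
by rewrite (lim s) ?(ltW as_) ?sb// (lim a)// lexx ltW.
Qed.

(** [g] minus the primitive of [h] has weak derivative 0, hence is constant. *)
Lemma weak_lip (a b M : R) (g k h : R -> R) : a <= b -> {within `[a, b], continuous g} ->
  measurable_fun `[a, b] h -> {ae mu, forall t, a <= t <= b -> `|h t| <= M} ->
  {ae mu, forall t, a <= t <= b -> k t = h t} ->
  sweak `[a, b] g k ->
  lipon a b `|M| g /\ {ae mu, forall t, a < t < b -> is_derive t 1 g (k t)}.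
Proof.
move=> ab cg mh hM kh wg.
(* The truncation turns the essential bound on h into a bound. *)
pose f := (fun t => clampr (- `|M|) `|M| (h t)) \_ `[a, b].
have mf : measurable_fun setT f.
  apply/(measurable_restrictT _ (measurable_itv _)).
  apply: (@measurableT_comp _ _ _ _ _ _ (clampr (- `|M|) `|M|)) => //.
  by apply: continuous_measurable_fun; exact: clamp_continuous.
have fM t : `|f t| <= `|M|.
  rewrite /f patchE; case: ifPn => _; last by rewrite normr0.
  by rewrite ler_norml clamp_itv// ge0_cp.
have kf : {ae mu, forall t, a <= t <= b -> k t = f t}.
  apply: aeS2 hM kh => t H1 H2 tab; rewrite H2// /f patchE mem_set/= ?in_itv//.
  by rewrite clamp_id// -ler_norml (le_trans (H1 tab))// ler_norm.
have lH : lipon a b `|M| (prim f a) by exact: prim_lipon.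
have dH : {ae mu, forall t, a < t < b -> is_derive t 1 (prim f a) (f t)}.
  by apply: aeS (prim_derive a mf fM) => t H /andP[/H].
have wH : sweak `[a, b] (prim f a) f by apply: lip_sweak dH => //; exists `|M|.
pose w t := g t - prim f a t.
have cH := lipon_cont lH.
have cw : {within `[a, b], continuous w} by move=> t; apply: cvgB; [exact: cg|exact: cH].
have wE t : a <= t <= b -> w t = w a.
  apply: (weak_cst cw) => psi tpsi.
  have cpsi' : {within `[a, b], continuous (derive1 psi)}.
    by apply: continuous_subspaceT; case: tpsi.
  transitivity (\int[mu]_(x in `[a, b]) (g x * derive1 psi x - prim f a x * derive1 psi x)).
    by apply: eq_Rintegral => x _; rewrite mulrBl.
  rewrite RintegralB//; last 2 first.
  - by apply: within_integrable; exact: within_contM.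
  - by apply: within_integrable; exact: within_contM.
  rewrite wg// wH// opprK addrC; apply/eqP; rewrite subr_eq0; apply/eqP.
  apply: Rintegral_ae_eq; apply: aeS kf => x H; rewrite /= in_itv/= => /H ->//.
have gE t : a <= t <= b -> prim f a t + g a = g t.
  move=> tab; have := wE t tab; rewrite /w prim_id subr0 => <-.
  by rewrite addrC subrK.
split.
  apply: lipon_eq gE _ => x y hx hy; rewrite opprD addrACA subrr addr0; exact: (lH x y).
apply: aeS2 dH kf => t H1 H2 tab.
have tab' : a <= t <= b by case/andP: tab => *; rewrite !ltW.
rewrite H2//; apply: (@near_eq_is_derive _ _ _ (fun t => prim f a t + g a)).
  move: tab => /andP[at_ tb]; near=> s; apply: gE.
  by apply/andP; split; apply: ltW; near: s; [exact: lt_nbhsr|exact: lt_nbhsl].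
by rewrite -[f t]addr0; apply: is_deriveD; exact: H1.
Unshelve. all: by end_near. Qed.

End WeakLip.

(** * Euclidean vectors *)

Section Vectors.
Context {R : realType}.

Lemma dotp_ge0 n (v : 'rV[R]_n) : 0 <= dotp v v.
Proof. by apply: sumr_ge0 => i _; rewrite -expr2 sqr_ge0. Qed.

Lemma enorm_ge0 n (v : 'rV[R]_n) : 0 <= enorm v.
Proof. exact: sqrtr_ge0. Qed.

Lemma enorm2 n (v : 'rV[R]_n) : enorm v ^+ 2 = dotp v v.
Proof. by rewrite sqr_sqrtr// dotp_ge0. Qed.

Lemma coord_le_enorm n (v : 'rV[R]_n) j : `|v 0 j| <= enorm v.
Proof.
rewrite -[X in X <= _]ger0_norm// -sqrtr_sqr ler_wsqrtr// real_normK ?num_real//.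
rewrite /dotp (bigD1 j)//= -expr2 lerDl; apply: sumr_ge0 => i _.
by rewrite -expr2 sqr_ge0.
Qed.

Lemma enorm_le_sum n (v : 'rV[R]_n) : enorm v <= \sum_j `|v 0 j|.
Proof.
have S0 : 0 <= \sum_j `|v 0 j| by apply: sumr_ge0.
rewrite -[leRHS]ger0_norm// -sqrtr_sqr ler_wsqrtr// /dotp.
rewrite expr2 mulr_suml; apply: ler_sum => i _.
rewrite -expr2 -real_normK ?num_real// expr2 ler_wpM2l//.
by rewrite (bigD1 i)//= lerDl; apply: sumr_ge0.
Qed.

Lemma enorm_le_bound n (v : 'rV[R]_n) M : 0 <= M -> (forall j, `|v 0 j| <= M) ->
  enorm v <= n%:R * M.
Proof.
move=> M0 vM; apply: le_trans (enorm_le_sum v) _.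
rewrite (le_trans (ler_sum _ (fun j _ => vM j)))//.
by rewrite sumr_const card_ord mulr_natl.
Qed.

Lemma dotpZl n (a : R) (v w : 'rV[R]_n) : dotp (a *: v) w = a * dotp v w.
Proof. by rewrite /dotp mulr_sumr; apply: eq_bigr => i _; rewrite mxE mulrA. Qed.

Lemma dotpC n (v w : 'rV[R]_n) : dotp v w = dotp w v.
Proof. by apply: eq_bigr => i _; rewrite mulrC. Qed.

Lemma dotpZr n (a : R) (v w : 'rV[R]_n) : dotp v (a *: w) = a * dotp v w.
Proof. by rewrite dotpC dotpZl dotpC. Qed.

Lemma dotpDl n (u v w : 'rV[R]_n) : dotp (u + v) w = dotp u w + dotp v w.
Proof.
by rewrite /dotp -big_split; apply: eq_bigr => i _; rewrite mxE mulrDl.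
Qed.

Lemma dotpDr n (u v w : 'rV[R]_n) : dotp u (v + w) = dotp u v + dotp u w.
Proof. by rewrite dotpC dotpDl !(dotpC u). Qed.

Lemma enormZ n (a : R) (v : 'rV[R]_n) : enorm (a *: v) = `|a| * enorm v.
Proof.
by rewrite /enorm dotpZl dotpZr mulrA -expr2 sqrtrM ?sqr_ge0// sqrtr_sqr.
Qed.

Lemma enormN n (v : 'rV[R]_n) : enorm (- v) = enorm v.
Proof. by rewrite -scaleN1r enormZ normrN normr1 mul1r. Qed.

Lemma enorm_eq0 n (v : 'rV[R]_n) : enorm v = 0 -> v = 0.
Proof.
move=> v0; apply/rowP => j; rewrite mxE; apply/eqP; rewrite -normr_le0.
by rewrite -v0 coord_le_enorm.
Qed.

Lemma cauchy_schwarz n (v w : 'rV[R]_n) : dotp v w <= enorm v * enorm w.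
Proof.
have [v0|v0] := eqVneq (enorm v) 0.
  rewrite v0 mul0r (enorm_eq0 v0) /dotp big1// => i _; by rewrite mxE mul0r.
have [w0|w0] := eqVneq (enorm w) 0.
  rewrite w0 mulr0 (enorm_eq0 w0) /dotp big1// => i _; by rewrite mxE mulr0.
have vp : 0 < enorm v by rewrite lt_def v0 enorm_ge0.
have wp : 0 < enorm w by rewrite lt_def w0 enorm_ge0.
have := dotp_ge0 (enorm w *: v - enorm v *: w).
rewrite -scaleNr !(dotpDl, dotpDr) !(dotpZl, dotpZr) -!enorm2 (dotpC w v).
have vw : 0 < enorm v * enorm w by rewrite mulr_gt0.
move=> H; rewrite -(ler_pM2l vw); nra.
Qed.

Lemma enormD n (v w : 'rV[R]_n) : enorm (v + w) <= enorm v + enorm w.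
Proof.
rewrite -(@ler_pXn2r _ 2)// ?nnegrE ?addr_ge0 ?enorm_ge0//.
rewrite enorm2 dotpDl !dotpDr -!enorm2 (dotpC w v).
have := cauchy_schwarz v w; rewrite sqrrD; set a := enorm v; set b := enorm w; lra.
Qed.

Lemma cvg_sum_seq (S : Type) (F : set_system S) (FF : Filter F) (I : Type) (r : seq I)
  (f : I -> S -> R) (l : I -> R) : (forall i, f i @ F --> l i) ->
  (fun s => \sum_(i <- r) f i s) @ F --> \sum_(i <- r) l i.
Proof.
move=> H; elim: r => [|i r IH].
  by rewrite big_nil; under eq_fun do rewrite big_nil; exact: cvg_cst.
rewrite big_cons; under eq_fun do rewrite big_cons.
by apply: cvgD.
Qed.

Lemma rV_cvgP (S : Type) (F : set_system S) (FF : Filter F) n (f : S -> 'rV[R]_n)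
  (l : 'rV[R]_n) : (forall j, (fun s => f s 0 j) @ F --> l 0 j) -> f @ F --> l.
Proof.
move=> H; apply/cvg_ballP => e e0.
have : \forall s \near F, forall j, ball (l 0 j) e (f s 0 j).
  by apply: filter_forall => j; have /cvg_ballP := H j; apply.
by apply: filterS => s Hs; split => // i j; rewrite ord1.
Qed.

Lemma rV_cvg_coord (S : Type) (F : set_system S) (FF : Filter F) n (f : S -> 'rV[R]_n)
  (l : 'rV[R]_n) j : f @ F --> l -> (fun s => f s 0 j) @ F --> l 0 j.
Proof.
move=> H; apply: (cvg_comp f (fun v : 'rV[R]_n => v 0 j) H).
exact: coord_continuous.
Qed.

Lemma rV_continuous (S : topologicalType) n (f : S -> 'rV[R]_n) :
  (forall j, continuous (fun s => f s 0 j)) -> continuous f.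
Proof. by move=> H x; apply: (rV_cvgP (nbhs_filter x)) => j; exact: H. Qed.

Lemma coord_cont (S : topologicalType) n (f : S -> 'rV[R]_n) j :
  continuous f -> continuous (fun s => f s 0 j).
Proof. by move=> H x; apply: (rV_cvg_coord (nbhs_filter x)); exact: H. Qed.

Lemma rV_is_derive (V : normedModType R) n (x v : V) (f : V -> 'rV[R]_n) (l : 'rV[R]_n) :
  (forall j, is_derive x v (fun z => f z 0 j) (l 0 j)) -> is_derive x v f l.
Proof.
move=> H; have C : (fun h => h^-1 *: (f (h *: v + x) - f x)) @ 0^' --> l.
  apply: rV_cvgP => j; have [dj <-] := H j.
  by under eq_fun do rewrite !mxE; exact: dj.
by split; [apply/cvg_ex; exists l; exact: C|apply/cvg_lim => //; exact: C].
Qed.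

Lemma is_derive_coord (V : normedModType R) n (x v : V) (f : V -> 'rV[R]_n)
  (l : 'rV[R]_n) j : is_derive x v f l -> is_derive x v (fun z => f z 0 j) (l 0 j).
Proof.
move=> [df dl]; have C : (fun h => h^-1 *: (f (h *: v + x) - f x)) @ 0^' --> l.
  by rewrite -dl; exact: df.
have {}C : (fun h => h^-1 *: (f (h *: v + x) 0 j - f x 0 j)) @ 0^' --> l 0 j.
  have E : (fun h => (h^-1 *: (f (h *: v + x) - f x)) 0 j) =
           (fun h => h^-1 *: (f (h *: v + x) 0 j - f x 0 j)).
    by apply/funext => h; rewrite !mxE.
  by rewrite -E; exact: (@rV_cvg_coord _ _ _ _ _ _ j C).
by split; [apply/cvg_ex; exists (l 0 j); exact: C|apply/cvg_lim => //; exact: C].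
Qed.

Lemma near_eq_diff (V W : normedModType R) (f g : V -> W) (x : V) :
  (\forall z \near x, f z = g z) -> differentiable g x ->
  differentiable f x /\ ('d f x = 'd g x :> (V -> W)).
Proof.
move=> fg dg; have [cg Hg] := (iffLR (diff_locallyP _ _) dg).
have E : f \o shift x = cst (f x) + 'd g x +o_ 0 id.
  apply/eqaddoP => e e0; have /eqaddoP /(_ e e0) := Hg.
  have fgx : f x = g x := nbhs_singleton fg.
  have fg0 : \forall h \near (0:V), f (h + x) = g (h + x).
    have c : (fun h : V => h + x) @ (0 : V) --> (0 + x).
      by apply: cvgD; [exact: cvg_id|exact: cvg_cst].
    by rewrite add0r in c; exact: (c _ fg).
  move: fg0; apply: filterS2 => h fgh.
  have -> : (f \o shift x - (cst (f x) + 'd g x)) h = (g \o shift x - (cst (g x) + 'd g x)) h.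
    change (f (h + x) - (f x + 'd g x h) = g (h + x) - (g x + 'd g x h)).
    by rewrite fgh fgx.
  exact.
have D := @diff_unique _ _ _ f _ x cg E.
split; [apply/diff_locallyP; rewrite D; split; [exact: cg|exact: E]|exact: D].
Qed.

Lemma rV_differentiable (V : normedModType R) n (x : V) (f : V -> 'rV[R]_n) :
  (forall j, differentiable (fun z => f z 0 j) x) -> differentiable f x.
Proof.
move=> H; have -> : f = \sum_(j < n) (fun z => f z 0 j *: (delta_mx 0 j : 'rV[R]_n)).
  apply/funext => z; rewrite fct_sumE [LHS]row_sum_delta//.
by apply: differentiable_sum => j; exact: differentiableZl.
Qed.

Lemma enorm2_continuous n : continuous (fun z : 'rV[R]_n => enorm z ^+ 2).
Proof.
have -> : (fun z : 'rV[R]_n => enorm z ^+ 2) = (fun z => \sum_(j < n) z 0 j * z 0 j).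
  by apply/funext => z; rewrite enorm2.
move=> z; have H (j : 'I_n) : (fun z : 'rV[R]_n => z 0 j * z 0 j) @ z --> z 0 j * z 0 j.
  by apply: (@cvgM _ _ (nbhs z) _ (fun z => z 0 j) (fun z => z 0 j));
    exact: (@coord_continuous R 1 n 0 j z).
exact: (@cvg_sum_seq _ (nbhs z) _ _ _ _ _ H).
Qed.

Lemma enorm_continuous n : continuous (@enorm R n).
Proof.
move=> z; have -> : @enorm R n = (fun z => Num.sqrt (enorm z ^+ 2)).
  by apply/funext => w; rewrite sqrtr_sqr ger0_norm ?enorm_ge0.
apply: (@continuous_comp _ _ _ (fun z : 'rV[R]_n => enorm z ^+ 2) Num.sqrt).
  exact: enorm2_continuous.
exact: sqrt_continuous.
Qed.

End Vectors.

(** * Terms for the functions Gamma *)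

Section Expr.
Variables (R : realType) (m : nat).

(** Terms for the coordinates of Gamma_k on the domain |zeta_i| < 1: [Ph] stands for
phi, [Var i j] for the coordinate [j] of zeta_i, and [Al l i] for the [l]-th
derivative of alpha at |zeta_i|^2.  On terms, the partial derivatives in the
definition of Gamma become a syntactic derivation. *)
Inductive expr :=
| Cst of R | Ph | Var of nat & 'I_m | Al of nat & nat
| Add of expr & expr | Mul of expr & expr.

Variables (c T : R) (al : nat -> R -> R) (n : nat).
Hypothesis c0 : 0 < c.
Hypothesis al_derive : forall (l : nat) (s : R), (l < n)%N -> 0 <= s < 1 ->
  is_derive s 1 (al l) (al l.+1 s).
Hypothesis al_cont : forall (l : nat) (s : R), (l <= n)%N -> 0 <= s < 1 ->
  {for s, continuous (al l)}.

Fixpoint evalx (t : R) (z : nat -> 'rV[R]_m) (E : expr) : R :=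
  match E with
  | Cst a => a
  | Ph => phi c T t
  | Var i j => z i 0 j
  | Al l i => al l (enorm (z i) ^+ 2)
  | Add E1 E2 => evalx t z E1 + evalx t z E2
  | Mul E1 E2 => evalx t z E1 * evalx t z E2
  end.

(** The directional derivative of [evalx] at [(t, z)] along [(t', z')]. *)
Fixpoint dev (t : R) (z : nat -> 'rV[R]_m) (t' : R) (z' : nat -> 'rV[R]_m)
    (E : expr) : R :=
  match E with
  | Cst a => 0
  | Ph => t' * (c * phi c T t ^+ 2)
  | Var i j => z' i 0 j
  | Al l i => al l.+1 (enorm (z i) ^+ 2) * (2 * dotp (z i) (z' i))
  | Add E1 E2 => dev t z t' z' E1 + dev t z t' z' E2
  | Mul E1 E2 => evalx t z E1 * dev t z t' z' E2 + evalx t z E2 * dev t z t' z' E1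
  end.

(** The coordinates of the velocity [fld], as terms. *)
Definition Dvar (i : nat) (j : 'I_m) : expr :=
  Add (Mul Ph (Mul (Add (Cst c) (Mul (Cst (-1)) (Al 0 i))) (Var i j))) (Var i.+1 j).

(** The derivation along the vector field [(1, fld)]. *)
Fixpoint Dx (E : expr) : expr :=
  match E with
  | Cst a => Cst 0
  | Ph => Mul (Cst c) (Mul Ph Ph)
  | Var i j => Dvar i j
  | Al l i => Mul (Al l.+1 i) (Mul (Cst 2) (\big[Add/Cst 0]_(j < m) Mul (Var i j) (Dvar i j)))
  | Add E1 E2 => Add (Dx E1) (Dx E2)
  | Mul E1 E2 => Add (Mul E1 (Dx E2)) (Mul E2 (Dx E1))
  end.

(** Vector variables have indices in [lo..hv], those inside alpha in [lo..ha], and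
alpha is differentiated at most [l] times.  There are two upper bounds because the
last variable of Gamma_k, for [k > 0], ranges over the whole space, not over the unit
ball: it may occur outside of alpha only. *)
Fixpoint wf (lo hv ha l : nat) (E : expr) : bool :=
  match E with
  | Cst _ | Ph => true
  | Var i _ => (lo <= i <= hv)%N
  | Al l' i => (l' <= l)%N && (lo <= i <= ha)%N
  | Add E1 E2 | Mul E1 E2 => wf lo hv ha l E1 && wf lo hv ha l E2
  end.

(** The velocity of zeta_i in the recursion for Gamma. *)
Definition fld (t : R) (z : nat -> 'rV[R]_m) (i : nat) : 'rV[R]_m :=
  phi c T t *: (c *: z i - al 0 (enorm (z i) ^+ 2) *: z i) + z i.+1.

Lemma eval_sum t z (F : 'I_m -> expr) :
  evalx t z (\big[Add/Cst 0]_(j < m) F j) = \sum_(j < m) evalx t z (F j).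
Proof. by apply: (big_morph (evalx t z)). Qed.

Lemma wf_sum lo hv ha l (F : 'I_m -> expr) : (forall j, wf lo hv ha l (F j)) ->
  wf lo hv ha l (\big[Add/Cst 0]_(j < m) F j).
Proof. by move=> H; elim/big_ind : _ => //= x y -> ->. Qed.

Lemma evalD t z E : evalx t z (Dx E) = dev t z 1 (fld t z) E.
Proof.
have Dv i j : evalx t z (Dvar i j) = fld t z i 0 j.
  by rewrite /= /fld !mxE; ring.
elim: E => //=.
- by rewrite mul1r expr2.
- move=> l i; rewrite eval_sum; congr (_ * (_ * _)).
  by apply: eq_bigr => j _; congr (_ * _); exact: Dv.
- by move=> E1 -> E2 ->.
- by move=> E1 -> E2 ->.
Qed.

Lemma wfD lo hv ha l E : (ha <= hv)%N -> wf lo hv ha l E ->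
  wf lo hv.+1 hv l.+1 (Dx E).
Proof.
move=> hah; have W E' : wf lo hv ha l E' -> wf lo hv.+1 hv l.+1 E'.
  elim: E' => //=.
  - by move=> i _ /andP[-> /leqW].
  - by move=> l' i /and3P[h1 h2 h3]; rewrite (leqW h1) h2 (leq_trans h3).
  - by move=> E1 H1 E2 H2 /andP[/H1 -> /H2].
  - by move=> E1 H1 E2 H2 /andP[/H1 -> /H2].
elim: E => //=.
- by move=> i _ /andP[li ih]; rewrite !li ih leqW//= ltnS ih (leqW li).
- move=> l' i /and3P[ll li ih]; rewrite ltnS ll li (leq_trans ih)//=.
  have ihv := leq_trans ih hah.
  by apply: wf_sum => j /=; rewrite li ihv (leqW ihv) ltnS ihv (leqW li).
- by move=> E1 H1 E2 H2 /andP[/H1 -> /H2].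
- by move=> E1 H1 E2 H2 /andP[h1 h2]; rewrite (W _ h1) (W _ h2) (H1 h1) (H2 h2).
Qed.

Lemma wf_le lo hv ha l lo' hv' ha' l' E : (lo' <= lo)%N -> (hv <= hv')%N ->
  (ha <= ha')%N -> (l <= l')%N -> wf lo hv ha l E -> wf lo' hv' ha' l' E.
Proof.
move=> h1 h2 h3 h4; elim: E => //=.
- by move=> i _ /andP[/(leq_trans h1) -> h]; rewrite (leq_trans h).
- by move=> k i /and3P[h5 /(leq_trans h1) -> h]; rewrite (leq_trans h5)//= (leq_trans h).
- by move=> E1 H1 E2 H2 /andP[/H1 -> /H2].
- by move=> E1 H1 E2 H2 /andP[/H1 -> /H2].
Qed.

Lemma dev_ext t z t' w w' lo hv ha l E : (ha <= hv)%N -> wf lo hv ha l E ->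
  (forall i, (lo <= i <= hv)%N -> w i = w' i) -> dev t z t' w E = dev t z t' w' E.
Proof.
move=> hah + ww; elim: E => //=.
- by move=> i j /ww ->.
- by move=> l' i /and3P[_ li ih]; rewrite ww// li (leq_trans ih).
- by move=> E1 H1 E2 H2 /andP[/H1 -> /H2 ->].
- by move=> E1 H1 E2 H2 /andP[/H1 -> /H2 ->].
Qed.

Lemma dev_add t z t1 t2 w1 w2 E :
  dev t z (t1 + t2) (fun i => w1 i + w2 i) E = dev t z t1 w1 E + dev t z t2 w2 E.
Proof.
elim: E => /= [a||i j|l i|E1 -> E2 ->|E1 -> E2 ->].
- by rewrite addr0.
- by rewrite mulrDl.
- by rewrite mxE.
- by rewrite dotpDr !mulrDr.
- by rewrite addrACA.
- by rewrite !mulrDr addrACA.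
Qed.

Lemma dev_0 t z E : dev t z 0 (fun=> 0) E = 0.
Proof.
elim: E => //= [|i j|l i|E1 -> E2 ->|E1 -> E2 ->].
- by rewrite mul0r.
- by rewrite mxE.
- by rewrite /dotp big1 ?mulr0// => j _; rewrite mxE mulr0.
- by rewrite addr0.
- by rewrite !mulr0 addr0.
Qed.

(** A total derivative is the sum of the partial ones. *)
Lemma dev_split t z w i k E l : wf i (i + k) (i + k) l E ->
  dev t z 1 w E = dev t z 1 (fun=> 0) E +
    \sum_(a < k.+1) dev t z 0 (upd (fun=> 0) (i + a) (w (i + a)%N)) E.
Proof.
move=> wE.
have S (K : nat) : \sum_(a < K) dev t z 0 (upd (fun=> 0) (i + a) (w (i + a)%N)) E =
    dev t z 0 (fun b => \sum_(a < K) upd (fun=> 0) (i + a) (w (i + a)%N) b) E.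
  elim: K => [|K IH].
    rewrite big_ord0 -[LHS](dev_0 t z E); congr dev; apply/funext => b.
    by rewrite big_ord0.
  rewrite big_ord_recr/= IH -dev_add addr0; congr dev; apply/funext => b.
  by rewrite big_ord_recr.
rewrite S -dev_add addr0; apply: (dev_ext _ _ _ (leqnn _) wE) => b /andP[ib bk].
rewrite add0r.
have bi : (b - i < k.+1)%N by rewrite ltnS leq_subLR.
rewrite (bigD1 (Ordinal bi))//= big1 ?addr0.
  by rewrite /upd subnKC// eqxx.
move=> a ab; rewrite /upd; case: eqP => // E1; case/eqP: ab; apply: val_inj => /=.
by rewrite E1 addKn.
Qed.

Lemma is_derive_phi (tau : R -> R) (s tau' : R) : tau s != T ->
  is_derive s 1 tau tau' ->
  is_derive s 1 (fun s => phi c T (tau s)) (tau' * (c * phi c T (tau s) ^+ 2)).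
Proof.
move=> tT dtau.
have T0 : T - tau s != 0 by rewrite subr_eq0 eq_sym.
have d1 : is_derive s 1 (fun s => T - tau s) (- tau').
  by rewrite -[- tau']sub0r; apply: is_deriveB; exact: dtau.
have d2 := is_deriveZ c^-1 (@is_deriveV _ (fun s => T - tau s) s (- tau') 1 T0 d1).
have -> : tau' * (c * phi c T (tau s) ^+ 2) = c^-1 *: (- (T - tau s) ^- 2 *: - tau').
  by rewrite /phi /GRing.scale/=; field; rewrite T0 gt_eqF.
exact: d2.
Qed.

Lemma is_derive_enorm2 (zeta : R -> 'rV[R]_m) (s : R) (z' : 'rV[R]_m) :
  (forall j, is_derive s 1 (fun s => zeta s 0 j) (z' 0 j)) ->
  is_derive s 1 (fun s => enorm (zeta s) ^+ 2) (2 * dotp (zeta s) z').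
Proof.
move=> dz.
have -> : (fun s => enorm (zeta s) ^+ 2) =
    \sum_(j < m) (fun s => zeta s 0 j) * (fun s => zeta s 0 j).
  by apply/funext => x; rewrite enorm2 /dotp fct_sumE.
have -> : 2 * dotp (zeta s) z' =
    \sum_(j < m) (zeta s 0 j *: z' 0 j + zeta s 0 j *: z' 0 j).
  rewrite /dotp mulr_sumr; apply: eq_bigr => j _.
  by rewrite /GRing.scale/=; ring.
by apply: is_derive_sum => j; apply: is_deriveM.
Qed.

Lemma enorm2_dom (z : 'rV[R]_m) : enorm z < 1 -> 0 <= enorm z ^+ 2 < 1.
Proof.
by move=> z1; rewrite exprn_ge0 ?enorm_ge0//= expr_lt1// enorm_ge0.
Qed.

(** The chain rule, by induction on the term. *)
Lemma eval_is_derive (tau : R -> R) (zeta : nat -> R -> 'rV[R]_m) (s tau' : R)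
    (z' : nat -> 'rV[R]_m) lo hv ha l E :
  (ha <= hv)%N -> (l < n)%N -> wf lo hv ha l E ->
  tau s != T -> is_derive s 1 tau tau' ->
  (forall i j, (lo <= i <= hv)%N -> is_derive s 1 (fun s => zeta i s 0 j) (z' i 0 j)) ->
  (forall i, (lo <= i <= ha)%N -> enorm (zeta i s) < 1) ->
  is_derive s 1 (fun s => evalx (tau s) (zeta^~ s) E)
    (dev (tau s) (zeta^~ s) tau' z' E).
Proof.
move=> hah ln + tT dtau dz zdom; elim: E => /=.
- by move=> a _; exact: is_derive_cst.
- by move=> _; exact: is_derive_phi.
- by move=> i j; exact: dz.
- move=> l' i /and3P[ll li ih].
  have ihv : (lo <= i <= hv)%N by rewrite li (leq_trans ih).
  apply: (@is_derive1_comp _ (al l') (fun s => enorm (zeta i s) ^+ 2)).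
    apply: al_derive; first exact: leq_ltn_trans ln.
    by apply: enorm2_dom; rewrite zdom// li.
  by apply: is_derive_enorm2 => j; exact: dz.
- by move=> E1 H1 E2 H2 /andP[w1 w2]; apply: is_deriveD; [exact: H1|exact: H2].
- by move=> E1 H1 E2 H2 /andP[w1 w2]; apply: is_deriveM; [exact: H1|exact: H2].
Qed.

Lemma eval_cvg (S : Type) (F : set_system S) (FF : Filter F) (tau : S -> R) (t : R)
    (zeta : nat -> S -> 'rV[R]_m) (z : nat -> 'rV[R]_m) lo hv ha l E :
  (ha <= hv)%N -> (l <= n)%N -> wf lo hv ha l E -> t != T -> tau @ F --> t ->
  (forall i, (lo <= i <= hv)%N -> zeta i @ F --> z i) ->
  (forall i, (lo <= i <= ha)%N -> enorm (z i) < 1) ->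
  (fun s => evalx (tau s) (zeta^~ s) E) @ F --> evalx t z E.
Proof.
move=> hah ln + tT ctau cz zdom; elim: E => /=.
- by move=> a _; exact: cvg_cst.
- move=> _; apply: cvgM; first exact: cvg_cst.
  apply: cvgV; first by rewrite subr_eq0 eq_sym.
  by apply: cvgB => //; exact: cvg_cst.
- by move=> i j /cz; exact: rV_cvg_coord.
- move=> l' i /and3P[ll li ih].
  have ihv : (lo <= i <= hv)%N by rewrite li (leq_trans ih).
  apply: (cvg_comp (fun s => enorm (zeta i s) ^+ 2) (al l')); last first.
    apply: al_cont; first exact: leq_trans ln.
    by apply: enorm2_dom; rewrite zdom// li.
  apply: (cvg_comp (zeta i) (fun z => enorm z ^+ 2) (cz _ ihv)).
  exact: enorm2_continuous.
- by move=> E1 H1 E2 H2 /andP[w1 w2]; apply: cvgD; [exact: H1|exact: H2].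
- by move=> E1 H1 E2 H2 /andP[w1 w2]; apply: cvgM; [exact: H1|exact: H2].
Qed.

Lemma differentiable_enorm2 (x : 'rV[R]_m) : differentiable (fun z : 'rV[R]_m => enorm z ^+ 2) x.
Proof.
have -> : (fun z : 'rV[R]_m => enorm z ^+ 2) =
    \sum_(j < m) (fun z : 'rV[R]_m => z 0 j) * (fun z : 'rV[R]_m => z 0 j).
  by apply/funext => z; rewrite enorm2 /dotp fct_sumE.
apply: differentiable_sum => j; apply: differentiableM; exact: differentiable_coord.
Qed.

(** Differentiability in one vector variable: the Jacobians in the definition of Gamma
are those of genuinely differentiable functions. *)
Lemma eval_differentiable (t : R) (z : nat -> 'rV[R]_m) (k : nat) lo hv ha l E :
  (l < n)%N -> wf lo hv ha l E ->
  (forall i, (lo <= i <= ha)%N -> enorm (z i) < 1) ->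
  differentiable (fun w => evalx t (upd z k w) E) (z k).
Proof.
move=> ln + zdom; elim: E => /=.
- by move=> a _; exact: differentiable_cst.
- by move=> _; exact: differentiable_cst.
- move=> i j _; rewrite /upd; case: eqP => _; last exact: differentiable_cst.
  exact: differentiable_coord.
- move=> l' i /and3P[ll li ih]; rewrite /upd; case: eqP => [ik|_]; last exact: differentiable_cst.
  apply: (@differentiable_comp _ _ _ _ (fun w : 'rV[R]_m => enorm w ^+ 2) (al l')).
    exact: differentiable_enorm2.
  apply/derivable1_diffP.
  have [] // := @al_derive l' (enorm (z k) ^+ 2) (leq_ltn_trans ll ln) _.
  by apply: enorm2_dom; rewrite -ik zdom// li.
- by move=> E1 H1 E2 H2 /andP[w1 w2]; apply: differentiableD; [exact: H1|exact: H2].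
- by move=> E1 H1 E2 H2 /andP[w1 w2]; apply: differentiableM; [exact: H1|exact: H2].
Qed.

End Expr.

Lemma is_derive_line (R : realType) (V W : normedModType R) (g : V -> W) (x v : V) (l : W) :
  is_derive (0 : R) 1 (fun s : R => g (s *: v + x)) l -> is_derive x v g l.
Proof.
have Q : (fun h : R => h^-1 *: (((fun s : R => g (s *: v + x)) \o shift (0 : R)) (h *: (1 : R)) -
    g ((0 : R) *: v + x))) = (fun h => h^-1 *: ((g \o shift x) (h *: v) - g x)).
  by apply/funext => h /=; rewrite addr0 scale0r add0r /GRing.scale/= mulr1.
move=> [dg gl]; split.
  by move: dg; rewrite /derivable Q.
by move: gl; rewrite /derive Q.
Qed.

Section GammaE.
Variables (R : realType) (m : nat).
Variables (c T : R) (alpha : R -> R) (al : nat -> R -> R) (n : nat).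
Hypothesis c0 : 0 < c.
Hypothesis al_derive : forall (l : nat) (s : R), (l < n)%N -> 0 <= s < 1 ->
  is_derive s 1 (al l) (al l.+1 s).
Hypothesis al_cont : forall (l : nat) (s : R), (l <= n)%N -> 0 <= s < 1 ->
  {for s, continuous (al l)}.
Hypothesis al0 : forall s : R, 0 <= s < 1 -> alpha s = al 0%N s.

Local Notation ev := (evalx c T al).
Local Notation Ga := (Gamma alpha c T).

(** Coordinate [j] of Gamma_k(t, zeta_i, ..., zeta_(i+k)). *)
Definition Gam (k i : nat) (j : 'I_m) : expr R m :=
  iter k (Dx c) (Mul (Al R m 0 i) (Var R i j)).

(** Each derivation adds one variable, but keeps it out of alpha. *)
Lemma Gam_wf k i j : wf i (i + k) (i + k.-1) k (Gam k i j).
Proof.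
elim: k => [|k IH] /=; first by rewrite addn0 leqnn.
rewrite addnS; apply: wfD; last exact: IH.
by rewrite leq_add2l leq_pred.
Qed.

(** By induction, Gamma_k agrees with the value of a term near the given point, so
that its partial derivatives are directional derivatives of that term; by
[dev_split] and [evalD] their sum is the value of the image of the term under
[Dx]. *)
Lemma GammaE k i t (z : nat -> 'rV[R]_m) : (k <= n)%N -> t != T ->
  (forall a, (a <= k)%N -> enorm (z (i + a)%N) < 1) ->
  Ga k t (fun a => z (i + a)%N) = \row_j ev t z (Gam k i j).
Proof.
elim: k t z => [|k IH] t z kn tT zdom.
  apply/rowP => j; rewrite /= /Gamma0 !mxE /= addn0 al0//.
  by apply: enorm2_dom; rewrite -[i]addn0 zdom.
have wfG j : wf i (i + k) (i + k) k (Gam k i j).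
  by apply: wf_le (Gam_wf k i j) => //; rewrite leq_add2l leq_pred.
have zdom' b : (i <= b <= i + k)%N -> enorm (z b) < 1.
  move=> /andP[ib bk]; rewrite -(subnKC ib); apply: zdom.
  by rewrite leqW// leq_subLR.
have near_dom (a : nat) : \forall w \near z (i + a)%N, (a <= k)%N -> enorm w < 1.
  have [ak|ka] := leqP a k; last by near=> w.
  have za : enorm (z (i + a)%N) < 1 by apply: zdom; exact: leqW.
  have := @enorm_continuous R m (z (i + a)%N).
  move=> /cvgr_lt /(_ _ za); apply: filterS => w wlt _; exact: wlt.
have nT := near_neq tT.
have E1 : derive1 (fun s : R => Ga k s (fun a => z (i + a)%N)) t =
    \row_j dev c T al t z 1 (fun=> 0) (Gam k i j).
  have H : is_derive t 1 (fun s : R => \row_j ev s z (Gam k i j))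
      (\row_j dev c T al t z 1 (fun=> 0) (Gam k i j)).
    apply: rV_is_derive => j; rewrite mxE.
    under eq_fun do rewrite mxE.
    apply: (@eval_is_derive _ _ _ _ _ _ c0 al_derive id (fun i _ => z i) t 1 (fun=> 0) i (i + k) (i + k) k) => //.
    by move=> b j' _; rewrite mxE; exact: is_derive_cst.
  have [_ <-] : is_derive t 1 (fun s : R => Ga k s (fun a => z (i + a)%N))
      (\row_j dev c T al t z 1 (fun=> 0) (Gam k i j)).
    apply: near_eq_is_derive H; near=> s; apply/esym; apply: IH.
    - exact: ltnW.
    - by near: s; exact: nT.
    - by move=> a ak; apply: zdom; exact: leqW.
  by rewrite derive1E.
have updE (a : nat) w b : upd (fun a => z (i + a)%N) a w b = upd z (i + a)%N w (i + b)%N.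
  by rewrite /upd eqn_add2l.
have E2 (a : 'I_k.+1) w :
   'd (fun w : 'rV[R]_m => Ga k t (upd (fun a => z (i + a)%N) a w)) (z (i + a)%N) w =
   \row_j dev c T al t z 0 (upd (fun=> 0) (i + a)%N w) (Gam k i j).
  have ak : (a <= k)%N by rewrite -ltnS.
  pose g (w : 'rV[R]_m) : 'rV[R]_m := \row_j ev t (upd z (i + a)%N w) (Gam k i j).
  have dg : differentiable g (z (i + a)%N).
    apply: rV_differentiable => j; rewrite /g; under eq_fun do rewrite mxE.
    by apply: (@eval_differentiable _ _ _ _ _ _ al_derive t z _ _ _ _ _ _ _ (wfG j)).
  have fg : \forall w \near z (i + a)%N,
      Ga k t (upd (fun a => z (i + a)%N) a w) = g w.
    apply: filterS (near_dom a) => v /(_ ak) v1.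
    rewrite (_ : upd _ _ _ = fun b => upd z (i + a)%N v (i + b)%N); last first.
      by apply/funext => b; exact: updE.
    apply: IH => //; first exact: ltnW.
    move=> b bk; rewrite /upd; case: eqP => // _; apply: zdom; exact: leqW.
  have [_ ->] := near_eq_diff fg dg.
  rewrite -deriveE//.
  have : is_derive (z (i + a)%N) w g
      (\row_j dev c T al t z 0 (upd (fun=> 0) (i + a)%N w) (Gam k i j)).
    apply: rV_is_derive => j; rewrite mxE; rewrite /g; under eq_fun do rewrite mxE.
    apply: is_derive_line.
    pose zeta b (s : R) := upd z (i + a)%N (s *: w + z (i + a)%N) b.
    have zeta0 : zeta^~ 0 = z.
      by apply/funext => b; rewrite /zeta /upd scale0r add0r; case: eqP => // ->.
    have := @eval_is_derive _ _ _ _ _ _ c0 al_derive (fun=> t) zeta 0 0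
      (upd (fun=> 0) (i + a)%N w) i (i + k) (i + k) k _ (leqnn _) kn (wfG j) tT.
    rewrite zeta0; apply.
    - move=> b j' _; rewrite /zeta /upd; case: eqP => _; last by rewrite mxE; exact: is_derive_cst.
      under eq_fun do rewrite !mxE.
      have := @is_deriveD R R R _ _ (0 : R) 1 _ _
        (is_deriveM (is_derive_id (0 : R) 1) (is_derive_cst (w 0 j') (0 : R) 1))
        (is_derive_cst (z (i + a)%N 0 j') (0 : R) 1).
      by rewrite /GRing.scale/= mul0r add0r mulr1 addr0.
    - by move=> b /zdom'; have -> : zeta b 0 = z b by rewrite -[in RHS]zeta0.
  by move=> [_ ->].
apply/rowP => j; rewrite mxE [LHS]/= E1 !mxE.
rewrite evalD (dev_split c T al t z (fld c T al t z) (wfG j)); congr (_ + _).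
rewrite summxE; apply: eq_bigr => a _; rewrite E2 mxE.
have ak : (a <= k)%N by rewrite -ltnS.
congr (dev _ _ _ _ _ _ _ _); congr (upd _ _ _).
rewrite /fld /Gamma0 al0 ?addnS//.
by apply: enorm2_dom; apply: zdom; exact: leqW.
Unshelve. all: by end_near. Qed.
End GammaE.

(** * The error variables *)

Section Errs.
Variables (R : realType) (m : nat).
Variables (c T : R) (alpha : R -> R) (al : nat -> R -> R) (n : nat).
Hypothesis c0 : 0 < c.
Hypothesis al_derive : forall (l : nat) (s : R), (l < n)%N -> 0 <= s < 1 ->
  is_derive s 1 (al l) (al l.+1 s).
Hypothesis al_cont : forall (l : nat) (s : R), (l <= n)%N -> 0 <= s < 1 ->
  {for s, continuous (al l)}.
Hypothesis al0 : forall s : R, 0 <= s < 1 -> alpha s = al 0%N s.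

Local Notation ev := (evalx c T al).
Local Notation V := 'rV[R]_m.

(** [ee t e k] is e_(k+1)(t) when [e i] is the i-th derivative of the error. *)
Definition ee (t : R) (e : nat -> V) (k : nat) : V := nth 0 (errs alpha c T t e k.+1) k.

Lemma size_errs t (e : nat -> V) k : size (errs alpha c T t e k) = k.
Proof. by elim: k => //= k IH; rewrite size_rcons IH. Qed.

Lemma nth_errs t (e : nat -> V) k i : (i < k)%N -> nth 0 (errs alpha c T t e k) i = ee t e i.
Proof.
elim: k => // k IH; rewrite ltnS leq_eqVlt => /predU1P[->//|ik].
by rewrite -IH//= nth_rcons size_errs ik.
Qed.

Lemma evalx_ext t (z z' : nat -> V) lo hv ha l (E : expr R m) : (ha <= hv)%N ->
  wf lo hv ha l E -> (forall i, (lo <= i <= hv)%N -> z i = z' i) ->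
  ev t z E = ev t z' E.
Proof.
move=> hah + zz; elim: E => //=.
- by move=> i j /zz ->.
- by move=> l' i /and3P[_ li ih]; rewrite zz// li (leq_trans ih).
- by move=> E1 H1 E2 H2 /andP[/H1 -> /H2 ->].
- by move=> E1 H1 E2 H2 /andP[/H1 -> /H2 ->].
Qed.

Lemma Gam_ha (k i : nat) (j : 'I_m) : wf i (i + k) (i + k) k (Gam c k i j).
Proof. by apply: wf_le (Gam_wf c k i j) => //; rewrite leq_add2l leq_pred. Qed.

(** Coordinate [j] of the sum of Gamma_(K-1-i)(zeta_i, ...) over [i < k].  In the
definition of e_(k+1) one has [K = k]; one differentiation in time turns it into
[K = k + 1]. *)
Definition gsum (K : nat) t (z : nat -> V) (k : nat) j :=
  \sum_(i < k) ev t z (Gam c (K - i.+1) i j).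

Lemma eeE t (e : nat -> V) k : (k <= n.+1)%N -> t != T ->
  (forall i, (i < k)%N -> enorm (ee t e i) < 1) ->
  forall j, ee t e k 0 j = phi c T t * (e k 0 j + gsum k t (ee t e) k j).
Proof.
move=> kn tT dom j; rewrite /ee /= nth_rcons size_errs ltnn eqxx !mxE -mulrDr.
congr (_ * (_ + _)); rewrite summxE; apply: eq_bigr => i _.
have ik : (i + (k - i.+1) < k)%N by have := ltn_ord i; lia.
rewrite (GammaE c0 al_derive al0 (z := nth 0 (errs alpha c T t e k))) ?mxE//.
- apply: evalx_ext (Gam_ha _ _ _) _ => // a /andP[ia ak].
  by rewrite nth_errs// (leq_ltn_trans ak).
- by have := ltn_ord i; lia.
- move=> a ak; rewrite nth_errs ?dom//; rewrite (leq_ltn_trans _ ik)// leq_add2l//.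
Qed.

(** The errors depend continuously on time and on the derivatives of the tracking
error.  The filter is arbitrary because the lemma is used for neighbourhoods of a
state, within segments, and for left limits. *)
Lemma ee_cvg (S : Type) (F : set_system S) (FF : Filter F) (tau : S -> R) (t : R)
    (e : S -> nat -> V) (e' : nat -> V) (k : nat) : (k <= n.+1)%N -> t != T ->
  tau @ F --> t -> (forall i, (i <= k)%N -> (fun s => e s i) @ F --> e' i) ->
  (forall i, (i < k)%N -> enorm (ee t e' i) < 1) ->
  (fun s => ee (tau s) (e s) k) @ F --> ee t e' k.
Proof.
elim/ltn_ind: k => k IH kn tT ctau ce dom.
have IH' i : (i < k)%N -> (fun s => ee (tau s) (e s) i) @ F --> ee t e' i.
  move=> ik; apply: IH => //.
  - by rewrite ltnW// (leq_trans ik).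
  - by move=> a ai; apply: ce; rewrite (leq_trans ai)// ltnW.
  - by move=> a ai; apply: dom; exact: ltn_trans ik.
have nT : \forall s \near F, tau s != T := ctau _ (near_neq tT).
have ndom : \forall s \near F, forall i : 'I_k, enorm (ee (tau s) (e s) i) < 1.
  apply: filter_forall => i.
  have := cvg_comp _ _ (IH' i (ltn_ord i)) (@enorm_continuous R m (ee t e' i)).
  by move=> /cvgr_lt /(_ _ (dom i (ltn_ord i))).
apply: rV_cvgP => j.
rewrite eeE//.
apply: (@cvg_trans _ ((fun s => phi c T (tau s) *
    (e s k 0 j + gsum k (tau s) (ee (tau s) (e s)) k j)) @ F)).
  apply: near_eq_cvg; near=> s; rewrite eeE//.
  - by near: s.
  - move=> i ik; have H : forall i : 'I_k, enorm (ee (tau s) (e s) i) < 1 by near: s.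
    exact: (H (Ordinal ik)).
apply: cvgM.
  apply: cvgM; first exact: cvg_cst.
  apply: cvgV; first by rewrite subr_eq0 eq_sym.
  by apply: cvgB => //; exact: cvg_cst.
apply: cvgD; first by apply: rV_cvg_coord; exact: ce.
apply: cvg_sum_seq => i.
have ik : (i + (k - i.+1) < k)%N by have := ltn_ord i; lia.
have L := @eval_cvg R m c T al n al_cont S F FF tau t (fun i s => ee (tau s) (e s) i)
  (ee t e') _ _ _ _ _ (leqnn _) _ (Gam_ha (k - i.+1) i j) tT ctau.
apply: L.
- by have := ltn_ord i; lia.
- by move=> a /andP[_ ak]; apply: IH'; exact: leq_ltn_trans ik.
- by move=> a /andP[_ ak]; apply: dom; exact: leq_ltn_trans ik.
Unshelve. all: by end_near. Qed.

Lemma al_lipx (l : nat) (q : R) : (l < n)%N -> 0 <= q < 1 -> lipx 0 q (al l).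
Proof.
move=> ln /andP[q0 q1].
have dom s : 0 <= s <= q -> 0 <= s < 1 by move=> /andP[-> /le_lt_trans ->].
have cw l' : (l' <= n)%N -> {within `[0, q], continuous (al l')}.
  move=> ln'; apply: continuous_in_subspaceT => s; rewrite inE/= in_itv/= => sq.
  by apply: al_cont => //; exact: dom.
have [M M0 HM] := segment_bounded (cw _ ln).
apply: (@lipx_C1 _ 0 q M (al l) (al l.+1)) => //.
- by apply: cw; exact: ltnW.
- by move=> t /andP[t0 tq]; apply: al_derive => //; apply: dom; rewrite !ltW.
Qed.

Lemma phi_lipx (b : R) : b < T -> lipx 0 b (phi c T).
Proof.
move=> bT; have [b0|b0] := ltP b 0.
  by exists 0 => s t /andP[/le_trans h /h]; rewrite leNgt b0.
have Tt t : t <= b -> 0 < T - t by move=> tb; rewrite subr_gt0 (le_lt_trans tb).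
have Tn t : t <= b -> t != T by move=> tb; rewrite lt_eqF// (le_lt_trans tb).
apply: (@lipx_C1 _ 0 b (c * phi c T b ^+ 2) (phi c T) (fun t => c * phi c T t ^+ 2)).
- apply: continuous_in_subspaceT => t; rewrite inE/= in_itv/= => /andP[_ tb].
  apply: cvgM; first exact: cvg_cst.
  apply: cvgV; first by rewrite gt_eqF// Tt.
  by apply: cvgB; [exact: cvg_cst|exact: cvg_id].
- move=> t /andP[_ tb]; rewrite -[c * _]mul1r.
  exact: (is_derive_phi c0 (Tn _ (ltW tb)) (is_derive_id t 1)).
- move=> t /andP[t0 tb]; have p0 : 0 < phi c T t by rewrite mulr_gt0 ?invr_gt0// Tt.
  rewrite ger0_norm; last by rewrite mulr_ge0 ?exprn_ge0 ?ltW.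
  apply: ler_wpM2l; first exact: ltW.
  apply: lerXn2r; [by rewrite nnegrE ltW| |].
    by rewrite nnegrE ltW// mulr_gt0 ?invr_gt0// Tt.
  rewrite /phi; apply: ler_wpM2l; first by rewrite invr_ge0 ltW.
  by rewrite lef_pV2 ?posrE ?Tt// lerB.
Qed.

Lemma evalx_lipx (b : R) (zeta : nat -> R -> V) lo hv ha l (E : expr R m) :
  0 <= b < T -> (ha <= hv)%N -> (l < n)%N -> wf lo hv ha l E ->
  (forall i j, (lo <= i <= hv)%N -> lipx 0 b (fun t => zeta i t 0 j)) ->
  (forall i t, (lo <= i <= ha)%N -> 0 <= t <= b -> enorm (zeta i t) < 1) ->
  lipx 0 b (fun t => ev t (zeta^~ t) E).
Proof.
move=> /andP[b0 bT] hah ln + lz dom; elim: E => /=.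
- by move=> a _; exact: lipx_cst.
- by move=> _; exact: phi_lipx.
- by move=> i j; exact: lz.
- move=> l' i /and3P[ll li ih].
  have ihv : (lo <= i <= hv)%N by rewrite li (leq_trans ih).
  have ls : lipx 0 b (fun t => enorm (zeta i t) ^+ 2).
    apply: (@lipx_eq _ 0 b (fun t => \sum_(j < m) zeta i t 0 j * zeta i t 0 j)).
      by move=> t _; rewrite enorm2.
    by apply: lipx_sum => j; apply: lipx_mul; exact: lz.
  have [K HK] := ls.
  have [tm tmb Hm] := EVT_max b0 (lipon_cont HK).
  rewrite in_itv/= in tmb.
  have sdom t : 0 <= t <= b -> 0 <= enorm (zeta i t) ^+ 2 < 1.
    by move=> tb; apply: enorm2_dom; apply: dom; rewrite ?li.
  apply: (lipx_comp (c := 0) (d := enorm (zeta i tm) ^+ 2) ls).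
    by apply: al_lipx; [exact: leq_ltn_trans ln|exact: sdom].
  move=> t tb; have /andP[-> _] := sdom t tb.
  by apply: Hm; rewrite in_itv.
- by move=> E1 H1 E2 H2 /andP[w1 w2]; apply: lipx_add; [exact: H1|exact: H2].
- by move=> E1 H1 E2 H2 /andP[w1 w2]; apply: lipx_mul; [exact: H1|exact: H2].
Qed.

Lemma ee_lipx (b : R) (e : R -> nat -> V) k : 0 <= b < T -> (k <= n)%N ->
  (forall i j, (i <= k)%N -> lipx 0 b (fun t => e t i 0 j)) ->
  (forall i t, (i < k)%N -> 0 <= t <= b -> enorm (ee t (e t) i) < 1) ->
  forall j, lipx 0 b (fun t => ee t (e t) k 0 j).
Proof.
move=> hb; have /andP[b0 bT] := hb.
elim/ltn_ind: k => k IH kn le dom j.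
have IH' i j' : (i < k)%N -> lipx 0 b (fun t => ee t (e t) i 0 j').
  move=> ik; apply: IH => //.
  - by rewrite ltnW// (leq_trans ik).
  - by move=> a j2 ai; apply: le; rewrite (leq_trans ai)// ltnW.
  - by move=> a t ai; apply: dom; exact: ltn_trans ik.
have Tn t : t <= b -> t != T by move=> tb; rewrite lt_eqF// (le_lt_trans tb).
apply: (@lipx_eq _ 0 b (fun t => phi c T t * (e t k 0 j + gsum k t (ee t (e t)) k j))).
  move=> t tb; rewrite eeE//; first exact: leqW.
    by case/andP: tb => _ /Tn.
  by move=> i ik; exact: dom.
apply: lipx_mul; first exact: phi_lipx.
apply: lipx_add; first exact: le.
apply: lipx_sum => i.
have ik : (i + (k - i.+1) < k)%N by have := ltn_ord i; lia.
apply: (evalx_lipx (zeta := fun i t => ee t (e t) i) hb _ _ (Gam_ha _ _ _)) => //.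
- by lia.
- by move=> a j' /andP[_ ak]; apply: IH'; exact: leq_ltn_trans ik.
- by move=> a t /andP[_ ak]; apply: dom; exact: leq_ltn_trans ik.
Qed.

(** For [i < k] the velocity of e_(i+1) is [fld], because the last summand of [gsum]
at [i + 1] is the term gamma_(i+1) that [fld] subtracts.  So the time derivative of
the terms in e_(k+1) is computed by [Dx]. *)
Lemma ee_derive (e : R -> nat -> V) (t : R) k : (k <= n)%N -> t != T ->
  (forall i j, (i <= k)%N -> is_derive t 1 (fun s => e s i 0 j) (e t i.+1 0 j)) ->
  (\forall s \near t, forall i : 'I_k, enorm (ee s (e s) i) < 1) ->
  forall j, is_derive t 1 (fun s => ee s (e s) k 0 j)
    (c * phi c T t * ee t (e t) k 0 j +
     phi c T t * (e t k.+1 0 j + gsum k.+1 t (ee t (e t)) k j)).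
Proof.
elim/ltn_ind: k => k IH kn tT de ndom j.
have dom i : (i < k)%N -> enorm (ee t (e t) i) < 1.
  by move=> ik; have := nbhs_singleton ndom; move=> /(_ (Ordinal ik)).
have IH' i j' : (i < k)%N -> is_derive t 1 (fun s => ee s (e s) i 0 j')
    (fld c T al t (ee t (e t)) i 0 j').
  move=> ik; have := IH i ik _ tT _ _ j'.
  rewrite /fld !mxE (eeE (k := i.+1))//; last 2 first.
  - by rewrite ltnW// ltnS (leq_trans ik).
  - by move=> a ai; apply: dom; exact: leq_trans ik.
  rewrite /gsum big_ord_recr/= subnn /=.
  set S2 := \sum_(_ < _) _.
  move=> H; have -> : phi c T t * (c * ee t (e t) i 0 j' - al 0 (enorm (ee t (e t) i) ^+ 2) *
      ee t (e t) i 0 j') + phi c T t * (e t i.+1 0 j' + (S2 + al 0 (enorm (ee t (e t) i) ^+ 2) *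
      ee t (e t) i 0 j')) = c * phi c T t * ee t (e t) i 0 j' + phi c T t * (e t i.+1 0 j' + S2).
    by ring.
  apply: H.
  - by rewrite ltnW// (leq_trans ik).
  - by move=> a j2 ai; apply: de; rewrite (leq_trans ai)// ltnW.
  - apply: filterS ndom => s H a; exact: (H (widen_ord (ltnW ik) a)).
have nT := near_neq tT.
apply: (@near_eq_is_derive _ _ _ (fun s => phi c T s * (e s k 0 j + gsum k s (ee s (e s)) k j))).
  apply: filterS2 nT ndom => s sT H; rewrite eeE//; first exact: leqW.
  by move=> i ik; exact: (H (Ordinal ik)).
have dS : is_derive t 1 (fun s => gsum k s (ee s (e s)) k j)
    (gsum k.+1 t (ee t (e t)) k j).
  have -> : (fun s => gsum k s (ee s (e s)) k j) =
     \sum_(i < k) (fun s => ev s (ee s (e s)) (Gam c (k - i.+1) i j)).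
    by apply/funext => s; rewrite fct_sumE.
  apply: is_derive_sum => i.
  have ik : (i + (k - i.+1) < k)%N by have := ltn_ord i; lia.
  have -> : (k.+1 - i.+1 = (k - i.+1).+1)%N by rewrite subSS subnSK.
  rewrite [Gam c _.+1 _ _]iterS evalD.
  apply: (eval_is_derive c0 al_derive (tau := id) (zeta := fun i s => ee s (e s) i) _ _ (Gam_ha _ _ _)) => //.
  - by lia.
  - by move=> a j' /andP[_ ak]; apply: IH'; exact: leq_ltn_trans ik.
  - by move=> a /andP[_ ak]; apply: dom; exact: leq_ltn_trans ik.
have dphi := is_derive_phi c0 tT (is_derive_id t 1).
have := is_deriveM dphi (is_deriveD (de k j (leqnn _)) dS).
rewrite /GRing.scale/= => H; rewrite eeE//; last exact: leqW.
have -> : c * phi c T t * (phi c T t * (e t k 0 j + gsum k t (ee t (e t)) k j)) +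
    phi c T t * (e t k.+1 0 j + gsum k.+1 t (ee t (e t)) k j) =
  phi c T t * (e t k.+1 0 j + gsum k.+1 t (ee t (e t)) k j) +
  (e t k 0 j + gsum k t (ee t (e t)) k j) * (1 * (c * phi c T t ^+ 2)) by ring.
exact: H.
Qed.

End Errs.

(** * Growth in powers of phi *)

Section Weights.
Variables (R : realType) (m : nat).
Variables (c T : R) (alpha : R -> R) (al : nat -> R -> R) (n : nat).
Hypothesis c0 : 0 < c.
Hypothesis al_cont : forall (l : nat) (s : R), (l <= n)%N -> 0 <= s < 1 ->
  {for s, continuous (al l)}.
Variable om : R.
Hypothesis om0 : 0 < om.
Hypothesis omT : om <= T.

Local Notation ev := (evalx c T al).
Local Notation V := 'rV[R]_m.

Lemma phi_gt0 (t : R) : t < om -> 0 < phi c T t.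
Proof.
by move=> tom; rewrite mulr_gt0 ?invr_gt0// subr_gt0 (lt_le_trans tom).
Qed.

Lemma phi_ge (t : R) : 0 <= t < om -> phi c T 0 <= phi c T t.
Proof.
move=> /andP[t0 tom]; rewrite /phi; apply: ler_wpM2l; first by rewrite invr_ge0 ltW.
have tT := lt_le_trans tom omT.
by rewrite lef_pV2 ?posrE ?subr_gt0// ?(le_lt_trans t0)// lerB.
Qed.

(** [g] is O(phi ^ w) on [0, om). *)
Definition bigOphi (w : int) (g : R -> R) :=
  exists2 C : R, 0 <= C & forall t, 0 <= t < om -> `|g t| <= C * phi c T t ^ w.

Lemma bigOphi_le (w w' : int) g : (w <= w')%R -> bigOphi w g -> bigOphi w' g.
Proof.
move=> ww [C C0 HC]; pose p0 := phi c T 0.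
have p00 : 0 < p0 by apply: phi_gt0.
have [k wk] : exists k : nat, w' = w + k%:Z.
  by exists (absz (w' - w)); lia.
exists (C * p0 ^- k); first by rewrite mulr_ge0// invr_ge0 exprn_ge0// ltW.
move=> t tom; rewrite (le_trans (HC t tom))// -mulrA ler_wpM2l//.
have p0t := phi_ge tom; have pt : 0 < phi c T t by apply: phi_gt0; case/andP: tom.
rewrite wk expfzDr ?gt_eqF// mulrCA -[leLHS]mulr1 ler_pM2l ?exprz_gt0//.
rewrite mulrC ler_pdivlMr ?exprn_gt0// mul1r -exprnP; by apply: lerXn2r => //; rewrite ?nnegrE ltW.
Qed.

Lemma bigOphi_add w f g : bigOphi w f -> bigOphi w g -> bigOphi w (fun t => f t + g t).
Proof.
move=> [C C0 HC] [C' C0' HC']; exists (C + C'); first exact: addr_ge0.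
by move=> t tom; rewrite (le_trans (ler_normD _ _))// mulrDl lerD ?HC ?HC'.
Qed.

Lemma bigOphi_mul w w' f g : bigOphi w f -> bigOphi w' g ->
  bigOphi (w + w') (fun t => f t * g t).
Proof.
move=> [C C0 HC] [C' C0' HC']; exists (C * C'); first exact: mulr_ge0.
move=> t tom; have pt : 0 < phi c T t by apply: phi_gt0; case/andP: tom.
by rewrite normrM expfzDr ?gt_eqF// mulrACA ler_pM ?HC ?HC'.
Qed.

Lemma bigOphi_cst a : bigOphi 0 (fun=> a).
Proof. by exists `|a| => // t _; rewrite expr0z mulr1. Qed.

Lemma bigOphi_phi : bigOphi 1 (phi c T).
Proof.
exists 1 => // t /andP[_ tom]; rewrite mul1r expr1z ger0_norm// ltW//.
exact: phi_gt0.
Qed.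

Lemma bigOphi_sum w (I : Type) (r : seq I) (F : I -> R -> R) : (forall i, bigOphi w (F i)) ->
  bigOphi w (fun t => \sum_(i <- r) F i t).
Proof.
move=> H; elim: r => [|i r [C' C0' HC']].
  exists 0 => // t _; by rewrite big_nil normr0 mul0r.
have [C C0 HC] := H i; exists (C + C'); first exact: addr_ge0.
move=> t tom; rewrite big_cons (le_trans (ler_normD _ _))// mulrDl.
by rewrite lerD ?HC ?HC'.
Qed.

(** The growth order of an expression as a power of phi, when the i-th variable is
O(phi ^ (i - n)) and the values of [al] are bounded. *)
Fixpoint wt (E : expr R m) : int :=
  match E with
  | Cst _ | Al _ _ => 0
  | Ph => 1
  | Var i _ => i%:Z - n%:Z
  | Add E1 E2 => Num.max (wt E1) (wt E2)
  | Mul E1 E2 => wt E1 + wt E2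
  end.

Lemma wt_sum (F : 'I_m -> expr R m) (w : int) : 0 <= w -> (forall j, wt (F j) <= w) ->
  wt (\big[(@Add R m)/Cst _ 0]_(j < m) F j) <= w.
Proof.
by move=> w0 H; elim/big_ind : _ => //= x y hx hy; rewrite ge_max hx.
Qed.

(** A derivation raises the order by one: it replaces zeta_i, of order [i - n], by phi
times a multiple of zeta_i plus zeta_(i+1), of order [i + 1 - n]. *)
Lemma wtD lo hv ha l (E : expr R m) : (ha <= n)%N -> wf lo hv ha l E ->
  wt (Dx c E) <= wt E + 1.
Proof.
move=> han; elim: E => //=.
- by move=> i j _; rewrite ge_max; lia.
- move=> l' i /and3P[_ _ ih]; rewrite !add0r.
  by apply: wt_sum => // j /=; have := leq_trans ih han; rewrite ?addrA; lia.
- by move=> E1 H1 E2 H2 /andP[/H1 h1 /H2 h2]; lia.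
- by move=> E1 H1 E2 H2 /andP[/H1 h1 /H2 h2]; lia.
Qed.

Lemma wt_Gam k i (j : 'I_m) : (i + k.-1 <= n)%N ->
  wt (Gam c k i j) <= i%:Z - n%:Z + k%:Z.
Proof.
elim: k => [|k IH] ikn /=; first by rewrite add0r addr0.
rewrite (le_trans (wtD _ (Gam_wf c k i j)))//; first by lia.
have := IH (leq_trans _ ikn); rewrite leq_add2l leq_pred => /(_ isT); lia.
Qed.

Lemma evalx_bigOphi (zeta : nat -> R -> V) lo hv ha l (E : expr R m) :
  wf lo hv ha l E ->
  (forall i j, (lo <= i <= hv)%N -> bigOphi (i%:Z - n%:Z) (fun t => zeta i t 0 j)) ->
  (forall l' i, (l' <= l)%N -> (lo <= i <= ha)%N ->
     bigOphi 0 (fun t => al l' (enorm (zeta i t) ^+ 2))) ->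
  bigOphi (wt E) (fun t => ev t (zeta^~ t) E).
Proof.
move=> + Hv Ha; elim: E => /=.
- by move=> a _; exact: bigOphi_cst.
- by move=> _; exact: bigOphi_phi.
- by move=> i j /Hv.
- by move=> l' i /andP[h1 h2]; apply: Ha.
- move=> E1 H1 E2 H2 /andP[/H1 h1 /H2 h2].
  by apply: bigOphi_add; [apply: bigOphi_le h1|apply: bigOphi_le h2]; rewrite le_max lexx ?orbT.
- by move=> E1 H1 E2 H2 /andP[/H1 h1 /H2 h2]; exact: bigOphi_mul.
Qed.

Lemma al_bounded (l : nat) (q : R) : (l <= n)%N -> 0 <= q < 1 ->
  exists2 M, 0 <= M & forall s, 0 <= s <= q -> `|al l s| <= M.
Proof.
move=> ln /andP[q0 q1].
have cw : {within `[0, q], continuous (al l)}.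
  apply: continuous_in_subspaceT => s; rewrite inE/= in_itv/= => /andP[s0 sq].
  by apply: al_cont => //; rewrite s0 (le_lt_trans sq).
exact: segment_bounded.
Qed.

Lemma gsum_bigOphi (q : R) (zeta : nat -> R -> V) K k (j : 'I_m) :
  (k <= n)%N -> (k <= K)%N -> (K <= n.+1)%N -> 0 <= q < 1 ->
  (forall i j, (i <= n)%N -> bigOphi (i%:Z - n%:Z) (fun t => zeta i t 0 j)) ->
  (forall i t, (i < n)%N -> 0 <= t < om -> enorm (zeta i t) <= q) ->
  bigOphi (K%:Z - 1 - n%:Z) (fun t => gsum c T al K t (zeta^~ t) k j).
Proof.
move=> kn kK Kn q01 Hv Hq; apply: bigOphi_sum => i.
have ik := ltn_ord i.
have := @evalx_bigOphi zeta _ _ _ _ _ (Gam_wf c (K - i.+1) i j) _ _.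
move=> H; apply: bigOphi_le (H _ _).
- apply: le_trans (wt_Gam _ _) _; lia.
- by move=> a j' /andP[_ ak]; apply: Hv; lia.
- move=> l' a ll /andP[_ ah]; have an : (a < n)%N by lia.
  have q2 : 0 <= q ^+ 2 < 1.
    by case/andP: q01 => q0 q1; rewrite exprn_ge0// expr_lt1.
  have ln : (l' <= n)%N by lia.
  have [M M0 HM] := al_bounded ln q2.
  exists M => // t tom; rewrite expr0z mulr1; apply: HM.
  by rewrite exprn_ge0 ?enorm_ge0// lerXn2r ?nnegrE ?enorm_ge0 ?Hq//; case/andP: q01.
Qed.

End Weights.

(** * A priori bounds along a trajectory *)

Section Trajectory.
Variables (R : realType) (m : nat).
Notation mu := (@lebesgue_measure R).
Variables (c T : R) (alpha : R -> R) (al : nat -> R -> R) (n : nat).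
Hypothesis c0 : 0 < c.
Hypothesis al_derive : forall (l : nat) (s : R), (l < n)%N -> 0 <= s < 1 ->
  is_derive s 1 (al l) (al l.+1 s).
Hypothesis al_cont : forall (l : nat) (s : R), (l <= n)%N -> 0 <= s < 1 ->
  {for s, continuous (al l)}.
Hypothesis al0 : forall s : R, 0 <= s < 1 -> alpha s = al 0%N s.
Hypothesis al_ge : forall s : R, 0 <= s < 1 -> c * n.+2%:R <= al 0%N s.
Hypothesis al_large : forall K : R, exists2 s0 : R, 0 <= s0 < 1 &
  forall s, s0 <= s < 1 -> K <= al 0%N s.
Variable om : R.
Hypothesis om0 : 0 < om.
Hypothesis omT : om <= T.

Local Notation V := 'rV[R]_m.
Variable e : R -> nat -> V.
Hypothesis e_lip : forall b, 0 <= b < om -> forall i j, (i <= n)%N ->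
  lipx 0 b (fun t => e t i 0 j).
Hypothesis e_derive : {ae mu, forall t : R, 0 < t < om -> forall i j, (i <= n)%N ->
  is_derive t 1 (fun s => e s i 0 j) (e t i.+1 0 j)}.

Local Notation z k t := (ee c T alpha t (e t) k).
Hypothesis z_lt1 : forall t k, (k <= n)%N -> 0 <= t < om -> enorm (z k t) < 1.

Local Notation N2 k := (fun t => enorm (z k t) ^+ 2).

Lemma z_lipx b k j : 0 <= b < om -> (k <= n)%N -> lipx 0 b (fun t => z k t 0 j).
Proof.
move=> /andP[b0 bom] kn; apply: (ee_lipx c0 al_derive al_cont al0) => //.
- by rewrite b0 (lt_le_trans bom).
- by move=> i j' ik; apply: e_lip; rewrite ?b0// (leq_trans ik).
- move=> i t ik /andP[t0 tb]; apply: z_lt1; first by rewrite ltnW// (leq_trans ik).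
  by rewrite t0 (le_lt_trans tb).
Qed.

Lemma N2_lipx b k : 0 <= b < om -> (k <= n)%N -> lipx 0 b (N2 k).
Proof.
move=> hb kn; apply: (@lipx_eq _ 0 b (fun t => \sum_(j < m) z k t 0 j * z k t 0 j)).
  by move=> t _; rewrite enorm2.
by apply: lipx_sum => j; apply: lipx_mul; exact: z_lipx.
Qed.

(** The velocity of e_(k+1). *)
Definition zrhs k t : V := (c * phi c T t) *: z k t +
  phi c T t *: (e t k.+1 + \row_j gsum c T al k.+1 t (ee c T alpha t (e t)) k j).

Lemma z_derive : {ae mu, forall t : R, 0 < t < om -> forall k, (k <= n)%N ->
  is_derive t 1 (N2 k) (2 * dotp (z k t) (zrhs k t))}.
Proof.
apply: aeS e_derive => t H tom k kn; have /andP[t0 tlt] := tom.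
apply: is_derive_enorm2 => j.
have -> : zrhs k t 0 j = c * phi c T t * z k t 0 j +
     phi c T t * (e t k.+1 0 j + gsum c T al k.+1 t (ee c T alpha t (e t)) k j).
  by rewrite /zrhs !mxE.
apply: (ee_derive c0 al_derive al0) => //.
- by rewrite lt_eqF// (lt_le_trans tlt).
- by move=> i j' ik; apply: H => //; exact: leq_trans kn.
- near=> s => i; apply: z_lt1; first by rewrite ltnW// (leq_trans (ltn_ord i)).
  by apply/andP; split; [apply: ltW; near: s; exact: lt_nbhsr|near: s; exact: lt_nbhsl].
Unshelve. all: by end_near. Qed.

(** In [z k.+1] the sum of the functions Gamma has one more summand than in the velocity
of [z k], namely gamma_(k+1), so that this velocity is
[c phi z_k - phi gamma_(k+1) + z_(k+1)]. *)
Lemma dotp_zrhs k t : (k < n)%N -> 0 <= t < om ->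
  dotp (z k t) (zrhs k t) =
  phi c T t * (c - al 0 (N2 k t)) * N2 k t + dotp (z k t) (z k.+1 t).
Proof.
move=> kn tom; have tT : t != T.
  by case/andP: tom => _ tom; rewrite lt_eqF// (lt_le_trans tom).
have E : zrhs k t = (phi c T t * (c - al 0 (N2 k t))) *: z k t + z k.+1 t.
  apply/rowP => j; rewrite /zrhs !mxE (eeE c0 al_derive al0 (k := k.+1)) //; last 2 first.
  - by rewrite ltnW.
  - by move=> i ik; apply: z_lt1 => //; rewrite -ltnS (leq_trans ik)// ltnW.
  rewrite /gsum big_ord_recr/= subnn/=.
  set S2 := \sum_(_ < _) _; ring.
by rewrite E dotpDr dotpZr enorm2.
Qed.

Lemma z_barrier k (B B' : R) : (k <= n)%N -> B < B' ->
  {ae mu, forall t, 0 < t < om -> B < N2 k t < B' -> dotp (z k t) (zrhs k t) <= 0} ->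
  N2 k 0 <= B -> forall t, 0 <= t < om -> N2 k t <= B.
Proof.
move=> kn BB H H0; apply: (barrier BB) => //.
  by move=> b hb; exact: N2_lipx.
apply: aeS2 z_derive H => t h1 h2 tom tB.
exists (2 * dotp (z k t) (zrhs k t)); first exact: h1.
by rewrite pmulr_rle0// h2.
Qed.

Let om00 : 0 <= (0 : R) < om. Proof. by rewrite lexx. Qed.

(** Near the unit sphere the damping [phi (alpha - c) |z_k|^2] exceeds
[<z_k, z_(k+1)> <= |z_k|], because alpha is unbounded there. *)
Lemma z_le_q k : (k < n)%N -> exists2 q : R, 0 <= q < 1 &
  forall t, 0 <= t < om -> enorm (z k t) <= q.
Proof.
move=> kn; pose p0 := phi c T 0.
have p00 : 0 < p0 by exact: (phi_gt0 c0 omT).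
(* For |z_k| >= 1/2 a damping phi (alpha - c) >= 2 suffices, and phi >= phi(0). *)
have [s0 s01 Hs0] := al_large (c + 2 / p0).
pose B := Num.max (N2 k 0) (Num.max s0 (1 / 4)).
have B1 : B < 1.
  rewrite !gt_max (_ : (1 / 4 : R) < 1); last by lra.
  rewrite andbT; have /andP[_ ->] := enorm2_dom (z_lt1 (ltnW kn) om00).
  by case/andP: s01.
have Bz : N2 k 0 <= B by rewrite le_max lexx.
have Bs : s0 <= B by rewrite !le_max lexx orbT.
have Bq : 1 / 4 <= B by rewrite !le_max lexx !orbT.
have H : forall t, 0 <= t < om -> N2 k t <= B.
  apply: (z_barrier (ltnW kn) B1) Bz; apply: aeW => t /andP[t0 tlt] /andP[Bt t1].
  have tom : 0 <= t < om by rewrite ltW.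
  rewrite dotp_zrhs//; set y := enorm (z k t) in Bt t1 *.
  have y0 : 0 <= y by exact: enorm_ge0.
  have yz : dotp (z k t) (z k.+1 t) <= y.
    rewrite (le_trans (cauchy_schwarz _ _))// ler_piMr// ltW//.
    exact: z_lt1.
  have aly := Hs0 (y ^+ 2) _; have {}aly : c + 2 / p0 <= al 0 (y ^+ 2).
    by apply: Hs0; rewrite t1 (le_trans Bs)// ltW.
  have pt := phi_ge c0 omT tom; rewrite -/p0 in pt.
  have y2 : 1 / 2 <= y.
    rewrite leNgt; apply/negP => y2; have : 1 / 4 < y ^+ 2 by exact: le_lt_trans Bt.
    by rewrite expr2; nra.
  have h1 : 2 <= phi c T t * (al 0 (y ^+ 2) - c).
    have h2 : 2 / p0 <= al 0 (y ^+ 2) - c by lra.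
    apply: le_trans (_ : p0 * (2 / p0) <= _).
      by rewrite mulrC divfK// gt_eqF.
    by apply: ler_pM => //; [exact: ltW|rewrite divr_ge0// ltW].
  have -> : phi c T t * (c - al 0 (y ^+ 2)) * y ^+ 2 =
      - (phi c T t * (al 0 (y ^+ 2) - c)) * y ^+ 2 by ring.
  move: h1; set A := phi c T t * _ => h1.
  have : y <= A * y ^+ 2.
    have : 1 <= A * y by nra.
    by rewrite expr2 mulrA; nra.
  lra.
have B0 : 0 <= B by rewrite (le_trans _ Bq)//; lra.
exists (Num.sqrt B).
  by rewrite sqrtr_ge0/= -sqrtr1 ltr_sqrt.
by move=> t tom; have := H t tom; rewrite -ler_sqrt// sqrtr_sqr ger0_norm ?enorm_ge0.
Qed.

Lemma z_uniform : exists2 q : R, 0 <= q < 1 &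
  forall k t, (k < n)%N -> 0 <= t < om -> enorm (z k t) <= q.
Proof.
have H K : (K <= n)%N -> exists2 q : R, 0 <= q < 1 &
  forall k t, (k < K)%N -> 0 <= t < om -> enorm (z k t) <= q.
  elim: K => [_|K IH Kn]; first by exists 0 => //; rewrite lexx ltr01.
  have [q /andP[q0 q1] Hq] := IH (ltnW Kn).
  have [q' /andP[q0' q1'] Hq'] := z_le_q Kn.
  exists (Num.max q q'); first by rewrite le_max q0 gt_max q1.
  move=> k t; rewrite ltnS leq_eqVlt => /predU1P[->|kK] tom.
    by rewrite le_max Hq' ?orbT.
  by rewrite le_max Hq.
have [q q01 Hq] := H n (leqnn n).
by exists q.
Qed.

Lemma is_derive_phiX (t : R) (k : nat) : t < om ->
  is_derive t 1 (fun s => phi c T s ^+ k) (k%:R * c * phi c T t * phi c T t ^+ k).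
Proof.
move=> tom; have tT : t != T by rewrite lt_eqF// (lt_le_trans tom).
have d := is_deriveX k (is_derive_phi c0 tT (is_derive_id t 1)).
have -> : (fun s => phi c T s ^+ k) = (phi c T) ^+ k.
  by apply/funext => s; rewrite exprfctE.
case: k d => [|k] d.
  rewrite !mul0r expr0; exact: is_derive_cst.
have -> : k.+1%:R * c * phi c T t * phi c T t ^+ k.+1 =
  (k.+1%:R * phi c T t ^+ k.+1.-1) *: (1 * (c * phi c T t ^+ 2)).
  by rewrite /GRing.scale/= exprS expr2; ring.
exact: d.
Qed.

Lemma phiX_lipx b k : 0 <= b < om -> lipx 0 b (fun t => phi c T t ^+ k).
Proof.
move=> /andP[b0 bom]; elim: k => [|k IH].
  by apply: lipx_eq (lipx_cst 0 b 1) => t _; rewrite expr0.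
apply: (@lipx_eq _ 0 b (fun t => phi c T t * phi c T t ^+ k)).
  by move=> t _; rewrite exprS.
by apply: lipx_mul => //; apply: phi_lipx => //; exact: lt_le_trans omT.
Qed.

(** Downward induction on [k].  The weight [phi ^ (2 (d + 1))] grows at the relative
rate [2 (d + 1) c phi], at most [2 n c phi], whereas [|z k| ^ 2] is damped at the rate
[2 (alpha - c) phi >= 2 (n + 1) c phi]; the surplus absorbs [z k.+1], which is bounded
by [B / phi ^ d]. *)
Lemma z_decay d k : (k + d = n)%N -> exists2 B, 0 <= B &
  forall t, 0 <= t < om -> phi c T t ^+ d * enorm (z k t) <= B.
Proof.
elim: d k => [|d IH] k kdn.
  exists 1 => // t tom; rewrite expr0 mul1r ltW// z_lt1//; lia.
have kn : (k < n)%N by lia.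
have dn : d.+1%:R <= n%:R :> R by rewrite ler_nat -kdn leq_addl.
have [B B0 HB] := IH k.+1 (ltac:(lia)).
pose W t := phi c T t ^+ (d.+1 * 2) * N2 k t.
pose M := Num.max (W 0) ((B / c) ^+ 2).
have HW : forall t, 0 <= t < om -> W t <= M.
  apply: (@barrier _ om M (M + 1) W).
  - by rewrite ltrDl.
  - move=> b hb; apply: lipx_mul; first exact: phiX_lipx.
    by apply: N2_lipx => //; exact: ltnW.
  - apply: aeS z_derive => t Hd /andP[t0 tlt] /andP[Mt _].
    have tom : 0 <= t < om by rewrite ltW.
    have dW := is_deriveM (is_derive_phiX (d.+1 * 2) tlt)
      (Hd (ltac:(by rewrite t0)) k (ltnW kn)).
    eexists; first exact: dW.
    rewrite /GRing.scale/= dotp_zrhs//.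
    have pt : 0 < phi c T t by exact: (phi_gt0 c0 omT).
    have ay := al_ge (enorm2_dom (z_lt1 (ltnW kn) tom)).
    have zz := cauchy_schwarz (z k t) (z k.+1 t).
    have HBt := HB t tom.
    have y0 := enorm_ge0 (z k t); have y10 := enorm_ge0 (z k.+1 t).
    move: Mt; rewrite /W gt_max => /andP[_ Mt].
    set p := phi c T t in pt HBt Mt *; set y := enorm (z k t) in ay zz y0 Mt *.
    set y1 := enorm (z k.+1 t) in zz HBt y10 *.
    set a := al 0 (y ^+ 2) in ay *; set dd := dotp (z k t) (z k.+1 t) in zz *.
    pose Y := p ^+ d.+1 * y.
    have Y0 : 0 <= Y by rewrite mulr_ge0// exprn_ge0// ltW.
    have YE : p ^+ (d.+1 * 2) * y ^+ 2 = Y ^+ 2 by rewrite /Y [in LHS]exprM -exprMn.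
    rewrite YE in Mt.
    have BY : B < c * Y.
      rewrite mulrC -ltr_pdivrMr//.
      have BC0 : 0 <= B / c by rewrite divr_ge0// ltW.
      by rewrite -(@ltr_pXn2r _ 2)// nnegrE.
    have P0 : 0 <= p ^+ (d.+1 * 2) by rewrite exprn_ge0// ltW.
    have h1 : p ^+ (d.+1 * 2) * dd <= p * (Y * B).
      apply: (@le_trans _ _ (p ^+ (d.+1 * 2) * (y * y1))); first exact: ler_wpM2l.
      have -> : p ^+ (d.+1 * 2) * (y * y1) = p * (Y * (p ^+ d * y1)).
        by rewrite /Y muln2 -addnn exprD !exprS; ring.
      by apply: ler_wpM2l (ltW pt) _ _ _; apply: ler_wpM2l.
    have ha : d.+1%:R * c + c - a <= - c.
      have : c * d.+1%:R <= c * n%:R by rewrite ler_wpM2l// ltW.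
      have : c * n.+2%:R = c * n%:R + 2 * c by rewrite -addn2 natrD mulrDr [c * 2]mulrC.
      by rewrite [_ * c]mulrC; lra.
    have -> : p ^+ (d.+1 * 2) * (2 * (p * (c - a) * y ^+ 2 + dd)) +
       y ^+ 2 * ((d.+1 * 2)%:R * c * p * p ^+ (d.+1 * 2)) =
      2 * (p * (d.+1%:R * c + c - a) * (p ^+ (d.+1 * 2) * y ^+ 2) + p ^+ (d.+1 * 2) * dd).
      by rewrite natrM; ring.
    rewrite YE pmulr_rle0//.
    have h2 : p * (d.+1%:R * c + c - a) * Y ^+ 2 <= p * (- c) * Y ^+ 2.
      by rewrite ler_wpM2r ?exprn_ge0// ler_wpM2l// ltW.
    have h3 : p * (Y * B) <= p * (Y * (c * Y)).
      by apply: ler_wpM2l (ltW pt) _ _ _; apply: ler_wpM2l => //; exact: ltW.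
    have -> : (0 : R) = p * (- c) * Y ^+ 2 + p * (Y * (c * Y)) by ring.
    by rewrite lerD// (le_trans h1).
  - by rewrite le_max lexx.
have M0 : 0 <= M by rewrite le_max sqr_ge0 orbT.
exists (Num.sqrt M); first exact: sqrtr_ge0.
move=> t tom; have pt : 0 < phi c T t by apply: (phi_gt0 c0 omT); case/andP: tom.
have := HW t tom; rewrite /W exprM -exprMn -ler_sqrt// sqrtr_sqr ger0_norm//.
by rewrite mulr_ge0 ?enorm_ge0// exprn_ge0// ltW.
Qed.

Lemma z_bigOphi k j : (k <= n)%N -> bigOphi c T om (k%:Z - n%:Z) (fun t => z k t 0 j).
Proof.
move=> kn; have [B B0 HB] := @z_decay (n - k) k (subnKC kn).
exists B => // t tom; have pt : 0 < phi c T t by apply: (phi_gt0 c0 omT); case/andP: tom.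
have -> : k%:Z - n%:Z = - (n - k)%N%:Z by lia.
rewrite -exprnN ler_pdivlMr ?exprn_gt0// mulrC (le_trans _ (HB t tom))//.
by rewrite ler_wpM2l ?coord_le_enorm// exprn_ge0// ltW.
Qed.

Lemma gsum_z_bigOphi K k j : (k <= n)%N -> (k <= K)%N -> (K <= n.+1)%N ->
  bigOphi c T om (K%:Z - 1 - n%:Z)
    (fun t => gsum c T al K t (ee c T alpha t (e t)) k j).
Proof.
move=> kn kK Kn; have [q q01 Hq] := z_uniform.
apply: (gsum_bigOphi c0 al_cont om0 omT j kn kK Kn q01 (zeta := fun i t => z i t)).
- by move=> i j'; exact: z_bigOphi.
- by move=> i t; exact: Hq.
Qed.

(** Solve the definition of e_(k+1) for the [k]-th derivative of the tracking error:
all other terms are O(1/phi) by [z_bigOphi] and [gsum_z_bigOphi]. *)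
Lemma e_bigOphi k j : (k <= n)%N -> bigOphi c T om (-1) (fun t => e t k 0 j).
Proof.
move=> kn.
apply: (@bigOphi_le _ c T c0 om om0 omT (k%:Z - n%:Z - 1)); first by lia.
have Hz := z_bigOphi j kn.
have Hg := @gsum_z_bigOphi k k j kn (leqnn k) (leqW kn).
have Hp : bigOphi c T om (-1) (fun t => (phi c T t)^-1).
  exists 1 => // t tom; have pt : 0 < phi c T t by apply: (phi_gt0 c0 omT); case/andP: tom.
  rewrite mul1r exprN1 ger0_norm ?invr_ge0 ?(ltW pt)//.
have [C C0 HC] := bigOphi_mul c0 omT Hz Hp; have [C' C0' HC'] := Hg.
exists (C + C'); first exact: addr_ge0.
move=> t tom; have pt : 0 < phi c T t by apply: (phi_gt0 c0 omT); case/andP: tom.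
have tT : t != T.
  by case/andP: tom => _ tom; rewrite lt_eqF// (lt_le_trans tom).
have -> : e t k 0 j = z k t 0 j * (phi c T t)^-1 - gsum c T al k t (ee c T alpha t (e t)) k j.
  rewrite (eeE c0 al_derive al0 _ tT) ?leqW//; last first.
    by move=> i ik; apply: z_lt1 => //; rewrite ltnW// (leq_trans ik).
  by rewrite mulrAC divff ?gt_eqF// mul1r addrK.
rewrite (le_trans (ler_normB _ _))// mulrDl lerD ?HC//.
by have := HC' t tom; rewrite addrAC.
Qed.

End Trajectory.

(** * Compactness of Lipschitz paths *)

Section Compactness.
Context {R : realType}.
Notation mu := (@lebesgue_measure R).

Lemma grid_point (t0 delta t : R) K : 0 <= delta -> t0 <= t <= t0 + K%:R * delta ->
  exists2 i : nat, (i <= K)%N & `|t - (t0 + i%:R * delta)| <= delta.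
Proof.
move=> d0; elim: K => [|K IH] /andP[h1 h2].
  exists 0%N => //; have -> : t = t0 by move: h2; rewrite mul0r addr0 => h2; apply/eqP; rewrite eq_le h2.
  by rewrite mul0r addr0 subrr normr0.
have [h|h] := leP t (t0 + K%:R * delta).
  by have [|i iK Hi] := IH; [rewrite h1|exists i => //; exact: leqW].
exists K; first exact: leqnSn.
rewrite gtr0_norm ?subr_gt0// lerBlDl (le_trans h2)//.
by rewrite -addn1 natrD mulrDl mul1r addrA.
Qed.

(** Arzela-Ascoli.  Tychonoff's theorem gives a cluster point for pointwise
convergence, and the common Lipschitz constant turns closeness at the points of a
fine finite grid into uniform closeness. *)
Lemma lip_seq_compact n (t0 t1 M : R) (B : R -> R) (Z : nat -> R -> 'rV[R]_n) : t0 <= t1 -> 0 <= M ->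
  (forall N t j, `|Z N t 0 j| <= B t) ->
  (forall N N' t, t <= t0 -> Z N t = Z N' t) ->
  (forall N j, lipon t0 t1 M (fun t => Z N t 0 j)) ->
  (forall N t, t1 <= t -> Z N t = Z N t1) ->
  exists (p : R -> 'rV[R]_n) (sg : nat -> nat), [/\
    forall N t, t <= t0 -> p t = Z N t,
    forall j, lipon t0 t1 M (fun t => p t 0 j),
    forall t, t1 <= t -> p t = p t1,
    forall k, (k <= sg k)%N
  & forall k t j, `|Z (sg k) t 0 j - p t 0 j| <= k.+1%:R^-1].
Proof.
move=> t01 M0 ZB Zhist Zlip Zcst.
pose A (t : R) : set 'rV[R]_n := [set v | forall j, `[- B t, B t]%classic (v 0 j)].
have cA : @compact (prod_topology (fun _ : R => 'rV[R]_n)) [set f | forall t, A t (f t)].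
  by apply: tychonoff => t; apply: (@rV_compact R n (fun=> `[- B t, B t]%classic)) => j;
    exact: segment_compact.
have [p [_ cl]] : [set f : prod_topology (fun _ : R => 'rV[R]_n) | forall t, A t (f t)] `&`
    @cluster (prod_topology (fun _ : R => 'rV[R]_n)) (Z @ \oo) !=set0.
  apply: cA; exists 0%N => // N _ t j; rewrite /= in_itv/= -ler_norml; exact: ZB.
have near_p (K : nat) (ts : 'I_K -> R) (eps : R) (N0 : nat) : 0 < eps ->
    exists2 N, (N0 <= N)%N & forall i j, `|Z N (ts i) 0 j - p (ts i) 0 j| < eps.
  move=> e0.
  pose PT := prod_topology (fun _ : R => 'rV[R]_n).
  have Hp : nbhs (p : PT) [set g : PT |
      forall i : 'I_K, forall j : 'I_n, `|p (ts i) 0 j - g (ts i) 0 j| < eps].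
    apply: (@filter_forall PT 'I_K (fun i => [set g : PT | forall j : 'I_n,
      `|p (ts i) 0 j - g (ts i) 0 j| < eps]) (nbhs (p : PT)) _) => i.
    apply: (@filter_forall PT 'I_n (fun j => [set g : PT |
      `|p (ts i) 0 j - g (ts i) 0 j| < eps]) (nbhs (p : PT)) _) => j.
    have C : (fun g : PT => g (ts i)) @ (p : PT) --> p (ts i).
      exact: (@proj_continuous R (fun _ : R => 'rV[R]_n) (ts i) p).
    have : (fun g : PT => g (ts i) 0 j) @ (p : PT) --> p (ts i) 0 j.
      by apply: (@rV_cvg_coord R PT (nbhs (p : PT)) _ n (fun g : PT => g (ts i)) (p (ts i)) j); exact: C.
    by move=> /cvgrPdist_lt /(_ _ e0).
  have HN : (Z @ \oo) [set g | exists2 N, (N0 <= N)%N & g = Z N].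
    by exists N0 => // N /= N0N; exists N.
  have [g [[N N0N ->] Hg]] := cl _ _ HN Hp.
  by exists N => // i j; rewrite distrC; exact: Hg.
have small x y : (forall eps, 0 < eps -> x <= y + eps) -> x <= y :> R.
  by move=> H; apply/ler_addgt0Pr.
have p_hist N t : t <= t0 -> p t = Z N t.
  move=> tt; apply/rowP => j; apply/eqP; rewrite -subr_eq0 -normr_le0.
  apply: small => eps e0; rewrite add0r.
  have [N' _ HN'] := near_p 1%N (fun=> t) eps 0%N e0.
  by rewrite (Zhist N N')// distrC ltW// (HN' ord0).
have p_lip j : lipon t0 t1 M (fun t => p t 0 j).
  move=> s t hs ht; apply: small => eps e0.
  have [N _ HN] := near_p 2%N (fun i => if i == ord0 then s else t) (eps / 2) 0%N (ltac:(lra)).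
  have h1 := HN ord0 j; have h2 := HN (@Ordinal 2 1 isT) j; rewrite /= in h1 h2.
  have h3 := Zlip N j s t hs ht; move: h1 h2 h3.
  rewrite !ler_norml !ltr_norml => /andP[? ?] /andP[? ?] /andP[? ?].
  by apply/andP; split; lra.
have p_cst t : t1 <= t -> p t = p t1.
  move=> tt; apply/rowP => j; apply/eqP; rewrite -subr_eq0 -normr_le0.
  apply: small => eps e0; rewrite add0r.
  have [N _ HN] := near_p 2%N (fun i => if i == ord0 then t1 else t) (eps / 2) 0%N (ltac:(lra)).
  have h1 := HN ord0 j; have h2 := HN (@Ordinal 2 1 isT) j; rewrite /= (Zcst N t)// in h1 h2.
  move: h1 h2.
  rewrite !ler_norml !ltr_norml => /andP[? ?] /andP[? ?].
  by apply/andP; split; lra.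
have key k : exists N, (k <= N)%N /\ forall t j, `|Z N t 0 j - p t 0 j| <= k.+1%:R^-1.
  pose eps : R := k.+1%:R^-1.
  have e0 : 0 < eps by rewrite invr_gt0.
  have [K HK] : exists K : nat, 0 < K%:R :> R /\ 2 * M * ((t1 - t0) / K%:R) <= eps / 2.
    exists (Num.truncn (2 * M * (t1 - t0) / (eps / 2))).+1; split; first by rewrite ltr0n.
    have := truncnS_gt (2 * M * (t1 - t0) / (eps / 2)).
    rewrite ltr_pdivrMr ?divr_gt0// => XK.
    by rewrite mulrA ler_pdivrMr ?ltr0n// mulrC [eps / 2 * _]mulrC mulrC ltW.
  case: HK => K0 HK; pose delta := (t1 - t0) / K%:R.
  have d0 : 0 <= delta by rewrite divr_ge0 ?subr_ge0// ltW.
  have [N kN HN] := near_p K.+1 (fun i => t0 + i%:R * delta) (eps / 2) k (ltac:(lra)).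
  exists N; split => // t j; rewrite -/eps.
  have mid t' : t0 <= t' <= t1 -> `|Z N t' 0 j - p t' 0 j| <= eps.
    move=> tt; have [|i iK Hi] := @grid_point t0 delta t' K d0.
      by rewrite /delta [K%:R * _]mulrC divfK ?gt_eqF// addrC subrK.
    have gi : t0 <= t0 + i%:R * delta <= t1.
      rewrite lerDl mulr_ge0//= -lerBrDl /delta mulrA ler_pdivrMr//.
      by rewrite mulrC ler_wpM2l ?subr_ge0// ler_nat.
    have h1 := HN (Ordinal (iK : (i < K.+1)%N)) j; rewrite /= in h1.
    have h2 := Zlip N j _ _ gi tt; have h3 := p_lip j _ _ gi tt.
    have h4 : M * `|t' - (t0 + i%:R * delta)| <= M * delta by rewrite ler_wpM2l.
    rewrite -/delta in HK; move: h1 h2 h3; clear - h4 HK.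
    rewrite !ler_norml !ltr_norml => /andP[? ?] /andP[? ?] /andP[? ?].
    by apply/andP; split; lra.
  have [tt|tt] := leP t t0; first by rewrite (p_hist N)// subrr normr0 ltW.
  have [tt1|tt1] := leP t t1; first by apply: mid; rewrite ltW.
  by rewrite (Zcst _ _ (ltW tt1)) (p_cst _ (ltW tt1)); apply: mid; rewrite t01 lexx.
have [sg Hsg] := choice key.
by exists p, sg; split => // k; have [? ?] := Hsg k.
Qed.

Lemma Rdominated (a b M : R) (f_ : nat -> R -> R) (f : R -> R) : a <= b ->
  (forall k, measurable_fun `[a, b] (f_ k)) -> measurable_fun `[a, b] f ->
  (forall k t, a <= t <= b -> `|f_ k t| <= M) ->
  {ae mu, forall t, a <= t <= b -> (f_ ^~ t) @ \oo --> f t} ->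
  (fun k => \int[mu]_(t in `[a, b]) f_ k t) @ \oo --> \int[mu]_(t in `[a, b]) f t.
Proof.
move=> ab mf_ mf fM cf.
have mI := measurable_itv `[a, b].
have Ioo : (mu `[a, b]%classic < +oo)%E by rewrite mu_itv// ltry.
have mEf k : measurable_fun `[a, b]%classic (fun t => (f_ k t)%:E) by apply/measurable_EFinP; exact: mf_.
have mEff : measurable_fun `[a, b]%classic (fun t => (f t)%:E) by exact/measurable_EFinP.
have cE : {ae mu, forall t, `[a, b]%classic t -> (fun k => (f_ k t)%:E) @ \oo --> (f t)%:E}.
  apply: aeS cf => t H; rewrite /= in_itv/= => /H cft.
  by apply: cvg_EFin; [near=> k|exact: cft].
have iM : mu.-integrable `[a, b]%classic (fun=> M%:E).
  by apply: (@bdd_integrable _ _ `|M|) => //; exact: measurable_cst.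
have bE : {ae mu, forall t k, `[a, b]%classic t -> (`|(f_ k t)%:E| <= M%:E)%E}.
  by apply: aeW => t k; rewrite /= in_itv/= => tab; rewrite lee_fin fM.
have [fi _ cI] := @dominated_convergence _ _ R mu `[a, b]%classic mI
  (fun k t => (f_ k t)%:E) (fun t => (f t)%:E) (fun=> M%:E) mEf mEff cE iM bE.
have Efin : (\int[mu]_(t in `[a, b]) (f t)%:E)%E = (\int[mu]_(t in `[a, b]) f t)%:E.
  by rewrite /Rintegral fineK//; exact: integrable_fin_num.
rewrite Efin in cI; exact: (fine_cvg cI).
Unshelve. all: by end_near. Qed.
End Compactness.

(** * Peano's theorem for causal operators *)

Section Peano.
Context {R : realType}.
Notation mu := (@lebesgue_measure R).
Variables (n : nat) (t0 t1 M : R) (xi : R -> 'rV[R]_n).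
Hypotheses (t01 : t0 < t1) (M0 : 0 <= M).

(** Being at rest after [t1], such a path is a function on the whole line, to which the
operator applies, and is determined by its restriction to the segment. *)
Definition paths (Y : R -> 'rV[R]_n) : Prop :=
  [/\ forall t, t <= t0 -> Y t = xi t, forall j, lipon t0 t1 M (fun t => Y t 0 j)
    & forall t, t1 <= t -> Y t = Y t1].

Variable Phi : (R -> 'rV[R]_n) -> R -> 'rV[R]_n.
Hypothesis Phi_meas : forall Y, paths Y -> forall j,
  measurable_fun `[t0, t1] (fun t => Phi Y t 0 j).
Hypothesis Phi_bd : forall Y, paths Y -> forall t j, t0 <= t <= t1 -> `|Phi Y t 0 j| <= M.
Hypothesis Phi_causal : forall Y Y', paths Y -> paths Y' -> forall t, t0 <= t <= t1 ->
  (forall s, s <= t -> Y s = Y' s) ->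
  {ae mu, forall s, t0 <= s < t -> Phi Y s = Phi Y' s}.
Hypothesis Phi_cont : forall (Y_ : nat -> R -> 'rV[R]_n) Y, (forall k, paths (Y_ k)) ->
  paths Y -> (forall k t j, `|Y_ k t 0 j - Y t 0 j| <= k.+1%:R^-1) ->
  {ae mu, forall t, t0 <= t <= t1 -> forall j, (fun k => Phi (Y_ k) t 0 j) @ \oo --> Phi Y t 0 j}.

Definition Pint Y j u := prim ((fun t => Phi Y t 0 j) \_ `[t0, t1]) t0 u.

Lemma Pint_meas Y j : paths Y -> measurable_fun setT ((fun t => Phi Y t 0 j) \_ `[t0, t1]).
Proof. by move=> hY; apply/(measurable_restrictT _ (measurable_itv _)); exact: Phi_meas. Qed.

Lemma Pint_bd Y j : paths Y -> forall t, `|((fun t => Phi Y t 0 j) \_ `[t0, t1]) t| <= M.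
Proof.
move=> hY t; rewrite patchE; case: ifPn => [/set_mem/=|_]; last by rewrite normr0.
by rewrite in_itv/=; exact: Phi_bd.
Qed.

Lemma Pint_lip Y j b : paths Y -> lipon t0 b M (Pint Y j).
Proof. by move=> hY; apply: prim_lipon; [exact: Pint_meas|exact: Pint_bd]. Qed.

Lemma PintE Y j u : u <= t1 -> Pint Y j u = \int[mu]_(t in `[t0, u]) Phi Y t 0 j.
Proof.
move=> ut; rewrite /Pint /prim; apply: eq_Rintegral => t; rewrite inE/= in_itv/= => /andP[h1 h2].
by rewrite patchE mem_set//= in_itv/= h1 (le_trans h2).
Qed.

Lemma Pint_ext Y Y' j u : paths Y -> paths Y' -> t0 <= u <= t1 ->
  (forall s, s <= u -> Y s = Y' s) -> Pint Y j u = Pint Y' j u.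
Proof.
move=> hY hY' tu YY; have /andP[h1 h2] := tu; rewrite !PintE//.
have neu : {ae mu, forall t, t <> u}.
  exists [set u]; split => //; first exact: lebesgue_measure_set1.
  by move=> t /= /contrapT.
apply: Rintegral_ae_eq; apply: aeS2 (Phi_causal hY hY' tu YY) neu => t H /eqP tneu.
by rewrite /= in_itv/= => /andP[a1 a2]; rewrite H// a1 lt_neqAle tneu.
Qed.

(** Tonelli's delayed version of the Picard operator. *)
Definition delayed (eta : R) (Y : R -> 'rV[R]_n) (t : R) : 'rV[R]_n :=
  if t <= t0 then xi t
  else \row_j (xi t0 0 j + Pint Y j (Num.max t0 (Num.min t t1 - eta))).

Lemma delayed_paths eta Y : 0 <= eta -> paths Y -> paths (delayed eta Y).
Proof.
move=> eta0 hY.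
have E t j : t0 <= t -> delayed eta Y t 0 j =
    xi t0 0 j + Pint Y j (Num.max t0 (Num.min t t1 - eta)).
  rewrite /delayed; case: ifPn => [tt ht|_ _]; last by rewrite mxE.
  have -> : t = t0 by apply/eqP; rewrite eq_le tt.
  rewrite (min_l (ltW t01)) max_l ?gerBl// /Pint prim_id addr0//.
split.
- by move=> t tt; rewrite /delayed tt.
- move=> j; apply: liponP => s t hs st ht.
  have hm u : u <= t1 -> t0 <= Num.max t0 (u - eta) <= t1.
    by move=> ut; rewrite le_max lexx ge_max (ltW t01)/= lerBlDr (le_trans ut)// lerDl.
  rewrite !E// ?(le_trans hs)// !min_l//; last exact: le_trans ht.
  rewrite opprD addrACA subrr add0r (le_trans (Pint_lip j hY (hm s _) (hm t _)))//.
    exact: le_trans ht.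
  apply: ler_wpM2l => //; have mono : Num.max t0 (s - eta) <= Num.max t0 (t - eta).
    by rewrite ge_max !le_max lexx/= lerB// orbT.
  rewrite ger0_norm ?subr_ge0//.
  by case: (leP t0 (t - eta)) => ?; case: (leP t0 (s - eta)) => ?; lra.
- move=> t tt; apply/rowP => j; rewrite !E ?(ltW t01)//; last exact: le_trans (ltW t01) tt.
  by rewrite minxx min_r.
Qed.

Hypothesis xi0 : paths (fun t => xi (Num.min t t0)).

Definition tonelli (N k : nat) : R -> 'rV[R]_n :=
  iter k (delayed ((t1 - t0) / N.+1%:R)) (fun t => xi (Num.min t t0)).

Lemma tonelli_paths N k : paths (tonelli N k).
Proof.
elim: k => //= k IH; apply: delayed_paths => //.
by rewrite divr_ge0 ?subr_ge0// ltW.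
Qed.

(** The delayed operator reads the path up to time [t - eta] only, so by causality each
iteration settles the path on one more interval of length [eta]. *)
Lemma tonelli_stable N k t : (k <= N.+1)%N ->
  t <= t0 + k%:R * ((t1 - t0) / N.+1%:R) -> tonelli N k.+1 t = tonelli N k t.
Proof.
set eta := (t1 - t0) / N.+1%:R.
have eta0 : 0 < eta by rewrite divr_gt0 ?subr_gt0.
have keta k' : (k' <= N.+1)%N -> t0 + k'%:R * eta <= t1.
  move=> kN; rewrite -lerBrDl /eta mulrA ler_pdivrMr// mulrC ler_wpM2l ?subr_ge0 ?ler_nat//.
  exact: ltW.
elim: k t => [|k IH] t kN tk.
  by rewrite mul0r addr0 in tk; rewrite /= /delayed tk min_l.
have [tt|tt] := leP t t0; first by rewrite /= /delayed tt.
rewrite [LHS]/= [RHS]/= {1 3}/delayed leNgt tt/=; apply/rowP => j; rewrite !mxE.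
congr (_ + _); rewrite -/(tonelli N k) -/eta.
have tt1 : t <= t1 by rewrite (le_trans tk)// keta.
rewrite min_l//; set u := Num.max _ _.
have u1 : u <= t0 + k%:R * eta.
  rewrite ge_max lerDl mulr_ge0 ?(ltW eta0)//= lerBlDr (le_trans tk)//.
  by rewrite -addn1 natrD mulrDl mul1r addrA.
apply: Pint_ext; [exact: (tonelli_paths N k.+1)|exact: tonelli_paths| |].
  by rewrite le_max lexx (le_trans u1)// keta// ltnW.
by move=> s su; apply: (IH s (ltnW kN)); exact: le_trans u1.
Qed.

Lemma tonelli_approx N : exists Z, paths Z /\ (forall t j, t0 <= t <= t1 ->
  `|Z t 0 j - (xi t0 0 j + Pint Z j t)| <= M * ((t1 - t0) / N.+1%:R)).
Proof.
exists (tonelli N N.+1); split; first exact: tonelli_paths.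
set Z := tonelli N N.+1; have hZ : paths Z by exact: tonelli_paths.
set eta := (t1 - t0) / N.+1%:R.
have eta0 : 0 < eta by rewrite divr_gt0 ?subr_gt0.
move=> t j /andP[h1 h2]; have Et : Z t = delayed eta Z t.
  apply: esym; apply: (tonelli_stable (leqnn _)).
  by rewrite mulrC divfK ?pnatr_eq0// addrC subrK.
rewrite [in X in `|X - _|]Et /delayed; case: ifPn => [tt|].
  have -> : t = t0 by apply/eqP; rewrite eq_le tt.
  by rewrite /Pint prim_id addr0 subrr normr0 mulr_ge0// ltW.
rewrite -ltNge => tt; rewrite mxE min_l// opprD addrACA subrr add0r.
have um : t0 <= Num.max t0 (t - eta) <= t1.
  by rewrite le_max lexx ge_max (ltW t01)/= lerBlDr (le_trans h2)// lerDl ltW.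
rewrite distrC (le_trans (Pint_lip j hZ um _))//; first by rewrite h1.
apply: ler_wpM2l => //; rewrite ger0_norm ?subr_ge0.
  by case: (leP t0 (t - eta)) => ?; lra.
by rewrite ge_max h1 gerBl ltW.
Qed.

(** The paths of [tonelli_approx] for delays tending to 0 have the common Lipschitz
constant [M]; a subsequence converges uniformly, and its limit solves the equation by
dominated convergence. *)
Lemma peano : exists Y, paths Y /\ forall t j, t0 <= t <= t1 ->
  Y t 0 j = xi t0 0 j + \int[mu]_(s in `[t0, t]) Phi Y s 0 j.
Proof.
have [Z HZ] := choice tonelli_approx.
have hZ N : paths (Z N) by case: (HZ N).
have bound N t j : `|Z N t 0 j| <= `|xi (Num.min t t0) 0 j| + M * (t1 - t0).
  have [Zh Zl Zc] := hZ N.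
  have [tt|tt] := leP t t0.
    by rewrite Zh// lerDl mulr_ge0// subr_ge0 ltW.
  have mid t' : t0 <= t' <= t1 -> `|Z N t' 0 j| <= `|xi t0 0 j| + M * (t1 - t0).
    move=> /andP[h1 h2]; rewrite -[Z N t' 0 j](subrK (Z N t0 0 j)) addrC.
    rewrite (le_trans (ler_normD _ _))// Zh// lerD//.
    rewrite -(Zh t0)// (le_trans (Zl _ _ _ _ _))// ?lexx ?h1 ?(ltW t01)//.
    by apply: ler_wpM2l => //; rewrite ger0_norm ?subr_ge0// lerB.
  have [tt1|tt1] := leP t t1; first by apply: mid; rewrite ltW.
  by rewrite (Zc _ (ltW tt1)); apply: mid; rewrite (ltW t01) lexx.
have [p [sg [ph pl pc sgk Hsg]]] : exists (p : R -> 'rV[R]_n) (sg : nat -> nat), [/\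
    forall N t, t <= t0 -> p t = Z N t,
    forall j, lipon t0 t1 M (fun t => p t 0 j),
    forall t, t1 <= t -> p t = p t1,
    forall k, (k <= sg k)%N
  & forall k t j, `|Z (sg k) t 0 j - p t 0 j| <= k.+1%:R^-1].
  apply: (@lip_seq_compact _ n t0 t1 M
    (fun t => \sum_j `|xi (Num.min t t0) 0 j| + M * (t1 - t0))) => //.
  - exact: ltW.
  - move=> N t j; rewrite (le_trans (bound N t j))// lerD2r.
    by rewrite (bigD1 j)//= lerDl; apply: sumr_ge0.
  - by move=> N N' t tt; have [h _ _] := hZ N; have [h' _ _] := hZ N'; rewrite h// h'.
  - by move=> N j; have [_ ? _] := hZ N.
  - by move=> N t; have [_ _] := hZ N; apply.
have hp : paths p.
  split=> // t tt; by rewrite (ph 0%N)//; have [h _ _] := hZ 0%N; rewrite h.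
exists p; split => // t j tt; have /andP[h1 h2] := tt; rewrite -PintE//.
have cI : (fun k => Pint (Z (sg k)) j t) @ \oo --> Pint p j t.
  rewrite PintE//; under eq_fun do rewrite PintE//.
  have sub : `[t0, t] `<=` `[t0, t1].
    by move=> s /=; rewrite !in_itv/= => /andP[-> st]; rewrite (le_trans st).
  apply: (@Rdominated _ t0 t M) => //.
  - by move=> k; apply: measurable_funS sub _ => //; exact: Phi_meas.
  - by apply: measurable_funS sub _ => //; exact: Phi_meas.
  - by move=> k s /andP[s0 st]; apply: Phi_bd => //; rewrite s0 (le_trans st).
  - apply: aeS (Phi_cont (fun k => hZ (sg k)) hp Hsg) => s H /andP[s0 st].
    by apply: H; rewrite s0 (le_trans st).
apply/eqP; rewrite -subr_eq0 -normr_le0; apply/ler_addgt0Pr => e e0; rewrite add0r.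
pose K := M * (t1 - t0) + 1.
have K0 : 0 < K by rewrite /K ltr_wpDl// mulr_ge0// subr_ge0 ltW.
have eK : 0 < e / 3 / K by rewrite !divr_gt0.
have e3 : 0 < e / 3 by rewrite divr_gt0.
have H1 := @near_infty_natSinv_lt R (PosNum eK).
have H2 := @near_infty_natSinv_lt R (PosNum e3).
have H3 : \forall k \near \oo, `|Pint p j t - Pint (Z (sg k)) j t| < e / 3.
  by have /cvgrPdist_lt := cI; apply.
have H123 : \forall k \near \oo, (k.+1%:R^-1 < e / 3 / K /\ k.+1%:R^-1 < e / 3) /\
   `|Pint p j t - Pint (Z (sg k)) j t| < e / 3.
  by near=> k; split; [split|]; near: k; [exact: H1|exact: H2|exact: H3].
have [k [[k1 k2] k3]] := @filter_ex _ _ _ _ H123.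
have k4 := Hsg k t j; have k5 := (HZ (sg k)).2 t j tt.
have k6 : M * ((t1 - t0) / (sg k).+1%:R) < e / 3.
  apply: (@le_lt_trans _ _ (K * k.+1%:R^-1)); last by rewrite mulrC -ltr_pdivlMr.
  rewrite mulrA ler_pM ?invr_ge0 ?mulr_ge0 ?subr_ge0 ?(ltW t01)//.
    by rewrite /K lerDl.
  by rewrite lef_pV2 ?posrE// ler_nat ltnS.
move: k2 k3 k4 k5 k6.
set a1 := M * _; set a2 := Pint p j t; set a3 := Pint _ _ _; set a4 := p t 0 j.
set a5 := Z _ _ _ _; set a6 := xi _ _ _; set a7 := k.+1%:R^-1.
move: a1 a2 a3 a4 a5 a6 a7; clear => a1 a2 a3 a4 a5 a6 a7.
rewrite !ler_norml !ltr_norml => ? /andP[? ?] /andP[? ?] /andP[? ?] ?.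
by apply/andP; split; lra.
Unshelve. all: by end_near. Qed.

End Peano.

(** * Local existence for equations with memory *)

Section MeasComp.
Context {R : realType}.
Notation mu := (@lebesgue_measure R).

(** An open set is a countable union of boxes with rational centres, and the preimage
of a box under [W] is cut out by finitely many measurable coordinates. *)
Lemma rV_cont_measurable N (f : 'rV[R]_N -> R) (A : set R) (W : R -> 'rV[R]_N) :
  continuous f -> measurable A -> (forall j, measurable_fun A (fun t => W t 0 j)) ->
  measurable_fun A (fun t => f (W t)).
Proof.
move=> cf mA mW; apply: (measurability _ (RGenOpens.measurableE R)).
move=> _ [_ [a [b ->] <-]].
pose O := f @^-1` `]a, b[%classic.
have oO : open O by move/continuousP: cf; apply; exact: interval_open.
pose box (x : {ffun 'I_N -> rat} * nat) : set R :=
  [set t | forall j, `|W t 0 j - ratr (x.1 j)| < x.2.+1%:R^-1].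
pose good (x : {ffun 'I_N -> rat} * nat) := forall v : 'rV[R]_N,
  (forall j, `|v 0 j - ratr (x.1 j)| < x.2.+1%:R^-1) -> O v.
have -> : A `&` (fun t => f (W t)) @^-1` `]a, b[%classic =
    \bigcup_(x in [set: {ffun 'I_N -> rat} * nat]) (A `&` [set t | good x /\ box x t]).
  apply/seteqP; split => [t [At fO]|t [x _ [At [gx bx]]]]; last by split => //; exact: gx.
  have /nbhs_ballP[e /= e0 eO] : nbhs (W t) O by exact: oO.
  have [k ke] : exists k : nat, k.+1%:R^-1 < e / 2.
    have e2 : 0 < e / 2 by rewrite divr_gt0.
    have H := @near_infty_natSinv_lt R (PosNum e2).
    by have [k Hk] := @filter_ex _ _ _ _ H; exists k.
  have k0 : 0 < k.+1%:R^-1 :> R by rewrite invr_gt0.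
  have Hq j : exists q : rat, `|W t 0 j - ratr q| < k.+1%:R^-1.
    have [|q Hq] := @rat_in_itvoo R (W t 0 j - k.+1%:R^-1) (W t 0 j + k.+1%:R^-1).
      by rewrite ltrD2l gtrN.
    by exists q; move: Hq; rewrite in_itv/= ltr_distlC.
  have [q {}Hq] := choice Hq.
  exists ([ffun j => q j], k) => //; split => //; split.
    move=> v /= Hv; apply: eO; split => // i j; rewrite ord1 /ball/=.
    have := Hq j; have := Hv j; rewrite /= ffunE.
    move: k0 ke; set K := _^-1; move: (W t 0 j) (v 0 j) (ratr (q j)) K.
    clear=> w1 w2 w3 K k0 ke; rewrite !ltr_norml => /andP[? ?] /andP[? ?].
    by apply/andP; split; lra.
  by move=> j /=; rewrite ffunE.
apply: countable_bigcupT_measurable => [|x]; first exact: countableP.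
have [gx|ngx] := pselect (good x); last first.
  rewrite (_ : _ `&` _ = set0)//; apply/seteqP; split => // t [_ []]//.
have -> : A `&` [set t | good x /\ box x t] = A `&` \bigcap_(j in [set: 'I_N])
    (A `&` (fun t => W t 0 j) @^-1`
       `]ratr (x.1 j) - x.2.+1%:R^-1, ratr (x.1 j) + x.2.+1%:R^-1[%classic).
  apply/seteqP; split => t [At].
    move=> [_ bx]; split => // j _; split => //=; rewrite in_itv/= -ltr_distl; exact: bx.
  move=> H; split => //; split => // j; have [_ /=] := H j I.
  by rewrite in_itv/= -ltr_distl.
apply: measurableI => //; apply: fin_bigcap_measurable => // j _.
by apply: mW => //; exact: measurable_itv.
Qed.

End MeasComp.

Lemma ae_ord (R : realType) n (P : 'I_n -> R -> Prop) :
  (forall j, {ae (@lebesgue_measure R), forall t, P j t}) ->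
  {ae (@lebesgue_measure R), forall t, forall j, P j t}.
Proof.
move=> H; have : {ae (@lebesgue_measure R), forall t, forall k : nat, forall hk : (k < n)%N, P (Ordinal hk) t}.
  apply: ae_foralln => k; have [kn|nk] := pselect (is_true (k < n)%N); last by apply: aeW => t hk; case: (nk hk).
  by apply: aeS (H (Ordinal kn)) => t Pt hk; rewrite (bool_irrelevance hk kn).
by apply: aeS => t Ht [k hk]; exact: Ht.
Qed.

Section LocalExistence.
Context {R : realType}.
Notation mu := (@lebesgue_measure R).
Variables (p q n : nat).

Lemma carath_measurable (H : 'rV[R]_p * R * 'rV[R]_n * 'rV[R]_q -> R) (A : set R)
    (d : R -> 'rV[R]_p) (Y : R -> 'rV[R]_n) (z : R -> 'rV[R]_q) :
  continuous H -> measurable A ->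
  (forall j, measurable_fun A (fun t => d t 0 j)) ->
  (forall j, measurable_fun A (fun t => Y t 0 j)) ->
  (forall j, measurable_fun A (fun t => z t 0 j)) ->
  measurable_fun A (fun t => H (d t, t, Y t, z t)).
Proof.
move=> cH mA md mY mz.
(* All arguments are packed into one row vector, to apply [rV_cont_measurable]. *)
pose g (v : 'rV[R]_(p + (1 + (n + q)))) := (lsubmx v, lsubmx (rsubmx v) 0 0,
   lsubmx (rsubmx (rsubmx v)), rsubmx (rsubmx (rsubmx v))).
pose W t : 'rV[R]_(p + (1 + (n + q))) := row_mx (d t) (row_mx (const_mx t) (row_mx (Y t) (z t))).
have -> : (fun t => H (d t, t, Y t, z t)) = (fun t => (H \o g) (W t)).
  by apply/funext => t; rewrite /= /g /W !(row_mxKl, row_mxKr) mxE.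
apply: rV_cont_measurable => //.
- have cl (a b : nat) (h : 'rV[R]_(p + (1 + (n + q))) -> 'rV[R]_(a + b)) :
      continuous h -> continuous (fun v => lsubmx (h v)).
    move=> ch; apply: rV_continuous => j; under eq_fun do rewrite mxE.
    exact: coord_cont.
  have cr (a b : nat) (h : 'rV[R]_(p + (1 + (n + q))) -> 'rV[R]_(a + b)) :
      continuous h -> continuous (fun v => rsubmx (h v)).
    move=> ch; apply: rV_continuous => j; under eq_fun do rewrite mxE.
    exact: coord_cont.
  have cg : continuous g.
    have c1 := cr _ _ id (fun x => cvg_id).
    have c2 := cr _ _ _ c1.
    have d1 := cl _ _ id (fun x => cvg_id).
    have d2 := coord_cont (j := 0) (cl _ _ _ c1).
    have d3 := cl _ _ _ c2; have d4 := cr _ _ _ c2.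
    by move=> v; exact: (cvg_pair (cvg_pair (cvg_pair (d1 v) (d2 v)) (d3 v)) (d4 v)).
  by move=> v; apply: continuous_comp; [exact: cg|exact: cH].
- move=> j; rewrite -[j]splitK; case: (fintype.split j) => [i|i]; rewrite /= /W.
    by under eq_fun do rewrite row_mxEl; exact: md.
  under eq_fun do rewrite row_mxEr; rewrite -[i]splitK; case: (fintype.split i) => [k|k] /=.
    by under eq_fun do rewrite row_mxEl mxE; exact: measurable_id.
  under eq_fun do rewrite row_mxEr; rewrite -[k]splitK; case: (fintype.split k) => [l|l] /=.
    by under eq_fun do rewrite row_mxEl; exact: mY.
  by under eq_fun do rewrite row_mxEr; exact: mz.
Qed.

Variables (sigma : R) (Top : (R -> 'rV[R]_n) -> R -> 'rV[R]_q) (d : R -> 'rV[R]_p).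
Hypotheses (sigma0 : 0 <= sigma) (hTop : op_class sigma Top) (hd : Linf `[0, +oo[ d).

(** Condition (c) on the operator makes the right-hand side continuous along
uniformly convergent paths.  The length [h] is so small that paths of speed at most
[M] remain in the region where (c) applies, which reduces the claim to [peano]. *)
Lemma locex (t0 M h0 : R) (xi : R -> 'rV[R]_n)
    (H : 'rV[R]_p * R * 'rV[R]_n * 'rV[R]_q -> 'rV[R]_n) :
  0 <= t0 -> 0 <= M -> 0 < h0 -> {within `[- sigma, t0], continuous xi} ->
  continuous H -> (forall y j, `|H y 0 j| <= M) ->
  exists (h : R) (X : R -> 'rV[R]_n), [/\ 0 < h <= h0, continuous X,
    forall t, - sigma <= t <= t0 -> X t = xi t,
    (forall j, lipon t0 (t0 + h) M (fun t => X t 0 j)) /\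
    (forall t, t0 + h <= t -> X t = X (t0 + h))
  & {ae mu, forall t : R, t0 < t < t0 + h -> is_derive t 1 X (H (d t, t, X t, Top X t))}].
Proof.
move=> t00 M0 h00 cxi cH HM.
have [LTop _ causal lipT] := hTop.
have st0 : - sigma <= t0 by rewrite (le_trans _ t00)// oppr_le0.
pose xi' := xi \o clampr (- sigma) t0.
have cxi' : continuous xi' by exact: within_clamp_continuous.
have xi'E t : - sigma <= t <= t0 -> xi' t = xi t.
  by move=> ht; rewrite /xi' /= clamp_id.
have [Delta [del [cc [D0 del0 cc0 Hlip]]]] := lipT t0 xi' t00
   (continuous_subspaceT cxi').
pose h := Num.min h0 (Num.min Delta (del / (n%:R * M + 1))).
have nM : 0 < n%:R * M + 1 by rewrite ltr_wpDl// mulr_ge0.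
have hh0 : 0 < h by rewrite /h !lt_min h00 D0 divr_gt0.
have h1 : h <= h0 by rewrite /h ge_min lexx.
have h2 : h <= Delta by rewrite /h !ge_min lexx !orbT.
have h3 : n%:R * (M * h) < del.
  have : h <= del / (n%:R * M + 1) by rewrite /h !ge_min lexx !orbT.
  rewrite ler_pdivlMr// mulrA; apply: lt_le_trans.
  by rewrite mulrC ltr_pM2l// ltrDl.
pose t1 := t0 + h; have t01 : t0 < t1 by rewrite /t1 ltrDl.
pose pth := paths t0 t1 M xi'.
have contY Y : pth Y -> continuous Y.
  move=> [Yh Yl Yc].
  have -> : Y = fun t => xi' (Num.min t t0) + (Y (clampr t0 t1 t) - xi' t0).
    apply/funext => t; rewrite /clampr; have [tt|tt] := leP t t0.
      rewrite (Yh t)// min_r ?(le_trans tt)// ?(ltW t01)// max_l// Yh// subrr addr0//.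
    rewrite addrC subrK; have [tt1|tt1] := leP t t1; first by rewrite max_r// ltW.
    by rewrite max_r ?(ltW t01)// Yc// ltW.
  move=> t; apply: cvgD.
    apply: (@continuous_comp _ _ _ (fun t => Num.min t t0) xi'); last exact: cxi'.
    by apply: (@continuous_min _ _ id (fun=> t0)); [exact: cvg_id|exact: cvg_cst].
  apply: cvgB; last exact: cvg_cst.
  move: t; apply: rV_continuous => j; apply: (within_clamp_continuous (g := fun t => Y t 0 j) (ltW t01)).
  exact: lipon_cont (Yl j).
have [[dm [mdm dE]] _] := hd.
have t0t1 : `[t0, t1] `<=` `[0, +oo[%classic.
  by move=> t /=; rewrite !in_itv/= => /andP[/(le_trans t00) ->].
have TMex Y : exists g : R -> 'rV[R]_q, continuous Y ->
    (forall j, measurable_fun `[t0, t1] (fun t => g t 0 j)) /\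
    {ae mu, forall t, `[t0, t1]%classic t -> Top Y t = g t}.
  have [cY|ncY] := pselect (continuous Y); last by exists (fun=> 0) => /ncY.
  by have [[g Hg] _] := LTop Y (continuous_subspaceT cY) t0 t1 t0t1; exists g.
have [TM HTM] := choice TMex.
pose Phi Y s := H (dm s, s, Y s, TM Y s).
have [Y [hY YE]] : exists Y, pth Y /\ forall t j, t0 <= t <= t1 ->
    Y t 0 j = xi' t0 0 j + \int[mu]_(s in `[t0, t]) Phi Y s 0 j.
  apply: peano => //.
  - move=> Y hY j; have [mTM _] := HTM Y (contY Y hY).
    apply: (carath_measurable (H := fun y => H y 0 j)) => //.
    + exact: coord_cont.
    + by move=> i; apply: measurable_funS (mdm i) => //; exact: t0t1.
    + move=> i; apply: measurable_funTS; apply: continuous_measurable_fun.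
      exact: (coord_cont (contY Y hY)).
  - by move=> Y hY t j _; exact: HM.
  - move=> Y Y' hY hY' t /andP[t0t tt1] YY.
    have tge0 := le_trans t00 t0t.
    have [_ TMY] := HTM Y (contY Y hY); have [_ TMY'] := HTM Y' (contY Y' hY').
    have := causal t Y Y' tge0 (continuous_subspaceT (contY Y hY)) (continuous_subspaceT (contY Y' hY')).
    move=> C; have {}C := C _; have {}C := C (fun s hs => YY s (ltW (andP hs).2)).
    apply: aeS2 C (aeI TMY TMY') => s C [E1 E2] /andP[t0s st].
    have sI : `[t0, t1]%classic s by rewrite /= in_itv/= t0s (le_trans (ltW st)).
    by rewrite /Phi -E1// -E2// C ?(le_trans t00)// YY// ltW.
  - move=> Y_ Y hY_ hY YYk.
    have nearxi Z : pth Z -> forall s, t0 <= s -> enorm (Z s - xi' t0) < del.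
      move=> [Zh Zl Zc]; have mid s : t0 <= s <= t1 -> enorm (Z s - xi' t0) < del.
        move=> /andP[s0 s1]; apply: le_lt_trans h3; apply: enorm_le_bound.
          by rewrite mulr_ge0// ltW.
        move=> j; rewrite !mxE -(Zh t0)//.
        rewrite (le_trans (Zl j t0 s _ _)) ?lexx ?s0 ?s1 ?(ltW t01)//.
        rewrite ler_wpM2l// ger0_norm ?subr_ge0// lerBlDl//.
      move=> s s0; have [ss|/ltW ss] := leP s t1; first by apply: mid; rewrite s0.
      by rewrite Zc//; apply: mid; rewrite lexx ltW.
    have Hk k : {ae mu, forall s, t0 <= s <= t0 + Delta ->
        enorm (Top (Y_ k) s - Top Y s) <= cc * (n%:R * k.+1%:R^-1)}.
      have := Hlip (Y_ k) Y (continuous_subspaceT (contY _ (hY_ k))) (continuous_subspaceT (contY _ hY)).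
      move=> L; have {}L := L _ _.
      have {L} : {ae mu, forall s, t0 <= s <= t0 + Delta ->
               enorm (Top (Y_ k) s - Top Y s) <=
               cc * sup [set enorm (Y_ k s' - Y s') | s' in `[t0, t0 + Delta]]}.
        apply: L.
          move=> s /andP[_ st]; have [Yh _ _] := hY; have [Ykh _ _] := hY_ k.
          by rewrite Yh// Ykh.
        by move=> s /andP[s0 _]; split; [exact: (nearxi _ (hY_ k))|exact: (nearxi _ hY)].
      apply: aeS => s Hs st; rewrite (le_trans (Hs st))//; apply: ler_wpM2l; first exact: ltW.
      apply: ge_sup.
        by exists (enorm (Y_ k t0 - Y t0)), t0 => //=; rewrite in_itv/= lexx lerDl ltW.
      move=> _ [s' _ <-]; apply: enorm_le_bound; first by rewrite invr_ge0.
      by move=> j; rewrite !mxE; exact: YYk.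
    have [_ TMY] := HTM Y (contY Y hY).
    have TMk : {ae mu, forall s, forall k, `[t0, t1]%classic s -> Top (Y_ k) s = TM (Y_ k) s}.
      by apply: ae_foralln => k; have [_] := HTM (Y_ k) (contY _ (hY_ k)).
    apply: aeS2 (aeI TMk TMY) (ae_foralln Hk) => s [E1 E2] {}Hk st j.
    have sI : `[t0, t1]%classic s by rewrite /= in_itv.
    have invk : (fun k : nat => k.+1%:R^-1 : R) @ \oo --> (0 : R) by exact: cvg_harmonic.
    have sq (w : nat -> R) (l C : R) : (forall k, `|w k - l| <= C * k.+1%:R^-1) -> w @ \oo --> l.
      move=> Hw; apply/cvgrPdist_le => e e0.
      have C0 : 0 < `|C| + 1 by rewrite ltr_wpDl.
      have /cvgrPdist_lt /(_ _ (divr_gt0 e0 C0)) := invk.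
      apply: filterS => k; rewrite sub0r normrN ger0_norm ?invr_ge0// ltr_pdivlMr// => ke.
      rewrite distrC (le_trans (Hw k))// (le_trans _ (ltW ke))// mulrC ler_wpM2l ?invr_ge0//.
      by rewrite (le_trans (ler_norm _))// lerDl.
    have cY : (fun k => Y_ k s) @ \oo --> Y s.
      by apply: rV_cvgP => i; apply: (sq _ _ 1) => k; rewrite mul1r; exact: YYk.
    have cT : (fun k => TM (Y_ k) s) @ \oo --> TM Y s.
      apply: rV_cvgP => i; apply: (sq _ _ (cc * n%:R)) => k; rewrite -mulrA.
      rewrite (le_trans _ (Hk k _))//; last first.
        by case/andP: st => -> st1; rewrite (le_trans st1)// lerD2l.
      by rewrite -E1// -E2// -[X in `|X|](_ : (Top (Y_ k) s - Top Y s) 0 i = _) ?coord_le_enorm// !mxE.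
    apply: rV_cvg_coord; apply: (cvg_comp (fun k => (dm s, s, Y_ k s, TM (Y_ k) s)) H); last exact: cH.
    exact: (cvg_pair (cvg_pair (cvg_pair (cvg_cst (dm s)) (cvg_cst s)) cY) cT).
  - split => //.
    + by move=> t tt; rewrite min_l.
    + move=> j s t /andP[s0 _] /andP[tt0 _]; rewrite !min_r// subrr normr0 mulr_ge0//.
    + by move=> t tt; rewrite !min_r// ?(ltW t01)// (le_trans (ltW t01)).
have [Yh Yl Yc] := hY.
exists h, Y; split => //.
- by rewrite hh0.
- exact: contY.
- by move=> t /andP[s0 st]; rewrite Yh// xi'E// s0.
have [mTM TMY] := HTM Y (contY Y hY).
have mPhi j : measurable_fun setT ((fun s => Phi Y s 0 j) \_ `[t0, t1]).
  apply/(measurable_restrictT _ (measurable_itv _)).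
  apply: (carath_measurable (H := fun y => H y 0 j)) => //.
  + exact: coord_cont.
  + by move=> i; apply: measurable_funS (mdm i) => //; exact: t0t1.
  + move=> i; apply: measurable_funTS; apply: continuous_measurable_fun.
    exact: (coord_cont (contY Y hY)).
have bPhi j t : `|((fun s => Phi Y s 0 j) \_ `[t0, t1]) t| <= M.
  by rewrite patchE; case: ifPn => _; [exact: HM|rewrite normr0].
have dP : {ae mu, forall t, forall j, t0 < t -> is_derive t 1
    (prim ((fun s => Phi Y s 0 j) \_ `[t0, t1]) t0) (((fun s => Phi Y s 0 j) \_ `[t0, t1]) t)}.
  by apply: ae_ord => j; exact: (prim_derive t0 (mPhi j) (bPhi j)).
apply: aeS2 dP (aeI TMY dE) => t D [E1 E2] /andP[t0t tt1].
have tI : `[t0, t1]%classic t by rewrite /= in_itv/= !ltW.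
have -> : H (d t, t, Y t, Top Y t) = Phi Y t.
  by rewrite /Phi E1// E2//; exact: t0t1.
apply: rV_is_derive => j.
have -> : Phi Y t 0 j = ((fun s => Phi Y s 0 j) \_ `[t0, t1]) t.
  by rewrite patchE mem_set.
apply: (@near_eq_is_derive _ _ _
  (fun t => xi' t0 0 j + prim ((fun s => Phi Y s 0 j) \_ `[t0, t1]) t0 t)).
  near=> s; have st : t0 <= s <= t1.
    by apply/andP; split; apply: ltW; near: s; [exact: lt_nbhsr|exact: lt_nbhsl].
  rewrite YE//; congr (_ + _); apply: eq_Rintegral => u; rewrite inE/= in_itv/= => /andP[u0 us].
  by rewrite patchE mem_set//= in_itv/= u0 (le_trans us)//; case/andP: st.
rewrite -[X in is_derive t _ _ X]add0r; apply: is_deriveD; exact: D.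
Unshelve. all: by end_near. Qed.

End LocalExistence.

(** * Local existence for the closed loop *)

Section Clamp.
Context {R : realType}.

(** The right-hand side of the closed loop is controlled, or even defined, on compact
boxes only; composing it with these projections makes it global and bounded. *)
Definition boxclamp (n : nat) (v0 : 'rV[R]_n) (b : R) (v : 'rV[R]_n) : 'rV[R]_n :=
  \row_j clampr (v0 0 j - b) (v0 0 j + b) (v 0 j).

Lemma boxclamp_continuous n (v0 : 'rV[R]_n) b : continuous (boxclamp v0 b).
Proof.
apply: rV_continuous => j; rewrite /boxclamp; under eq_fun do rewrite mxE.
move=> v; apply: (@continuous_comp _ _ _ (fun v : 'rV[R]_n => v 0 j)
  (clampr (v0 0 j - b) (v0 0 j + b))); first exact: coord_continuous.
exact: clamp_continuous.
Qed.

Lemma boxclamp_in n (v0 v : 'rV[R]_n) b j : 0 <= b -> `|boxclamp v0 b v 0 j - v0 0 j| <= b.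
Proof.
move=> b0; rewrite mxE ler_distl; apply: clamp_itv; lra.
Qed.

Lemma boxclamp_id n (v0 v : 'rV[R]_n) b : (forall j, `|v 0 j - v0 0 j| <= b) ->
  boxclamp v0 b v = v.
Proof. by move=> H; apply/rowP => j; rewrite mxE clamp_id// -ler_distl. Qed.

Lemma box_compact n (v0 : 'rV[R]_n) b : compact [set v : 'rV[R]_n | forall j, `|v 0 j - v0 0 j| <= b].
Proof.
have -> : [set v : 'rV[R]_n | forall j, `|v 0 j - v0 0 j| <= b] =
    [set v : 'rV[R]_n | forall j, `[v0 0 j - b, v0 0 j + b]%classic (v 0 j)].
  apply/seteqP; split => v Hv j; have := Hv j; by rewrite /= in_itv/= ler_distl.
by apply: (@rV_compact R n (fun j => `[v0 0 j - b, v0 0 j + b]%classic)) => j; exact: segment_compact.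
Qed.

Lemma bounded_clamped p n q k (H : 'rV[R]_p * R * 'rV[R]_n * 'rV[R]_q -> 'rV[R]_k)
    (d0 : 'rV[R]_p) (bd t1 t2 : R) (X0 : 'rV[R]_n) (b : R) (z0 : 'rV[R]_q) (bz : R) :
  let cl := fun y : 'rV[R]_p * R * 'rV[R]_n * 'rV[R]_q =>
    (boxclamp d0 bd y.1.1.1, clampr t1 t2 y.1.1.2, boxclamp X0 b y.1.2, boxclamp z0 bz y.2) in
  0 <= bd -> t1 <= t2 -> 0 <= b -> 0 <= bz -> continuous (H \o cl) ->
  exists2 M, 0 <= M & forall y j, `|H (cl y) 0 j| <= M.
Proof.
move=> cl bd0 t12 b0 bz0 cH.
pose K : set ('rV[R]_p * R * 'rV[R]_n * 'rV[R]_q) :=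
  [set v : 'rV[R]_p | forall j, `|v 0 j - d0 0 j| <= bd] `*` `[t1, t2] `*`
  [set v : 'rV[R]_n | forall j, `|v 0 j - X0 0 j| <= b] `*` [set v : 'rV[R]_q | forall j, `|v 0 j - z0 0 j| <= bz].
have cK : compact K.
  apply: compact_setX; last exact: box_compact.
  apply: compact_setX; last exact: box_compact.
  by apply: compact_setX; [exact: box_compact|exact: segment_compact].
have cl_in y : K (cl y).
  split; [split; [split|]|].
  - exact: (fun j => boxclamp_in d0 y.1.1.1 j bd0).
  - by rewrite /= in_itv/=; exact: clamp_itv.
  - exact: (fun j => boxclamp_in X0 y.1.2 j b0).
  - exact: (fun j => boxclamp_in z0 y.2 j bz0).
have cl_id y : K y -> cl y = y.
  case: y => [[[u t] X] z] [[[h1 h2] h3] h4]; rewrite /cl /= in h1 h2 h3 h4 *.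
  by rewrite !boxclamp_id// clamp_id//; move: h2; rewrite in_itv.
have cE : {within K, continuous (fun y => enorm (H (cl y)))}.
  apply: continuous_subspaceT => y.
  by apply: (@continuous_comp _ _ _ (H \o cl) (@enorm R k)); [exact: cH|exact: enorm_continuous].
have [M M0 HM] := compact_bounded_fun cK cE; exists M => // y j.
rewrite (le_trans (coord_le_enorm _ _))// -[leLHS]ger0_norm ?enorm_ge0//.
by rewrite -{1}(cl_id _ (cl_in y)); exact: HM.
Qed.

End Clamp.

Section ClosedLoop.
Context {R : realType}.
Notation mu := (@lebesgue_measure R).
Variables (m n p q : nat) (sigma c T : R).
Variables (alpha N : R -> R) (al : nat -> R -> R).
Local Notation V := 'rV[R]_m.
Hypothesis c0 : 0 < c.
Hypothesis al_derive : forall (l : nat) (s : R), (l < n)%N -> 0 <= s < 1 ->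
  is_derive s 1 (al l) (al l.+1 s).
Hypothesis al_cont : forall (l : nat) (s : R), (l <= n)%N -> 0 <= s < 1 ->
  {for s, continuous (al l)}.
Hypothesis al0 : forall s : R, 0 <= s < 1 -> alpha s = al 0%N s.
Hypothesis al_ge0 : forall s : R, 0 <= s < 1 -> 0 <= alpha s.
Hypothesis hN : {within `[0, +oo[, continuous N}.

(** The feedback reads instantaneous values only; [w i] is the [i]-th derivative of the
tracking error at time [t]. *)
Definition FB (t : R) (w : nat -> V) : V :=
  let z := ee c T alpha t w n in N (alpha (enorm z ^+ 2)) *: z.


Lemma FB_cvg (S : Type) (F : set_system S) (FF : Filter F) (tau : S -> R) (t : R)
    (w : S -> nat -> V) (w' : nat -> V) : t != T ->
  tau @ F --> t -> (forall i, (i <= n)%N -> (fun s => w s i) @ F --> w' i) ->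
  (forall i, (i <= n)%N -> enorm (ee c T alpha t w' i) < 1) ->
  (fun s => FB (tau s) (w s)) @ F --> FB t w'.
Proof.
move=> tT ctau cw dom.
have cz : (fun s => ee c T alpha (tau s) (w s) n) @ F --> ee c T alpha t w' n.
  by apply: (ee_cvg c0 al_derive al_cont al0 FF) => // i /ltnW; exact: dom.
have cs := cvg_comp _ _ cz (@enorm2_continuous R m (ee c T alpha t w' n)).
have sd : 0 <= enorm (ee c T alpha t w' n) ^+ 2 < 1 by apply: enorm2_dom; exact: dom.
have ca : (fun s => alpha (enorm (ee c T alpha (tau s) (w s) n) ^+ 2)) @ F -->
    alpha (enorm (ee c T alpha t w' n) ^+ 2).
  rewrite (al0 sd).
  have := cvg_comp _ _ cs (al_cont (leq0n n) sd).
  apply: cvg_trans; apply: near_eq_cvg.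
  have /andP[_ s1] := sd.
  have H := cs; move/cvgr_lt: H => /(_ _ s1); apply: filterS => s hs /=.
  by rewrite al0// hs exprn_ge0 ?enorm_ge0.
rewrite /FB; apply: cvgZ; last exact: cz.
move/subspace_continuousP: hN => /(_ (alpha (enorm (ee c T alpha t w' n) ^+ 2))).
rewrite /= in_itv/= andbT => /(_ (al_ge0 sd)) cN.
move=> A /cN; rewrite /within/= => HA.
have H := ca _ HA; rewrite /= in H.
have ndom : \forall s \near F, 0 <= enorm (ee c T alpha (tau s) (w s) n) ^+ 2 < 1.
  have /andP[_ s1] := sd; have H2 := cs; move/cvgr_lt: H2 => /(_ _ s1); apply: filterS => s hs /=.
  by rewrite hs exprn_ge0 ?enorm_ge0.
have H' : \forall s \near F, alpha (enorm (ee c T alpha (tau s) (w s) n) ^+ 2) \in `[0, +oo[ ->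
  A (N (alpha (enorm (ee c T alpha (tau s) (w s) n) ^+ 2))) := H.
have : \forall s \near F, A (N (alpha (enorm (ee c T alpha (tau s) (w s) n) ^+ 2))).
  by apply: filterS2 H' ndom => s + hs; apply; rewrite in_itv/= andbT al_ge0.
by [].
Qed.

Lemma ee_ext t (e e' : nat -> V) k : (forall i, (i <= k)%N -> e i = e' i) ->
  ee c T alpha t e k = ee c T alpha t e' k.
Proof.
rewrite /ee; move=> H; congr nth.
have {H} : forall i, (i < k.+1)%N -> e i = e' i by [].
elim: k.+1 => // l IH H; have {}IH := IH (fun i il => H i (leqW il)).
by rewrite /= IH H.
Qed.

Definition blk (X : 'rV[R]_(n.+1 * m)) (i : nat) : V := row (inord i) (vec_mx X).

Lemma blkE X i j : blk X i 0 j = X 0 (mxvec_index (inord i) j).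
Proof. by rewrite /blk !mxE. Qed.

Lemma blk_stack x t i : (i <= n)%N -> blk (stack n.+1 x t) i = x i t.
Proof. by move=> ni; apply/rowP => j; rewrite blkE mxvecE !mxE inordK. Qed.

Lemma stack_blk (X : R -> 'rV[R]_(n.+1 * m)) : stack n.+1 (fun i t => blk (X t) i) = X.
Proof.
apply/funext => t; apply/rowP => k; case/mxvec_indexP: k => i j.
by rewrite mxvecE !mxE inord_val.
Qed.

Lemma stack_coord (x : nat -> R -> V) t (i : 'I_n.+1) j :
  stack n.+1 x t 0 (mxvec_index i j) = x i t 0 j.
Proof. by rewrite mxvecE !mxE. Qed.

Lemma blk_continuous i : continuous (blk^~ i).
Proof.
apply: rV_continuous => j; under eq_fun do rewrite blkE.
exact: coord_continuous.
Qed.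

Variables (d : R -> 'rV[R]_p) (f : 'rV[R]_p * 'rV[R]_q * V -> V).
Variable (Top : (R -> 'rV[R]_(n.+1 * m)) -> R -> 'rV[R]_q).
Variable yref : nat -> R -> V.
Hypotheses (sigma0 : 0 <= sigma) (hTop : op_class sigma Top) (hd : Linf `[0, +oo[ d).
Hypotheses (cf : continuous f).
Hypothesis cyref : forall i, (i <= n)%N -> {within `[0, T[, continuous (yref i)}.

Local Notation z x t := (ee c T alpha t (fun i => x i t - yref i t)).

Lemma compact_enorm_bound k (a b : R) (g : R -> 'rV[R]_k) :
  {within `[a, b], continuous g} -> exists2 C, 0 <= C & forall t, a <= t <= b -> enorm (g t) <= C.
Proof.
move=> cg; have [|M M0 HM] := @segment_bounded R a b (fun t => enorm (g t)).
  by move=> t; exact: (cvg_comp _ _ (cg t) (@enorm_continuous R k _)).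
by exists M => // t /HM; rewrite ger0_norm ?enorm_ge0.
Qed.

(** The state is confined to a box around [stack n.+1 xi t0] on which the errors stay
in the unit ball, [d] to its essential bound, and the memory term to the bound [c2]
that condition (b) yields for paths in that box.  On a short interval the solution of
the truncated equation does not leave the boxes, so that it solves the original one. *)
Lemma extend (t0 : R) (xi : nat -> R -> V) : 0 <= t0 < T ->
  (forall i, (i <= n)%N -> {within `[- sigma, t0], continuous (xi i)}) ->
  (forall k, (k <= n)%N -> enorm (z xi t0 k) < 1) ->
  exists h x, [/\ 0 < h /\ t0 + h < T,
    forall i t, (i <= n)%N -> - sigma <= t <= t0 -> x i t = xi i t,
    forall i, continuous (x i) /\ forall j, lipx t0 (t0 + h) (fun t => x i t 0 j),
    forall k t, (k <= n)%N -> t0 <= t <= t0 + h -> enorm (z x t k) < 1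
  & {ae mu, forall t : R, t0 < t < t0 + h ->
      (forall i, (i < n)%N -> is_derive t 1 (x i) (x i.+1 t)) /\
      is_derive t 1 (x n) (f (d t, Top (stack n.+1 x) t,
        feedback n.+1 alpha N c T yref x t))}].
Proof.
move=> /andP[t00 t0T] cxi dom0.
have [_ Tbd _ _] := hTop; have [_ [bd dbd]] := hd.
pose t2 := (t0 + T) / 2.
have t02 : t0 < t2 by rewrite /t2; lra.
have t2T : t2 < T by rewrite /t2; lra.
have t20 : 0 <= t2 by rewrite (le_trans t00)// ltW.
pose yr i := yref i \o clampr 0 t2.
have cyr i : (i <= n)%N -> continuous (yr i).
  move=> ni; apply: within_clamp_continuous => //.
  apply: continuous_subspaceW (cyref ni) => t; rewrite /= !in_itv/= => /andP[-> h].
  exact: le_lt_trans h t2T.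
have yrE i t : 0 <= t <= t2 -> yr i t = yref i t by move=> ht; rewrite /yr /= clamp_id.
pose w (t : R) X i := blk X i - yr i t.
pose X0 := stack n.+1 xi t0.
have cw (S : Type) (F : set_system S) (FF : Filter F) (tau : S -> R) t
    (Y : S -> 'rV[R]_(n.+1 * m)) X i : (i <= n)%N ->
    tau @ F --> t -> Y @ F --> X -> (fun s => w (tau s) (Y s) i) @ F --> w t X i.
  move=> ni ct cY; apply: cvgB.
    exact: (cvg_comp _ _ cY (@blk_continuous i X)).
  exact: (cvg_comp _ _ ct (@cyr i ni t)).
have nT t : t <= t2 -> t != T by move=> h; rewrite lt_eqF// (le_lt_trans h).
have dom1 k : (k <= n)%N -> enorm (ee c T alpha t0 (w t0 X0) k) < 1.
  move=> kn; rewrite (_ : ee _ _ _ _ _ _ = z xi t0 k); first exact: dom0.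
  apply: ee_ext => i ik; rewrite /w blk_stack ?(leq_trans ik)// yrE// t00 ltW//.
have nbox : \forall y \near ((t0, X0) : R * 'rV[R]_(n.+1 * m)), forall k : 'I_n.+1,
    enorm (ee c T alpha y.1 (w y.1 y.2) k) < 1.
  apply: (@filter_forall _ _ (fun (k : 'I_n.+1) (y : R * 'rV[R]_(n.+1 * m)) =>
    enorm (ee c T alpha y.1 (w y.1 y.2) k) < 1) _ (nbhs_filter (t0, X0))) => k.
  have kn : (k <= n)%N by rewrite -ltnS.
  have C : (fun y : R * 'rV[R]_(n.+1 * m) => ee c T alpha y.1 (w y.1 y.2) k) @ (t0, X0) -->
      ee c T alpha t0 (w t0 X0) k.
    apply: (ee_cvg c0 al_derive al_cont al0 (nbhs_filter _)) => //.
    - exact: leqW.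
    - by rewrite lt_eqF.
    - exact: cvg_fst.
    - by move=> i ik; apply: cw; [exact: leq_trans kn|exact: cvg_fst|exact: cvg_snd].
    - by move=> i ik; apply: dom1; rewrite (leq_trans (ltnW ik)).
  have := cvg_comp _ _ C (@enorm_continuous R m _).
  by move=> /cvgr_lt /(_ _ (dom1 k kn)).
have [b [b0 bt2 Hbox]] : exists b : R, [/\ 0 < b, t0 + b <= t2 & forall t (X : 'rV[R]_(n.+1 * m)), t0 <= t <= t0 + b ->
    (forall j, `|X 0 j - X0 0 j| <= b) -> forall k, (k <= n)%N ->
    enorm (ee c T alpha t (w t X) k) < 1].
  have /nbhs_ballP[e /= e0 He] := nbox.
  exists (Num.min (e / 2) (t2 - t0)); split.
  - by rewrite lt_min divr_gt0// subr_gt0.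
  - by rewrite -lerBrDl ge_min lexx orbT.
  - move=> t X /andP[t0t tb] Xb k kn.
    have be : Num.min (e / 2) (t2 - t0) < e.
      by rewrite gt_min ltr_pdivrMr// mulrDr mulr1 ltrDl e0.
    have B : ball ((t0, X0) : R * 'rV[R]_(n.+1 * m)) e (t, X).
      split => /=.
        rewrite /ball/= distrC ger0_norm ?subr_ge0//; apply: le_lt_trans be.
        by rewrite lerBlDl.
      split => // i j; rewrite /ball/= ord1 distrC; apply: le_lt_trans be; exact: Xb.
    by have := He _ B (Ordinal (kn : (k < n.+1)%N)).
have [C1 C10 HC1] : exists2 C, 0 <= C &
    forall t, - sigma <= t <= t0 -> enorm (stack n.+1 xi t) <= C.
  apply: compact_enorm_bound.
  have H i : {within `[- sigma, t0], continuous (xi i)} \/ (n < i)%N.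
    by case: (leqP i n) => [/cxi|]; [left|right].
  move=> t; apply: rV_cvgP => k; case/mxvec_indexP: k => i j.
  have := cxi i (ltn_ord i) t; move=> /(rV_cvg_coord _ (j := j)).
  rewrite /from_subspace.
  by under [X in _ -> X @ _ --> _]eq_fun do rewrite stack_coord; rewrite stack_coord.
(* c1 bounds the stacked path, on the past by C1 and in the box by its radius. *)
pose c1 := C1 + (enorm X0 + (n.+1 * m)%:R * b) + 1.
have c10 : 0 < c1 by rewrite /c1 ltr_wpDl// !addr_ge0 ?enorm_ge0// mulr_ge0// ltW.
have [c2 c20 Hc2] := Tbd c1 c10.
pose bd' := `|bd|.
pose cl := fun y : 'rV[R]_p * R * 'rV[R]_(n.+1 * m) * 'rV[R]_q =>
    (boxclamp 0 bd' y.1.1.1, clampr t0 (t0 + b) y.1.1.2, boxclamp X0 b y.1.2, boxclamp 0 c2 y.2).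
pose H0 := fun y : 'rV[R]_p * R * 'rV[R]_(n.+1 * m) * 'rV[R]_q =>
  mxvec (\matrix_(i < n.+1) if (i < n)%N then blk y.1.2 i.+1
         else f (y.1.1.1, y.2, FB y.1.1.2 (w y.1.1.2 y.1.2))).
have t0b : t0 <= t0 + b by rewrite lerDl ltW.
have cH : continuous (H0 \o cl).
  apply: rV_continuous => k; case/mxvec_indexP: k => i j.
  under eq_fun do rewrite /= mxvecE !mxE.
  have c3 : continuous (fun y : 'rV[R]_p * R * 'rV[R]_(n.+1 * m) * 'rV[R]_q => boxclamp X0 b y.1.2).
    move=> y; apply: continuous_comp; last exact: boxclamp_continuous.
    by apply: (@continuous_comp _ _ _ fst snd); [exact: cvg_fst|exact: cvg_snd].
  case: (ltnP i n) => [ni|_].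
    apply: coord_cont => y; apply: (@continuous_comp _ _ _ (fun y => boxclamp X0 b y.1.2) (blk^~ i.+1)).
      exact: c3.
    exact: blk_continuous.
  apply: coord_cont => y; rewrite /=.
  have c2' : clampr t0 (t0 + b) y'.1.1.2 @[y' --> y] --> clampr t0 (t0 + b) y.1.1.2.
    apply: (@continuous_comp _ _ _ (fun y : 'rV[R]_p * R * 'rV[R]_(n.+1 * m) * 'rV[R]_q => y.1.1.2)
      (clampr t0 (t0 + b))); last exact: clamp_continuous.
    apply: (@continuous_comp _ _ _ (fun y : 'rV[R]_p * R * 'rV[R]_(n.+1 * m) * 'rV[R]_q => y.1.1) snd); last exact: cvg_snd.
    by apply: (@continuous_comp _ _ _ fst fst); exact: cvg_fst.
  have c1' : boxclamp 0 bd' y'.1.1.1 @[y' --> y] --> boxclamp 0 bd' y.1.1.1.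
    apply: (@continuous_comp _ _ _ (fun y : 'rV[R]_p * R * 'rV[R]_(n.+1 * m) * 'rV[R]_q => y.1.1.1)
      (boxclamp 0 bd')); last exact: boxclamp_continuous.
    apply: (@continuous_comp _ _ _ (fun y : 'rV[R]_p * R * 'rV[R]_(n.+1 * m) * 'rV[R]_q => y.1.1) fst); last exact: cvg_fst.
    by apply: (@continuous_comp _ _ _ fst fst); exact: cvg_fst.
  have c4' : boxclamp 0 c2 y'.2 @[y' --> y] --> boxclamp 0 c2 y.2.
    apply: (@continuous_comp _ _ _ snd (boxclamp 0 c2)); last exact: boxclamp_continuous.
    exact: cvg_snd.
  have /andP[tc0 tcb] := clamp_itv y.1.1.2 t0b.
  suff cF : FB (clampr t0 (t0 + b) y'.1.1.2)
      (w (clampr t0 (t0 + b) y'.1.1.2) (boxclamp X0 b y'.1.2)) @[y' --> y] -->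
      FB (clampr t0 (t0 + b) y.1.1.2) (w (clampr t0 (t0 + b) y.1.1.2) (boxclamp X0 b y.1.2)).
    have cP : (fun y' : 'rV[R]_p * R * 'rV[R]_(n.+1 * m) * 'rV[R]_q =>
        (boxclamp 0 bd' y'.1.1.1, boxclamp 0 c2 y'.2, FB (clampr t0 (t0 + b) y'.1.1.2)
          (w (clampr t0 (t0 + b) y'.1.1.2) (boxclamp X0 b y'.1.2)))) @ y -->
        ((boxclamp 0 bd' y.1.1.1, boxclamp 0 c2 y.2, FB (clampr t0 (t0 + b) y.1.1.2)
          (w (clampr t0 (t0 + b) y.1.1.2) (boxclamp X0 b y.1.2))) : 'rV[R]_p * 'rV[R]_q * V).
      exact: (cvg_pair (cvg_pair c1' c4') cF).
    exact: (cvg_comp _ _ cP (@cf _)).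
  apply: FB_cvg => //.
  - by apply: nT; rewrite (le_trans tcb).
  - by move=> i' ni; apply: cw => //; exact: c3.
  - move=> k kn; apply: Hbox => //; first by rewrite tc0.
    by move=> j'; apply: boxclamp_in; exact: ltW.
have [M M0 HM] := bounded_clamped (normr_ge0 bd) t0b (ltW b0) (ltW c20) cH.
(* A path of speed at most M stays in the box for this time. *)
pose h0 := Num.min b (b / (M + 1)).
have M10 : 0 < M + 1 by rewrite ltr_wpDl.
have h00 : 0 < h0 by rewrite lt_min b0 divr_gt0.
have cX : {within `[- sigma, t0], continuous (stack n.+1 xi)}.
  move=> t; apply: rV_cvgP => k; case/mxvec_indexP: k => i j.
  have := cxi i (ltn_ord i) t; move=> /(rV_cvg_coord _ (j := j)).
  rewrite /from_subspace.
  by under [X in _ -> X @ _ --> _]eq_fun do rewrite stack_coord; rewrite stack_coord.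
have [h [X [/andP[hp hh0] ccX XE [Xl Xc] dX]]] :=
  locex sigma0 hTop hd t00 M0 h00 cX cH HM.
have hb : h <= b by rewrite (le_trans hh0)// ge_min lexx.
have Mh : M * h <= b.
  have : h <= b / (M + 1) by rewrite (le_trans hh0)// ge_min lexx orbT.
  rewrite ler_pdivlMr// => Hh; apply: le_trans Hh.
  by rewrite mulrC ler_wpM2l ?lerDl ?ltW.
have st0 : - sigma <= t0 by rewrite (le_trans _ t00)// oppr_le0.
have X0E : X t0 = X0 by rewrite XE// lexx st0.
have t0h : t0 <= t0 + h by rewrite lerDl ltW.
have Xbox t : t0 <= t <= t0 + h -> forall j, `|X t 0 j - X0 0 j| <= b.
  move=> /andP[t0t th] j; rewrite -X0E; apply: le_trans Mh.
  rewrite (le_trans (Xl j t0 t _ _)) ?lexx ?t0t//.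
  by rewrite ler_wpM2l// ger0_norm ?subr_ge0// lerBlDl.
have Xbd t : - sigma <= t -> enorm (X t) <= c1.
  move=> st.
  have hX t' : t0 <= t' <= t0 + h -> enorm (X t') <= c1.
    move=> ht'; rewrite -[X t'](subrK X0) (le_trans (enormD _ _))// /c1 addrC.
    have E : enorm (X t' - X0) <= (n.+1 * m)%:R * b.
      by apply: enorm_le_bound; [exact: ltW|move=> j; rewrite !mxE; exact: Xbox].
    by move: C10 E; lra.
  have [tt0|tt0] := leP t t0.
    rewrite XE ?st// (le_trans (HC1 t _)) ?st//.
    have : 0 <= enorm X0 + (n.+1 * m)%:R * b by rewrite addr_ge0 ?enorm_ge0// mulr_ge0// ltW.
    by rewrite /c1; lra.
  have [tth|tth] := leP t (t0 + h); first by apply: hX; rewrite tth ltW.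
  by rewrite Xc ?(ltW tth)//; apply: hX; rewrite t0h lexx.
pose x i t := blk (X t) i.
have sx : stack n.+1 x = X by exact: stack_blk.
have wE t i : t0 <= t <= t0 + h -> (i <= n)%N -> w t (X t) i = x i t - yref i t.
  move=> /andP[t0t th] ni; rewrite /w yrE// (le_trans t00 t0t) (le_trans th)//.
  by rewrite (le_trans _ bt2)// lerD2l.
have zE t k : t0 <= t <= t0 + h -> (k <= n)%N -> ee c T alpha t (w t (X t)) k = z x t k.
  by move=> th kn; apply: ee_ext => i ik; apply: wE => //; rewrite (leq_trans ik).
have thb t : t0 <= t <= t0 + h -> t0 <= t <= t0 + b.
  by move=> /andP[-> /le_trans H]; apply: H; rewrite lerD2l.
exists h, x; split.
- split => //; rewrite (le_lt_trans _ t2T)// (le_trans _ bt2)// lerD2l//.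
- by move=> i t ni ht; rewrite /x XE// blk_stack.
- move=> i; split.
    move=> t; apply: (@continuous_comp _ _ _ X (blk^~ i)); first exact: ccX.
    exact: blk_continuous.
  move=> j; exists M; apply: lipon_eq (Xl (mxvec_index (inord i) j)) => t _.
  by rewrite /x blkE.
- move=> k t kn th; rewrite -zE//; apply: Hbox => //; [exact: thb|exact: Xbox].
- apply: aeS2 dX dbd => t dX dbd th.
  have th' : t0 <= t <= t0 + h by case/andP: th => /ltW -> /ltW ->.
  have t0' : 0 <= t by case/andP: th' => /(le_trans t00).
  have dt : forall j, `|d t 0 j - (0 : 'rV[R]_p) 0 j| <= bd'.
    move=> j; rewrite mxE subr0 (le_trans (coord_le_enorm _ _))//.
    by rewrite (le_trans (dbd _)) ?ler_norm//= in_itv/= t0'.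
  have Tt : forall j, `|Top X t 0 j - (0 : 'rV[R]_q) 0 j| <= c2.
    move=> j; rewrite mxE subr0 (le_trans (coord_le_enorm _ _))//.
    by apply: Hc2 => //; exact: continuous_subspaceT.
  have {}dX := dX th.
  rewrite /= /cl /= !boxclamp_id// in dX; last exact: Xbox.
  rewrite clamp_id in dX; last exact: thb.
  have fE : FB t (w t (X t)) = feedback n.+1 alpha N c T yref x t.
    by rewrite /FB zE.
  have dc i j : is_derive t 1 (fun s => x i s 0 j)
      (H0 (d t, t, X t, Top X t) 0 (mxvec_index (inord i) j)).
    have -> : (fun s => x i s 0 j) = (fun s => X s 0 (mxvec_index (inord i) j)).
      by apply/funext => s; rewrite /x blkE.
    exact: is_derive_coord dX.
  split.
    move=> i ni; apply: rV_is_derive => j.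
    have := dc i j; rewrite /H0 mxvecE !mxE inordK; last by rewrite ltnS ltnW.
    by rewrite ni blkE.
  apply: rV_is_derive => j.
  have := dc n j; rewrite /H0 mxvecE !mxE inordK// ltnn /=.
  by rewrite fE sx.
Qed.

End ClosedLoop.

(** * The gain function *)


Section Alpha.
Context {R : realType}.
Variables (n : nat) (K : R) (alpha : R -> R).
Hypothesis hbij : set_bij `[0, 1[ `[K, +oo[ alpha.

Lemma alpha_ge s : 0 <= s < 1 -> K <= alpha s.
Proof.
move=> s01; have [af _ _] := hbij.
have : `[K, +oo[%classic (alpha s) by apply: af; rewrite /= in_itv.
by rewrite /= in_itv/= andbT.
Qed.

(** Beyond the point [s0] where alpha takes the value [M], it cannot be less than [M]:
as it also takes larger values there, it would take the value [M] once more. *)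
Lemma alpha_large : {within `[0, 1[, continuous alpha} ->
  forall M : R, exists2 s0, 0 <= s0 < 1 & forall s, s0 <= s < 1 -> M <= alpha s.
Proof.
move=> ca M'; have [_ ai aS] := hbij.
have surj v : K <= v -> exists2 s, 0 <= s < 1 & alpha s = v.
  move=> Kv; have [s s01 <-] : (alpha @` `[0, 1[%classic) v.
    by apply: aS; rewrite /= in_itv/= andbT.
  by exists s => //; move: s01; rewrite /= in_itv.
have inj s t : 0 <= s < 1 -> 0 <= t < 1 -> alpha s = alpha t -> s = t.
  by move=> hs ht; apply: ai; rewrite inE/= in_itv.
have cw a b : 0 <= a -> b < 1 -> {within `[a, b], continuous alpha}.
  move=> a0 b1; apply: continuous_subspaceW ca => t; rewrite /= !in_itv/= => /andP[h1 h2].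
  by rewrite (le_trans a0 h1) (le_lt_trans h2 b1).
have [M [KM MM]] : exists M, K <= M /\ M' <= M.
  by exists (Num.max M' K); rewrite !le_max !lexx orbT.
have [s0 s01 aM] := surj M KM.
have /andP[s00 s0_1] := s01.
have [sm smI Hm] := EVT_max s00 (cw 0 s0 (lexx _) s0_1).
have [s2 s21 a2] := surj (alpha sm + 1) (ltac:(rewrite (le_trans (alpha_ge (s := sm) _)) ?lerDl//;
  move: smI; rewrite in_itv/= => /andP[-> /le_lt_trans]; exact)).
have s02 : s0 < s2.
  rewrite ltNge; apply/negP => s20; have := Hm s2; rewrite in_itv/= s20.
  by case/andP: s21 => -> _ /(_ isT); rewrite a2; lra.
have aM2 : M < alpha s2.
  by rewrite a2 -aM; have := Hm s0; rewrite in_itv/= s00 lexx => /(_ isT); lra.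
exists s0 => // s /andP[s0s s1]; apply: (le_trans MM).
rewrite leNgt; apply/negP => asM.
have s0s' : s0 < s by rewrite lt_neqAle s0s andbT; apply: contraTneq asM => <-; rewrite aM ltxx.
have [t [t0 t1 tM]] : exists t, [/\ s0 < t, t < 1 & alpha t = M].
  have /andP[_ s2_1] := s21.
  have [ss|ss] := leP s s2.
    have [|t] := IVT ss (cw s s2 (le_trans s00 s0s) s2_1) (v := M).
      by apply/andP; split; rewrite ?ge_min ?le_max (ltW asM, ltW aM2) ?orbT.
    rewrite in_itv/= => /andP[st ts] tM; exists t; split => //; first exact: lt_le_trans st.
    exact: le_lt_trans ts _.
  have [|t] := IVT (ltW ss) (cw s2 s (le_trans s00 (ltW s02)) s1) (v := M).
    by apply/andP; split; rewrite ?ge_min ?le_max (ltW asM, ltW aM2) ?orbT.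
  rewrite in_itv/= => /andP[st ts] tM; exists t; split => //; first exact: lt_le_trans st.
  exact: le_lt_trans ts _.
have := inj s0 t s01 _; rewrite aM tM t1 (le_trans s00 (ltW t0)) => /(_ isT erefl) E.
by rewrite E ltxx in t0.
Qed.

(** The jet of [alpha] on [0, 1), continued affinely to negative arguments, so
that derivatives at 0 become two-sided. *)
Lemma alpha_jet : Ck n `[0, 1[ alpha -> exists al : nat -> R -> R,
  [/\ forall (l : nat) (s : R), (l < n)%N -> 0 <= s < 1 -> is_derive s 1 (al l) (al l.+1 s),
      forall (l : nat) (s : R), (l <= n)%N -> 0 <= s < 1 -> {for s, continuous (al l)},
      forall s : R, 0 <= s < 1 -> alpha s = al 0%N s
    & {within `[0, 1[, continuous alpha}].
Proof.
move=> [G [[cG dG] G0]].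
pose al l (s : R) := if s < 0 then G l 0 + s * G l.+1 0 else G l s.
have alE l s : 0 <= s -> al l s = G l s by move=> s0; rewrite /al ltNge s0.
exists al; split.
- move=> l s ln s01; have /andP[s0 s1] := s01.
  have C : (fun h => h^-1 *: (al l (h *: 1 + s) - al l s)) @ 0^' --> al l.+1 s.
    move=> A LA; have := dG l ln s; rewrite /= in_itv/= s01 => /(_ isT).
    rewrite alE// in LA; move=> /(_ A LA) H.
    have H1 : \forall u \near s, u != s -> `[0, 1[%classic u -> A ((u - s)^-1 *: (G l u - G l s)) := H.
    have ch : (fun h : R => h *: 1 + s) @ (0 : R) --> s.
      rewrite -[X in _ --> X]add0r -[X in _ --> X + _](scale0r (1 : R)).
      by apply: cvgD; [apply: cvgZr_tmp|exact: cvg_cst].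
    have H2 : \forall h \near (0 : R), h *: 1 + s != s -> `[0, 1[%classic (h *: 1 + s) ->
       A ((h *: 1 + s - s)^-1 *: (G l (h *: 1 + s) - G l s)) := ch _ H1.
    have n1 : \forall h \near (0 : R), h *: 1 + s < 1 := ch _ (lt_nbhsl s1).
    have n0 : \forall h \near (0 : R), 0 < s -> 0 < h *: 1 + s.
      have [s0'|] := ltP 0 s; last by move=> _; apply: filterE.
      have n0 : \forall h \near (0 : R), 0 < h *: 1 + s := ch _ (lt_nbhsr s0').
      by apply: filterS n0.
    rewrite /dnbhs; change (\forall h \near (0 : R), h != 0 -> A (h^-1 *: (al l (h *: 1 + s) - al l s))).
    have A1 : A (G l.+1 s) := nbhs_singleton LA.
    apply: filterS2 H2 (filterI n1 n0) => h {}H2 [{}n1 {}n0] hn0.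
    have [hs|hs] := ltP (h *: 1 + s) 0.
      have sE : s = 0.
        apply/eqP; rewrite eq_le s0 andbT leNgt; apply/negP => /n0.
        by rewrite ltNge (ltW hs).
      subst s; rewrite addr0 /GRing.scale/= mulr1 in hs *.
      rewrite /al hs ltxx addrC addKr mulrA mulVf// mul1r//.
    rewrite (alE l s)// alE//; move: H2; rewrite addrK /GRing.scale/= mulr1 /= in hs n1 *.
    by rewrite -subr_eq0 addrK in_itv/= hs n1 => /(_ hn0 isT).
  by split; [apply/cvg_ex; exists (al l.+1 s); exact: C|apply/cvg_lim => //; exact: C].
- move=> l s ln s01; have /andP[s0 s1] := s01.
  move=> A; rewrite alE// => LA.
  have := cG l ln; move/subspace_continuousP => /(_ s); rewrite /= in_itv/= => /(_ s01 A LA) H.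
  have H1 : \forall u \near s, `[0, 1[%classic u -> A (G l u) := H.
  have n1 : \forall u \near s, u < 1 := lt_nbhsl s1.
  have n0 : \forall u \near s, u < 0 -> A (al l u).
    have [s0'|s0'] := ltP 0 s.
      by apply: filterS (lt_nbhsr s0') => u u0; rewrite ltNge (ltW u0).
    have sE : s = 0 by apply/eqP; rewrite eq_le s0 s0'.
    have C : (fun u => G l 0 + u * G l.+1 0) @ s --> G l s.
      rewrite sE -[X in _ --> X]addr0 -[X in _ --> _ + X](mul0r (G l.+1 0)).
      by apply: cvgD; [exact: cvg_cst|apply: cvgM; [exact: cvg_id|exact: cvg_cst]].
    have H3 : \forall u \near s, A (G l 0 + u * G l.+1 0) := C _ LA.
    by apply: filterS H3 => u Hu u0; rewrite /al u0.
  change (\forall u \near s, A (al l u)).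
  apply: filterS2 H1 (filterI n1 n0) => u {}H1 [{}n1 {}n0].
  have [u0|u0] := ltP u 0; first exact: n0.
  by rewrite alE//; apply: H1; rewrite /= in_itv/= u0 n1.
- by move=> s s01; rewrite alE ?G0 ?in_itv//; case/andP: s01.
- apply: (subspace_eq_continuous (f := G 0%N)); last exact: cG.
  by move=> t; rewrite inE => /G0 ->.
Qed.

End Alpha.

(** * The reference *)


Section Reference.
Context {R : realType}.
Notation mu := (@lebesgue_measure R).

Lemma ae_exhaust (a om : R) (P : R -> Prop) :
  (forall b, b < om -> {ae mu, forall t, a < t < b -> P t}) ->
  {ae mu, forall t, a < t < om -> P t}.
Proof.
move=> H; have /ae_foralln : forall k : nat, {ae mu, forall t, a < t < om - k.+1%:R^-1 -> P t}.
  by move=> k; apply: H; rewrite ltrBlDr ltrDl invr_gt0.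
apply: aeS => t Ht /andP[at_ tom].
have e0 : 0 < om - t by rewrite subr_gt0.
have Hk := @near_infty_natSinv_lt R (PosNum e0).
have [k {}Hk] := @filter_ex _ _ _ _ Hk; apply: (Ht k); rewrite at_/=.
by move: Hk => /=; rewrite ltrBrDl addrC -ltrBrDl.
Qed.

(** [weak_lip] on each segment: its test functions are test functions of [A], and the
Lipschitz constant is the essential bound of the next derivative on all of [A]. *)
Lemma winf_lip (n k : nat) (A : set R) (G : nat -> R -> 'rV[R]_n) (i : nat) :
  measurable A -> Winf_jet k A G -> (i < k)%N -> exists2 M, 0 <= M &
  forall a b, a <= b -> `[a, b] `<=` A -> forall j,
    lipon a b M (fun t => G i t 0 j) /\
    {ae mu, forall t : R, a < t < b -> is_derive t 1 (fun t => G i t 0 j) (G i.+1 t 0 j)}.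
Proof.
move=> mA [cG lG wG] ik; have [[h [mh hE]] [M HM]] := lG i.+1 ik.
exists `|M| => // a b ab abA j.
apply: (@weak_lip _ a b M (fun t => G i t 0 j) (fun t => G i.+1 t 0 j) (fun t => h t 0 j)) => //.
- move=> t; have := (continuous_subspaceW abA (cG i ik)) t.
  by move=> /(rV_cvg_coord _ (j := j)).
- exact: measurable_funS (mh j).
- apply: aeS2 HM hE => t HM hE tab; have At : A t by apply: abA; rewrite /= in_itv.
  by rewrite -hE// (le_trans (coord_le_enorm _ _))// HM.
- by apply: aeS hE => t hE tab; rewrite hE//; apply: abA; rewrite /= in_itv.
- move=> psi tpsi; have tA : test_fun A psi.
    move: tpsi => [h1 h2 [K [h3 h4 h5]]]; split => //; exists K; split => //.
    by apply: subset_trans h4 _; exact: interiorS.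
  have [_ _ psi0 _ _] := test_fun_props (@subset_refl _ _) tpsi.
  have := wG i ik psi tA j.
  rewrite -(@Rintegral_sub _ `[a, b] A); [|by []|by move=> t /psi0[_ ->]; rewrite mulr0].
  by rewrite -(@Rintegral_sub _ `[a, b] A); [|by []|by move=> t /psi0[-> _]; rewrite mulr0].
Qed.

Lemma yref_props (m n : nat) (T : R) (yref : nat -> R -> 'rV[R]_m) : 0 < T ->
  Winf_jet n.+1 `[0, T[ yref -> exists M, [/\ 0 <= M,
    forall i b j, (i <= n)%N -> 0 <= b < T -> lipon 0 b M (fun t => yref i t 0 j),
    forall i t j, (i <= n)%N -> 0 <= t < T -> `|yref i t 0 j| <= M,
    {ae mu, forall t, 0 < t < T -> forall i j, (i <= n)%N ->
       is_derive t 1 (fun t : R => yref i t 0 j) (yref i.+1 t 0 j)}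
  & {ae mu, forall t, 0 <= t < T -> forall j, `|yref n.+1 t 0 j| <= M}].
Proof.
move=> T0 wj; have [_ lG _] := wj.
have HM i : exists M, (i <= n)%N -> 0 <= M /\
  forall a b, a <= b -> `[a, b] `<=` `[0, T[%classic -> forall j,
    lipon a b M (fun t => yref i t 0 j) /\
    {ae mu, forall t : R, a < t < b -> is_derive t 1 (fun t => yref i t 0 j) (yref i.+1 t 0 j)}.
  have [ni|ni] := leqP i n; last by exists 0.
  by have [M M0 H] := winf_lip (measurable_itv _) wj ni; exists M.
have {HM}[Mi HMi] := choice HM.
have [_ [Mn HMn]] := lG n.+1 (leqnn _).
pose M0 := \sum_(i < n.+1) (`|Mi i| + (\sum_j `|yref i 0 0 j|) + `|Mi i| * T) + `|Mn|.
have T0' := ltW T0.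
have S0 (i : 'I_n.+1) : 0 <= `|Mi i| + (\sum_j `|yref i 0 0 j|) + `|Mi i| * T.
  by rewrite !addr_ge0// ?mulr_ge0// sumr_ge0.
have Mge i : (i <= n)%N -> `|Mi i| + (\sum_j `|yref i 0 0 j|) + `|Mi i| * T <= M0.
  move=> ni; rewrite /M0 (bigD1 (Ordinal (ni : (i < n.+1)%N)))//= -[leRHS]addrA lerDl.
  by rewrite addr_ge0// sumr_ge0.
have sub b : 0 <= b < T -> `[0, b] `<=` `[0, T[%classic.
  by move=> /andP[b0 bT] t; rewrite /= !in_itv/= => /andP[-> /le_lt_trans]; exact.
exists M0; split.
- by rewrite addr_ge0// sumr_ge0.
- move=> i b j ni bT; have [Mi0 H] := HMi i ni; have /andP[b0 _] := bT.
  have [H1 _] := H 0 b b0 (sub b bT) j; apply: lipon_le H1; apply: le_trans (Mge i ni).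
  rewrite (le_trans (ler_norm _))// -[leRHS]addrA lerDl addr_ge0 ?mulr_ge0// sumr_ge0//.
- move=> i t j ni tT; have [Mi0 H] := HMi i ni; have /andP[t0 tT'] := tT.
  have [H1 _] := H 0 t t0 (sub t tT) j; apply: le_trans (Mge i ni).
  have := H1 0 t; rewrite !lexx t0 => /(_ isT isT); rewrite subr0 => H2.
  have H3 : `|yref i 0 0 j| <= \sum_j `|yref i 0 0 j| by rewrite (bigD1 j)//= lerDl sumr_ge0.
  have H4 : Mi i * `|t| <= `|Mi i| * T.
    by apply: ler_pM => //; [exact: ler_norm|rewrite ger0_norm// ltW].
  have H5 := normr_ge0 (Mi i).
  rewrite -[yref i t 0 j](subrK (yref i 0 0 j)) (le_trans (ler_normD _ _))//.
  by rewrite addrC -addrA; apply: ler_wpDl => //; apply: lerD => //; exact: le_trans H4.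
- apply: ae_exhaust => b bT.
  have [b0|b0] := ltP b 0.
    by apply: aeW => t /andP[t0 tb]; have := lt_trans (lt_trans t0 tb) b0; rewrite ltxx.
  apply: (@aeS _ (fun t : R => forall i : nat, forall j, (i <= n)%N -> 0 < t < b ->
     is_derive t 1 (fun t : R => yref i t 0 j) (yref i.+1 t 0 j))).
    by move=> t Ht tb i j ni; exact: Ht.
  apply: ae_foralln => i; apply: ae_ord => j.
  have [ni|ni] := leqP i n; last by exact: aeW.
  have [_ H] := HMi i ni.
  have hb : 0 <= b < T by rewrite b0.
  by have [_ Hd] := H 0 b b0 (sub b hb) j; apply: aeS Hd => t Ht _; exact: Ht.
- apply: aeS HMn => t Ht tT j; rewrite (le_trans (coord_le_enorm _ _))//.
  rewrite (le_trans (Ht _))// ?in_itv// (le_trans (ler_norm _))// /M0 lerDr sumr_ge0//.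
Qed.

End Reference.

(** * The high-gain level *)


Section HighGain.
Context {R : realType}.

Lemma cvg_dotp (S : Type) (F : set_system S) (FF : Filter F) n (v w : S -> 'rV[R]_n) (v' w' : 'rV[R]_n) :
  v @ F --> v' -> w @ F --> w' -> (fun s => dotp (v s) (w s)) @ F --> dotp v' w'.
Proof.
by move=> cv cw; apply: cvg_sum_seq => j; apply: cvgM; exact: rV_cvg_coord.
Qed.

Variables (m p q : nat) (f : 'rV[R]_p * 'rV[R]_q * 'rV[R]_m -> 'rV[R]_m).
Hypotheses (m0 : (0 < m)%N) (cf : continuous f).

Notation gain s y := (dotp y.2 (f (y.1.1, y.1.2, - (s *: y.2)))).

Lemma gain_cvg (s : R) (y : 'rV[R]_p * 'rV[R]_q * 'rV[R]_m) :
  (fun ys : ('rV[R]_p * 'rV[R]_q * 'rV[R]_m) * R => gain ys.2 ys.1) @ filter_prod (nbhs y) (nbhs s)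
    --> (gain s y : R).
Proof.
pose X := 'rV[R]_p * 'rV[R]_q * 'rV[R]_m : Type.
have c1 : (fun ys : X * R => ys.1) @ filter_prod (nbhs y) (nbhs s) --> y by exact: cvg_fst.
have c2 : (fun ys : X * R => ys.2) @ filter_prod (nbhs y) (nbhs s) --> s by exact: cvg_snd.
have c12 : (fun ys : X * R => ys.1.2) @ filter_prod (nbhs y) (nbhs s) --> y.2.
  by apply: (cvg_comp _ _ c1); exact: cvg_snd.
have c11 : (fun ys : X * R => ys.1.1) @ filter_prod (nbhs y) (nbhs s) --> y.1.
  by apply: (cvg_comp _ _ c1); exact: cvg_fst.
have c111 : (fun ys : X * R => ys.1.1.1) @ filter_prod (nbhs y) (nbhs s) --> y.1.1.
  by apply: (cvg_comp _ _ c11); exact: cvg_fst.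
have c112 : (fun ys : X * R => ys.1.1.2) @ filter_prod (nbhs y) (nbhs s) --> y.1.2.
  by apply: (cvg_comp _ _ c11); exact: cvg_snd.
apply: cvg_dotp => //.
have cu : (fun ys : X * R => - (ys.2 *: ys.1.2)) @ filter_prod (nbhs y) (nbhs s) --> - (s *: y.2).
  by apply: cvgN; apply: cvgZ.
suff cP : (fun ys : X * R => ((ys.1.1.1, ys.1.1.2, - (ys.2 *: ys.1.2)) : X)) @ filter_prod (nbhs y) (nbhs s)
    --> ((y.1.1, y.1.2, - (s *: y.2)) : X) by exact: (cvg_comp _ _ cP (@cf _)).
exact: (cvg_pair (cvg_pair c111 c112) cu).
Qed.

Lemma annulus_compact (rho : R) : compact [set v : 'rV[R]_m | rho <= enorm v /\ enorm v <= 1].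
Proof.
have -> : [set v : 'rV[R]_m | rho <= enorm v /\ enorm v <= 1] =
  [set v : 'rV[R]_m | forall j, `|v 0 j - (0 : 'rV[R]_m) 0 j| <= 1] `&` (@enorm R m @^-1` `[rho, 1]).
  apply/seteqP; split => v /=; rewrite in_itv/=.
    move=> [h1 h2]; rewrite h1 h2; split => // j.
    by rewrite mxE subr0 (le_trans (coord_le_enorm _ _)).
  by move=> [_ /andP].
apply: compact_closedI; first exact: box_compact.
apply: closed_comp; last exact: interval_closed.
by move=> v _; exact: enorm_continuous.
Qed.

Lemma gain_bounded (rho a b : R) (Kp : set 'rV[R]_p) (Kq : set 'rV[R]_q) :
  compact Kp -> compact Kq -> exists M, forall s y, a <= s <= b ->
  (Kp `*` Kq `*` [set v | rho <= enorm v /\ enorm v <= 1]) y -> `|gain s y| <= M.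
Proof.
move=> cKp cKq; pose X := ('rV[R]_p * 'rV[R]_q * 'rV[R]_m)%type.
pose g (ys : X * R) : R := gain ys.2 ys.1.
have cK : compact (Kp `*` Kq `*` [set v : 'rV[R]_m | rho <= enorm v /\ enorm v <= 1] `*` `[a, b]).
  apply: compact_setX; last exact: segment_compact.
  apply: compact_setX; last exact: annulus_compact.
  exact: compact_setX.
have [|M _ HM] := @compact_bounded_fun R _ _ g cK.
  by apply: continuous_subspaceT => ys; case: ys => y s; exact: gain_cvg.
by exists M => s y sab Ky; apply: (HM (y, s)); split => //=; rewrite in_itv.
Qed.

(** Let [s] be a level with [chi s > B], and [V1] a point that [N \o alpha] maps to
[s].  As chi is bounded on bounded sets of levels, [chi s] can be taken so large that
[s] is not attained by [N] on the values of alpha over [0, max(V0, rho^2)], whence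
[V1 > max(V0, rho^2)].  By compactness the gain exceeds [B] also at levels near [s],
that is, on a band above [V1]. *)
Lemma high_gain_level (K : R) (alpha N : R -> R) : high_gain f -> 0 <= K ->
  set_bij `[0, 1[ `[K, +oo[ alpha -> {within `[0, 1[, continuous alpha} ->
  {within `[0, +oo[, continuous N} -> set_surj `[0, +oo[ [set: R] N ->
  forall bd bz B V0 : R, 0 <= bd -> 0 <= bz -> 0 <= V0 < 1 ->
  exists V1 V2, [/\ V0 <= V1, V1 < V2, V2 < 1 & forall (dl : 'rV[R]_p) (zt : 'rV[R]_q) (v : 'rV[R]_m),
    (forall j, `|dl 0 j| <= bd) -> (forall j, `|zt 0 j| <= bz) -> V1 < enorm v ^+ 2 < V2 ->
    dotp v (f (dl, zt, N (alpha (enorm v ^+ 2)) *: v)) <= - B].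
Proof.
move=> [rho [rho0 rho1 Hrho]] K0 abij ca cN sN bd bz B V0 bd0 bz0 /andP[V00 V01].
pose Kp := [set v : 'rV[R]_p | forall j, `|v 0 j - (0 : 'rV[R]_p) 0 j| <= bd].
pose Kq := [set v : 'rV[R]_q | forall j, `|v 0 j - (0 : 'rV[R]_q) 0 j| <= bz].
have cKp : compact Kp by exact: box_compact.
have cKq : compact Kq by exact: box_compact.
have Kp0 : Kp 0 by move=> j; rewrite mxE subrr normr0.
have Kq0 : Kq 0 by move=> j; rewrite mxE subrr normr0.
have supE := Hrho Kp Kq cKp (ex_intro _ _ Kp0) cKq (ex_intro _ _ Kq0).
pose KK := Kp `*` Kq `*` [set v : 'rV[R]_m | rho <= enorm v /\ enorm v <= 1].
have chi_le s y : KK y -> high_gain_chi f rho Kp Kq s <= gain s y.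
  move=> Ky; have [M HM] := gain_bounded rho s s cKp cKq.
  apply: ge_inf.
    exists (- M) => _ [d' [z' [v' [h1 h2 h3 h4 ->]]]].
    have := HM s (d', z', v'); rewrite lexx => /(_ isT) H.
    by have {}H := H (conj (conj h1 h2) (conj h3 h4)); move: H; rewrite ler_norml => /andP[].
  by case: y Ky => [[d' z'] v'] [[h1 h2] [h3 h4]]; exists d', z', v'.
have [v0 hv0] : exists v0 : 'rV[R]_m, enorm v0 = 1.
  exists (delta_mx 0 (Ordinal m0)); rewrite /enorm /dotp (bigD1 (Ordinal m0))//= big1.
    by rewrite !mxE !eqxx mulr1 addr0 sqrtr1.
  by move=> i hi; rewrite !mxE (negbTE hi) andbF mulr0.
have Ky0 : KK (0, 0, v0) by split; [split|rewrite /= hv0 lexx ltW].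
pose Vs := Num.max V0 (rho ^+ 2).
have Vs0 : 0 <= Vs by rewrite /Vs le_max V00.
have Vs1 : Vs < 1 by rewrite /Vs gt_max V01 expr_lt1// ltW.
have cw a b (g : R -> R) (A : set R) : `[a, b] `<=` A -> {within A, continuous g} ->
    exists M, forall t, a <= t <= b -> g t <= M.
  move=> sub cg; have [M _ HM] := segment_bounded (continuous_subspaceW sub cg).
  by exists M => t tab; apply: le_trans (ler_norm _) _; exact: HM.
have [as_ Has] : exists M, forall t, 0 <= t <= Vs -> alpha t <= M.
  apply: (cw _ _ _ _ _ ca) => t; rewrite /= !in_itv/= => /andP[-> /le_lt_trans]; exact.
have sub0 (b : R) : `[0, b] `<=` (`[0, +oo[%classic : set R).
  by move=> t; rewrite /= !in_itv/= => /andP[->].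
have [M1 HM1] := cw _ _ _ _ (sub0 as_) cN.
have cmN : {within `[0, +oo[, continuous (fun t => - N t)} by move=> t; apply: cvgN; exact: cN.
have [M2 HM2] := cw _ _ _ _ (sub0 as_) cmN.
have [M3 HM3] := gain_bounded rho (- M2) M1 cKp cKq.
have [s sB] : exists s, Num.max B M3 < high_gain_chi f rho Kp Kq s.
  have H : ((Num.max B M3)%:E < ereal_sup [set (high_gain_chi f rho Kp Kq s)%:E | s in [set: R]])%E.
    by rewrite supE ltry.
  have [_ [s _ <-]] := ereal_sup_gt H.
  by rewrite lte_fin => H1; exists s.
move: sB; rewrite gt_max => /andP[sB sM3].
have [k k0 kE] : exists2 k, 0 <= k & N k = s.
  have [k hk <-] := sN s I; exists k => //; by move: hk; rewrite /= in_itv/= andbT.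
(* Otherwise s would be a level attained by N on the values of alpha below as_,
where the gain is at most M3. *)
have ask : as_ < k.
  rewrite ltNge; apply/negP => kas.
  have := HM1 k; have := HM2 k; rewrite k0 kas => /(_ isT) h2 /(_ isT) h1.
  have := HM3 s (0, 0, v0); rewrite -kE h1 -lerNl h2 => /(_ isT Ky0) H.
  have := le_trans (ler_norm _) H; rewrite kE leNgt => /negP; apply.
  exact: lt_le_trans sM3 (chi_le s _ Ky0).
have [V1 V1I V1E] : (alpha @` `[0, 1[%classic) k.
  have [_ _ aS] := abij; apply: aS; rewrite /= in_itv/= andbT.
  apply: le_trans (ltW ask); apply: le_trans (Has 0 _); last by rewrite lexx.
  by apply: (alpha_ge abij); rewrite lexx ltr01.
move: V1I; rewrite /= in_itv/= => /andP[V10 V11].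
have VV : Vs < V1.
  rewrite ltNge; apply/negP => V1s; have := Has V1; rewrite V10 V1s V1E => /(_ isT).
  by rewrite leNgt ask.
have nearP : \forall s' \near s, KK `<=` (fun y => B < gain s' y).
  have /compact_near_coveringP nc : compact KK.
    apply: compact_setX; last exact: annulus_compact.
    exact: compact_setX.
  apply: (nc R (nbhs s) (fun s' y => B < gain s' y) (nbhs_filter s)) => y Ky.
  have := @gain_cvg s y; move/cvgr_gt => /(_ B (lt_le_trans sB (chi_le s y Ky))).
  exact.
have nearV : \forall V \near V1, KK `<=` (fun y => B < gain (N (alpha V)) y).
  have V1d : 0 <= V1 < 1 by rewrite V10 V11.
  have Na : N (alpha V1) = s by rewrite V1E.
  move/subspace_continuousP: cN => /(_ (alpha V1)); rewrite /= in_itv/= andbT.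
  rewrite -Na in nearP; move=> /(_ (le_trans K0 (alpha_ge abij V1d))) cN.
  have H1 : \forall u \near alpha V1, `[0, +oo[%classic u -> KK `<=` (fun y => B < gain (N u) y) :=
    cN _ nearP.
  move/subspace_continuousP: ca => /(_ V1); rewrite /= in_itv/= V1d => /(_ isT) ca.
  have H2 : \forall V \near V1, `[0, 1[%classic V -> `[0, +oo[%classic (alpha V) ->
    KK `<=` (fun y => B < gain (N (alpha V)) y) := ca _ H1.
  have V1p : 0 < V1 by exact: le_lt_trans Vs0 VV.
  apply: filterS2 (filterI (lt_nbhsr V1p) (lt_nbhsl V11)) H2 => V [h1 h2] H.
  have V01' : 0 <= V < 1 by rewrite (ltW h1).
  apply: H; first by rewrite /= in_itv.
  by rewrite /= in_itv/= andbT (le_trans K0 (alpha_ge abij V01')).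
have /nbhs_ballP[e /= e0 He] := nearV.
exists V1, (V1 + Num.min (e / 2) ((1 - V1) / 2)).
have em : 0 < Num.min (e / 2) ((1 - V1) / 2) by rewrite lt_min !divr_gt0// subr_gt0.
have em1 : Num.min (e / 2) ((1 - V1) / 2) <= e / 2 by rewrite ge_min lexx.
have em2 : Num.min (e / 2) ((1 - V1) / 2) <= (1 - V1) / 2 by rewrite ge_min lexx orbT.
move: em em1 em2; set mm := Num.min _ _ => em em1 em2.
split.
- by apply: le_trans (ltW VV); rewrite /Vs le_max lexx.
- by rewrite ltrDl.
- by move: em2 V11; lra.
move=> dl zt v hdl hzt /andP[vV1 vV2].
have hb : ball V1 e (enorm v ^+ 2).
  by rewrite /ball/= distrC gtr0_norm ?subr_gt0//; move: vV2 em1 e0; lra.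
have Ky : KK (dl, zt, - v).
  split; [split => j /=|rewrite /= enormN; split].
  - by rewrite mxE subr0.
  - by rewrite mxE subr0.
  - rewrite -(@ler_pXn2r _ 2)// ?nnegrE ?enorm_ge0 ?(ltW rho0)//.
    by apply: le_trans (ltW vV1); apply: le_trans (ltW VV); rewrite /Vs le_max lexx orbT.
  - rewrite -(@ler_pXn2r _ 2)// ?nnegrE ?enorm_ge0// expr1n.
    by apply: ltW; apply: lt_le_trans vV2 _; move: em2 V11; lra.
have := He _ hb _ Ky; rewrite /= scalerN opprK -scaleN1r dotpZl mulN1r.
by rewrite ltrNr => /ltW.
Qed.

End HighGain.

(** * Continuation of solutions *)


Section Continuation.
Context {R : realType}.
Notation mu := (@lebesgue_measure R).

Lemma lipx_glue (a b b' : R) (g : R -> R) : lipx a b g -> lipx b b' g -> lipx a b' g.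
Proof.
move=> /lipx_ge0[L L0 HL] /lipx_ge0[L' L0' HL']; exists (L + L'); apply: liponP => s t as_ st tb.
have st' : 0 <= t - s by rewrite subr_ge0.
have [bs|sb] := leP b s.
  rewrite (le_trans (HL' s t _ _)) ?bs ?(le_trans st)// ?(le_trans bs)//.
  by rewrite ger0_norm// ler_wpM2r// lerDr.
have [tb'|bt] := leP t b.
  rewrite (le_trans (HL s t _ _)) ?as_ ?(ltW sb)// ?(le_trans as_)//.
  by rewrite ger0_norm// ler_wpM2r// lerDl.
have H1 := HL s b; have H2 := HL' b t.
rewrite as_ (ltW sb) (le_trans as_ (ltW sb)) lexx in H1.
rewrite lexx (ltW bt) (le_trans (ltW bt) tb) tb in H2.
have -> : g t - g s = (g t - g b) + (g b - g s) by rewrite addrA subrK.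
rewrite (le_trans (ler_normD _ _))// mulrDl addrC lerD//.
  rewrite (le_trans (H1 isT isT))// ger0_norm ?subr_ge0 ?(ltW sb)// ler_wpM2l// lerB// ltW//.
rewrite (le_trans (H2 isT isT))// ger0_norm ?subr_ge0 ?(ltW bt)// ler_wpM2l// lerB// ltW//.
Qed.

Lemma lipx_abs_continuous m (a b : R) (g : R -> 'rV[R]_m) :
  (forall j, lipx a b (fun t => g t 0 j)) -> abs_continuous a b g.
Proof.
move=> H; have H' j : exists L, 0 <= L /\ lipon a b L (fun t => g t 0 j).
  by have [L L0 HL] := lipx_ge0 (H j); exists L.
have {H H'}[L HL] := choice H'; pose K := \sum_j L j + 1.
have S0 : 0 <= \sum_j L j by apply: sumr_ge0 => j _; case: (HL j).
have K0 : 0 < K by rewrite /K ltr_wpDl.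
move=> e e0; exists (e / K); first exact: divr_gt0.
move=> k lo hi h1 h2; rewrite ltr_pdivlMr// => h3; apply: le_lt_trans h3.
rewrite mulr_suml; apply: ler_sum => i _; have [h4 [h5 h6]] := h1 i (ltn_ord i).
apply: le_trans (enorm_le_sum _) _.
have hl : 0 <= hi i - lo i by rewrite subr_ge0.
apply: (@le_trans _ _ ((\sum_j L j) * (hi i - lo i))); last first.
  by rewrite mulrC; apply: ler_wpM2l => //; rewrite /K lerDl.
rewrite mulr_suml; apply: ler_sum => j _; rewrite !mxE; have [_ Hj] := HL j.
rewrite (le_trans (Hj (lo i) (hi i) _ _)) ?h4 ?h6 ?(le_trans h5)// ?(le_trans h4)//.
by rewrite ger0_norm.
Qed.

(** [g t + M t] is nondecreasing and bounded; its supremum gives the value of the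
extension at [om]. *)
Lemma lip_limit (om M : R) (g : R -> R) : 0 < om -> 0 <= M ->
  (forall b, 0 <= b < om -> lipon 0 b M g) ->
  exists l, lipon 0 om M (fun t => if t < om then g t else l).
Proof.
move=> om0 M0 H.
have L s t : 0 <= s -> s <= t -> t < om -> `|g t - g s| <= M * (t - s).
  move=> s0 st tom; have t0 := le_trans s0 st.
  rewrite (le_trans (H t _ s t _ _)) ?t0 ?s0 ?lexx//.
  by rewrite ger0_norm// subr_ge0.
pose E := [set g t + M * t | t in `[0, om[].
have E0 : E !=set0 by exists (g 0 + M * 0), 0 => //=; rewrite in_itv/= lexx om0.
have ubE t : 0 <= t < om -> ubound E (g t + 2 * M * om - M * t).
  move=> /andP[t0 tom] r [s /=]; rewrite in_itv/= => /andP[s0 som] <-.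
  have Mt : M * t <= M * om by rewrite ler_wpM2l// ltW.
  have Ms : M * s <= M * om by rewrite ler_wpM2l// ltW.
  have [st|ts] := leP s t.
    by have := L s t s0 st tom; rewrite ler_norml => /andP[]; rewrite mulrBr; lra.
  by have := L t s t0 (ltW ts) som; rewrite ler_norml => /andP[]; rewrite mulrBr; lra.
have hsE : has_sup E.
  by split => //; exists (g 0 + 2 * M * om - M * 0); apply: ubE; rewrite lexx om0.
exists (sup E - M * om).
have K t : 0 <= t < om -> `|sup E - M * om - g t| <= M * (om - t).
  move=> ht; have h1 : sup E <= g t + 2 * M * om - M * t by apply: ge_sup => //; exact: ubE.
  have h2 : g t + M * t <= sup E.
    by apply: ub_le_sup; [exact: (proj2 hsE)|exists t => //=; rewrite in_itv].
  by rewrite ler_norml mulrBr; apply/andP; split; lra.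
apply: liponP => s t s0 st tom.
have [t1|t1] := ltP t om; first by rewrite (le_lt_trans st t1) L.
have -> : t = om by apply/eqP; rewrite eq_le tom.
have [s1|s1] := ltP s om; first by apply: K; rewrite s0.
have -> : s = om by apply/eqP; rewrite eq_le s1 (le_trans st tom).
by rewrite !subrr normr0 mulr0.
Qed.

Variables (m n p q : nat) (sigma c T : R).
Variables (alpha N : R -> R) (al : nat -> R -> R).
Local Notation V := 'rV[R]_m.
Hypothesis c0 : 0 < c.
Hypothesis al_derive : forall (l : nat) (s : R), (l < n)%N -> 0 <= s < 1 ->
  is_derive s 1 (al l) (al l.+1 s).
Hypothesis al_cont : forall (l : nat) (s : R), (l <= n)%N -> 0 <= s < 1 ->
  {for s, continuous (al l)}.
Hypothesis al0 : forall s : R, 0 <= s < 1 -> alpha s = al 0%N s.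
Hypothesis al_ge0 : forall s : R, 0 <= s < 1 -> 0 <= alpha s.
Hypothesis hN : {within `[0, +oo[, continuous N}.
Variables (d : R -> 'rV[R]_p) (f : 'rV[R]_p * 'rV[R]_q * V -> V).
Variable (Top : (R -> 'rV[R]_(n.+1 * m)) -> R -> 'rV[R]_q).
Variables yref y0 : nat -> R -> V.
Hypotheses (sigma0 : 0 <= sigma) (hTop : op_class sigma Top) (hd : Linf `[0, +oo[ d).
Hypothesis cf : continuous f.
Hypothesis cyref : forall i, (i <= n)%N -> {within `[0, T[, continuous (yref i)}.

Local Notation sol := (is_solution sigma d f Top y0 alpha N c T yref).
Local Notation fb x := (feedback n.+1 alpha N c T yref x).
Local Notation z x t := (ee c T alpha t (fun i => x i t - yref i t)).

Lemma z_ext (x x' : nat -> R -> V) t k : (forall i, (i <= k)%N -> x i t = x' i t) -> z x t k = z x' t k.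
Proof. by move=> H; apply: ee_ext => i ik; rewrite H. Qed.

Lemma fb_ext (x x' : nat -> R -> V) t : (forall i, (i <= n)%N -> x i t = x' i t) -> fb x t = fb x' t.
Proof.
move=> H; have E : z x t n = z x' t n by exact: z_ext.
by rewrite /feedback; change (N (alpha (enorm (z x t n) ^+ 2)) *: z x t n =
  N (alpha (enorm (z x' t n) ^+ 2)) *: z x' t n); rewrite E.
Qed.

Lemma ae_neq (a : R) : {ae mu, forall t, t <> a}.
Proof.
exists [set a]; split => //; first exact: lebesgue_measure_set1.
by move=> t /= /contrapT.
Qed.

(** [xi] is continued by [extend].  Causality identifies the memory term of the
resulting path with that of [xi] before [om], and with that of the path without
stopping after [om]. *)
Lemma continue_solution (om : R) (xi : nat -> R -> V) : 0 <= om < T ->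
  (forall i t, (i <= n)%N -> - sigma <= t <= 0 -> xi i t = y0 i t) ->
  (forall i, (i <= n)%N -> {within `[- sigma, om], continuous (xi i)}) ->
  (forall i j, (i <= n)%N -> lipx 0 om (fun t => xi i t 0 j)) ->
  (forall k t, (k <= n)%N -> 0 <= t <= om -> enorm (z xi t k) < 1) ->
  (forall b, 0 < b < om -> {ae mu, forall t : R, 0 <= t < b ->
     (forall i, (i.+1 < n.+1)%N -> is_derive t 1 (xi i) (xi i.+1 t)) /\
     is_derive t 1 (xi n) (f (d t, Top (fun s => stack n.+1 xi (Num.min s b)) t, fb xi t))}) ->
  exists om' x, [/\ om < om', sol om' x &
    forall i t, (i <= n)%N -> - sigma <= t <= om -> x i t = xi i t].
Proof.
move=> /andP[om0 omT] xy cxi lxi zxi dxi.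
have [_ _ causal _] := hTop.
have omI : 0 <= om <= om by rewrite om0 lexx.
have om0T : 0 <= om < T by rewrite om0.
have [h [x [[h0 hT] xE xc xz xd]]] := extend c0 al_derive al_cont al0 al_ge0 hN sigma0 hTop hd cf cyref
  om0T cxi (fun k kn => zxi k om kn omI).
have sx0 t : 0 <= t -> - sigma <= t by move=> t0; rewrite (le_trans _ t0)// oppr_le0.
have xE' i t : (i <= n)%N -> 0 <= t <= om -> x i t = xi i t.
  by move=> ni /andP[t0 tom]; apply: xE => //; rewrite sx0.
have cst (y : nat -> R -> V) b : - sigma <= b -> (forall i, (i <= n)%N -> {within `[- sigma, b], continuous (y i)}) ->
    {within `[- sigma, +oo[, continuous (fun s => stack n.+1 y (Num.min s b))}.
  move=> sb cy.
  apply: (subspace_eq_continuous (f := fun s => stack n.+1 y (clampr (- sigma) b s))).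
    move=> s; rewrite inE/= in_itv/= andbT => ss; congr (stack _ _ _).
    by rewrite /clampr minC max_r// le_min sb ss.
  apply: continuous_subspaceT; apply: rV_continuous => k; case/mxvec_indexP: k => i j.
  under eq_fun do rewrite stack_coord.
  apply: coord_cont; apply: within_clamp_continuous => //.
  by apply: cy; rewrite -ltnS.
exists (om + h), x; split; first by rewrite ltrDl.
  split.
  - by rewrite ltr_wpDl//= ltW.
  - move=> i t ni /andP[st t0]; rewrite xE//; last by rewrite st (le_trans t0).
    by apply: xy => //; rewrite st.
  - move=> i b ni bh; apply: lipx_abs_continuous => j.
    apply: (@lipx_sub _ 0 (om + h)) => //; first exact: ltW.
    apply: (@lipx_glue 0 om); last by have [_] := xc i.
    by apply: lipx_eq (lxi i j ni) => t ht; rewrite xE'.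
  - move=> [//|k] t /= kn /andP[t0 th]; change (enorm (z x t k) < 1).
    have [tom|tom] := leP t om.
      rewrite (z_ext (x' := xi)) ?zxi ?t0// => i ik.
      by apply: xE'; [exact: (leq_trans ik kn)|rewrite t0].
    by apply: xz => //; rewrite !ltW.
  move=> tau /andP[tau0 tauh].
  have cX : {within `[- sigma, +oo[, continuous (stack n.+1 x)}.
    apply: continuous_subspaceT; apply: rV_continuous => k; case/mxvec_indexP: k => i j.
    under eq_fun do rewrite stack_coord.
    by apply: coord_cont; case: (xc i).
  have cXt : {within `[- sigma, +oo[, continuous (fun s => stack n.+1 x (Num.min s tau))}.
    apply: cst => [|i ni]; first by rewrite sx0// ltW.
    by apply: continuous_subspaceT; case: (xc i).
  have h1 : {ae mu, forall t : R, 0 < t < Num.min om tau ->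
      (forall i, (i.+1 < n.+1)%N -> is_derive t 1 (x i) (x i.+1 t)) /\
      is_derive t 1 (x n) (f (d t, Top (fun s => stack n.+1 x (Num.min s tau)) t, fb x t))}.
    apply: ae_exhaust => b; rewrite lt_min => /andP[bom btau].
    have [b0|b0] := leP b 0.
      by apply: aeW => t /andP[t0 tb]; have := lt_le_trans (lt_trans t0 tb) b0; rewrite ltxx.
    have hb : 0 < b < om by rewrite b0.
    have cXb : {within `[- sigma, +oo[, continuous (fun s => stack n.+1 xi (Num.min s b))}.
      apply: cst => [|i ni]; first by rewrite sx0// ltW.
      apply: continuous_subspaceW (cxi i ni) => s; rewrite /= !in_itv/= => /andP[-> sb].
      by rewrite (le_trans sb) ?ltW.
    have agree s : - sigma <= s < b -> stack n.+1 xi (Num.min s b) = stack n.+1 x (Num.min s tau).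
      move=> /andP[ss sb]; rewrite !min_l ?(ltW sb) ?(ltW (lt_trans sb btau))//.
      apply/rowP => k; case/mxvec_indexP: k => i j; rewrite !stack_coord xE//.
        by rewrite -ltnS.
      by rewrite ss ltW// (lt_trans sb).
    have C := causal b _ _ (ltW b0) cXb cXt agree.
    apply: aeS2 C (dxi b hb) => t C D /andP[t0 tb].
    have {}D := D (ltac:(by rewrite ltW)); have {}C := C (ltac:(by rewrite ltW)).
    have tom := lt_trans tb bom.
    have ne : \forall s \near t, forall i, (i <= n)%N -> x i s = xi i s.
      apply: filterS (filterI (lt_nbhsr t0) (lt_nbhsl tom)) => s [s0 s1] i ni.
      by apply: xE' => //; rewrite !ltW.
    have te i : (i <= n)%N -> x i t = xi i t by move=> ni; apply: (nbhs_singleton ne).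
    have [D1 D2] := D; split.
      move=> i ii; apply: (@near_eq_is_derive _ _ _ (xi i)).
        by apply: filterS ne => s Hs; rewrite (Hs i (ltnW ii)).
      by rewrite te//; exact: D1.
    apply: (@near_eq_is_derive _ _ _ (xi n)); first by apply: filterS ne => s Hs; rewrite Hs.
    by rewrite -C (fb_ext te).
  have C2 := causal tau _ _ (ltW tau0) cX cXt _.
  have {}C2 := C2 (ltac:(by move=> s /andP[_ st]; rewrite min_l// ltW)).
  apply: aeS2 (aeI (ae_neq 0) (ae_neq om)) (aeI h1 (aeI C2 xd)) => t [nt0 ntom] [H1 [H2 H3]] /andP[t0 tt].
  have t0' : 0 < t by rewrite lt_neqAle eq_sym t0 andbT; apply/eqP.
  have [tom|tom] := ltP t om; first by apply: H1; rewrite t0' lt_min tom.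
  have tom' : om < t by rewrite lt_neqAle tom andbT eq_sym; apply/eqP.
  rewrite -H2 ?t0//; apply: H3; rewrite tom'/=; exact: lt_trans tt tauh.
by move=> i t ni ht; exact: xE.
Qed.

End Continuation.

(** * Lipschitz functions in the spaces of bounded functions *)


Section FunctionSpaces.
Context {R : realType}.
Notation mu := (@lebesgue_measure R).

Lemma lip_within m (a b : R) (g : R -> 'rV[R]_m) :
  (forall j, lipx a b (fun t => g t 0 j)) -> {within `[a, b], continuous g}.
Proof.
move=> H; apply/subspace_continuousP => t tab; apply: rV_cvgP => j.
have [L HL] := H j; have := lipon_cont HL; move/subspace_continuousP; exact.
Qed.

Lemma within_coord m (A : set R) (g : R -> 'rV[R]_m) j :
  {within A, continuous g} -> {within A, continuous (fun t => g t 0 j)}.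
Proof. by move=> cg t; have := cg t; move=> /(rV_cvg_coord _ (j := j)). Qed.

Lemma within_itvco (T : topologicalType) (a b : R) (g : R -> T) :
  (forall t, a <= t < b -> {within `[a, t], continuous g}) -> {within `[a, b[, continuous g}.
Proof.
move=> H; apply/subspace_continuousP => t; rewrite /= in_itv/= => /andP[at_ tb].
have t1 : t < (t + b) / 2 by lra.
have t2 : (t + b) / 2 < b by lra.
have := H ((t + b) / 2); rewrite (le_trans at_ (ltW t1)) t2 => /(_ isT).
move/subspace_continuousP => /(_ t); rewrite /= in_itv/= at_ (ltW t1) => /(_ isT) C A /C H1.
have H2 : \forall u \near t, `[a, (t + b) / 2]%classic u -> A (g u) := H1.
have : \forall u \near t, `[a, b[%classic u -> A (g u).
  apply: filterS2 H2 (lt_nbhsl t1) => u h1 h2; rewrite /= in_itv/= => /andP[h3 h4].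
  by apply: h1; rewrite /= in_itv/= h3 ltW.
exact.
Qed.

Lemma within_cvg_left (T : topologicalType) (a b : R) (g : R -> T) : a < b ->
  {within `[a, b], continuous g} -> g t @[t --> b^'-] --> g b.
Proof.
move=> ab /subspace_continuousP /(_ b); rewrite /= in_itv/= lexx (ltW ab) => /(_ isT) C A /C H.
have H1 : \forall u \near b, `[a, b]%classic u -> A (g u) := H.
change (\forall u \near b, u < b -> A (g u)).
apply: filterS2 H1 (lt_nbhsr ab) => u h1 h2 h3; apply: h1.
by rewrite /= in_itv/= !ltW.
Qed.

Lemma near_left (a b : R) : a < b -> \forall t \near b^'-, a < t < b.
Proof.
move=> ab; change (\forall u \near b, u < b -> a < u < b).
by apply: filterS (lt_nbhsr ab) => u -> ->.
Qed.

Lemma Linf_cont m (a b : R) (A : set R) (g : R -> 'rV[R]_m) : A `<=` `[a, b] -> measurable A ->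
  {within `[a, b], continuous g} -> Linf A g.
Proof.
move=> Aab mA cg; split.
  exists g; split; last by apply: aeW.
  move=> j; apply: (measurable_funS (measurable_itv _) Aab).
  by apply: subspace_continuous_measurable_fun => //; exact: within_coord.
have [C _ HC] := compact_enorm_bound cg; exists C; apply: aeW => t /Aab.
by rewrite /= in_itv/=; exact: HC.
Qed.

Lemma Linf_derive m (a b : R) (A : set R) (g k : R -> 'rV[R]_m) : a <= b -> A `<=` `[a, b] -> measurable A ->
  (forall j, lipx a b (fun t => g t 0 j)) ->
  {ae mu, forall t : R, a < t < b -> is_derive t 1 g (k t)} -> Linf A k.
Proof.
move=> ab Aab mA lg dg.
have Hj j : exists Lk : R * (R -> R), [/\ measurable_fun setT Lk.2, forall t, `|Lk.2 t| <= Lk.1 &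
    {ae mu, forall t, a < t < b -> k t 0 j = Lk.2 t}].
  have [L HL] := lg j.
  have dj : {ae mu, forall t : R, a < t < b -> is_derive t 1 (fun t => g t 0 j) (k t 0 j)}.
    by apply: aeS dg => t H tab; apply: is_derive_coord; exact: H.
  by have [_ [k' [h1 h2 h3]]] := lip_ftc ab HL dj; exists (`|L|, k').
have {Hj}[Lk HLk] := choice Hj.
have kE : {ae mu, forall t, A t -> k t = \row_j (Lk j).2 t}.
  have : {ae mu, forall t, forall j, a < t < b -> k t 0 j = (Lk j).2 t}.
    by apply: ae_ord => j; case: (HLk j).
  apply: aeS2 (aeI (ae_neq a) (ae_neq b)) => t [ta tb] H /Aab; rewrite /= in_itv/= => /andP[h1 h2].
  apply/rowP => j; rewrite mxE; apply: H; rewrite !lt_neqAle h1 h2 !andbT.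
  by apply/andP; split; apply/eqP => E; [apply: ta|apply: tb].
split.
  exists (fun t => \row_j (Lk j).2 t); split => // j.
  under eq_fun do rewrite mxE.
  by apply: measurable_funTS; case: (HLk j).
exists (\sum_j (Lk j).1); apply: aeS kE => t H At; rewrite H//.
apply: le_trans (enorm_le_sum _) _; apply: ler_sum => j _; rewrite mxE.
by case: (HLk j).
Qed.

Lemma winf_of_lip m (k : nat) (a b : R) (A : set R) (G : nat -> R -> 'rV[R]_m) :
  a <= b -> A `<=` `[a, b] -> measurable A ->
  (forall i j, (i < k)%N -> lipx a b (fun t => G i t 0 j)) ->
  (forall i, (i < k)%N -> {ae mu, forall t : R, a < t < b -> is_derive t 1 (G i) (G i.+1 t)}) ->
  Linf A (G k) -> Winf_jet k A G.
Proof.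
move=> ab Aab mA lG dG LG.
have cG i : (i < k)%N -> {within `[a, b], continuous (G i)}.
  by move=> ik; apply: lip_within => j; exact: lG.
split.
- by move=> i ik; apply: continuous_subspaceW (cG i ik).
- move=> i; rewrite leq_eqVlt => /predU1P[->//|ik].
  exact: Linf_cont Aab mA (cG i ik).
- move=> i ik psi tpsi j; apply: (lip_sweak ab Aab (lG i j ik)) => //.
  by apply: aeS (dG i ik) => t H tab; apply: is_derive_coord; exact: H.
Qed.

Lemma ae_dense (P : R -> Prop) (s t : R) : {ae mu, forall u, P u} -> s < t ->
  exists u, s < u < t /\ P u.
Proof.
move=> [N [mN N0 PN]] st; apply: contrapT => H.
have sub : `]s, t[%classic `<=` N.
  move=> u; rewrite /= in_itv/= => su; apply: PN => Pu; apply: H; by exists u.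
have : (mu `]s, t[%classic <= mu N)%E by apply: le_measure => //; rewrite inE.
by rewrite N0 lebesgue_measure_itv/= lte_fin st -EFinB lee_fin leNgt subr_gt0 st.
Qed.

Lemma cont_ae_eq (a b : R) (g h : R -> R) : a < b -> {within `[a, b], continuous g} ->
  {within `[a, b], continuous h} -> {ae mu, forall t, a < t < b -> g t = h t} ->
  forall t, a <= t <= b -> g t = h t.
Proof.
move=> ab cg ch gh t tab; apply/eqP; rewrite -subr_eq0 -normr_le0; apply/ler_addgt0Pl => e e0.
rewrite addr0.
have cw : {within `[a, b], continuous (fun t => g t - h t)}.
  by move=> s; apply: cvgB; [exact: cg|exact: ch].
move/subspace_continuousP: cw => /(_ t); rewrite /= in_itv/= tab => /(_ isT).
move=> /cvgrPdist_lt /(_ e e0) H.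
have H1 : \forall u \near t, `[a, b]%classic u -> `|(g t - h t) - (g u - h u)| < e := H.
move/nbhs_ballP: H1 => [dl /= dl0 Hd].
have /andP[at_ tb] := tab.
have [|u [/andP[u1 u2] Hu]] := ae_dense gh (s := Num.max a (t - dl)) (t := Num.min b (t + dl)).
  by rewrite gt_max !lt_min; apply/andP; split; apply/andP; split; lra.
move: u1 u2; rewrite gt_max lt_min => /andP[u1 u2] /andP[u3 u4].
have B : ball t dl u by rewrite /ball/= ltr_norml; apply/andP; split; lra.
have := Hd u B; rewrite /= in_itv/= (ltW u1) (ltW u3) => /(_ isT).
by rewrite (Hu (ltac:(by rewrite u1 u3))) subrr subr0 => /ltW.
Qed.

(** One-sided difference quotients at an interior point are two-sided. *)
Lemma Ck_jet_derive m (k : nat) (a b : R) (G : nat -> R -> 'rV[R]_m) i (t : R) :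
  Ck_jet k `[a, b] G -> (i < k)%N -> a < t < b -> is_derive t 1 (G i) (G i.+1 t).
Proof.
move=> [_ dG] ik /andP[at_ tb].
have C : (fun h => h^-1 *: (G i (h *: 1 + t) - G i t)) @ 0^' --> G i.+1 t.
  move=> A LA; have := dG i ik t; rewrite /= in_itv/= (ltW at_) (ltW tb) => /(_ isT A LA) H.
  have H1 : \forall u \near t, u != t -> `[a, b]%classic u -> A ((u - t)^-1 *: (G i u - G i t)) := H.
  have ch : (fun h : R => h *: 1 + t) @ (0 : R) --> t.
    rewrite -[X in _ --> X]add0r -[X in _ --> X + _](scale0r (1 : R)).
    by apply: cvgD; [apply: cvgZr_tmp|exact: cvg_cst].
  have H2 : \forall h \near (0 : R), h *: 1 + t != t -> `[a, b]%classic (h *: 1 + t) ->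
     A ((h *: 1 + t - t)^-1 *: (G i (h *: 1 + t) - G i t)) := ch _ H1.
  have n1 : \forall h \near (0 : R), h *: 1 + t < b := ch _ (lt_nbhsl tb).
  have n0 : \forall h \near (0 : R), a < h *: 1 + t := ch _ (lt_nbhsr at_).
  rewrite /dnbhs; change (\forall h \near (0 : R), h != 0 -> A (h^-1 *: (G i (h *: 1 + t) - G i t))).
  apply: filterS2 H2 (filterI n1 n0) => h {}H2 [{}n1 {}n0] hn0.
  move: H2; rewrite /= in_itv/= (ltW n1) (ltW n0) addrK /GRing.scale/= mulr1.
  by rewrite -subr_eq0 addrK => /(_ hn0 isT).
by split; [apply/cvg_ex; exists (G i.+1 t); exact: C|apply/cvg_lim => //; exact: C].
Qed.

End FunctionSpaces.

(** * Solutions of the closed loop *)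


Section Solution.
Context {R : realType}.
Notation mu := (@lebesgue_measure R).

Lemma abs_continuous_cont m (a b : R) (g : R -> 'rV[R]_m) : abs_continuous a b g ->
  {within `[a, b], continuous g}.
Proof.
move=> H; apply/subspace_continuousP => t /=; rewrite in_itv/= => tab.
apply: rV_cvgP => j; apply/cvgrPdist_lt => e e0.
have [dl dl0 Hd] := H e e0.
have H1 s u : a <= s <= b -> a <= u <= b -> s <= u -> u - s < dl -> enorm (g u - g s) < e.
  move=> /andP[s1 s2] /andP[u1 u2] su usd; have := Hd 1%N (fun=> s) (fun=> u).
  rewrite !big_ord1; apply => //.
have n1 : \forall s \near t, `|t - s| < dl.
  by apply/nbhs_ballP; exists dl => // s; rewrite /ball.
suff : \forall s \near t, `[a, b]%classic s -> `|g t 0 j - g s 0 j| < e by [].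
apply: filterS n1 => s ts; rewrite /= in_itv/= => sab.
have -> : g t 0 j - g s 0 j = (g t - g s) 0 j by rewrite !mxE.
apply: le_lt_trans (coord_le_enorm _ _) _.
have [st|st] := leP s t.
  by apply: H1 => //; apply: le_lt_trans ts; exact: ler_norm.
rewrite -enormN opprB; apply: H1 => //; first exact: ltW.
by apply: le_lt_trans ts; rewrite distrC; exact: ler_norm.
Qed.

Lemma abs_continuous_coord m (a b : R) (g : R -> 'rV[R]_m) j : abs_continuous a b g ->
  acs a b (fun t => g t 0 j).
Proof.
move=> H e /H[dl dl0 Hd]; exists dl => // k lo hi h1 h2 h3.
apply: le_lt_trans (Hd k lo hi h1 h2 h3); apply: ler_sum => i _.
have -> : g (hi i) 0 j - g (lo i) 0 j = (g (hi i) - g (lo i)) 0 j by rewrite !mxE.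
exact: coord_le_enorm.
Qed.

Lemma cont_box_bounded p q m (f : 'rV[R]_p * 'rV[R]_q * 'rV[R]_m -> 'rV[R]_m) (bd bz bu : R) :
  continuous f -> exists2 M, 0 <= M & forall (dl : 'rV[R]_p) (zt : 'rV[R]_q) (u : 'rV[R]_m), (forall j, `|dl 0 j| <= bd) ->
  (forall j, `|zt 0 j| <= bz) -> (forall j, `|u 0 j| <= bu) -> enorm (f (dl, zt, u)) <= M.
Proof.
move=> cf; pose K := [set v : 'rV[R]_p | forall j, `|v 0 j - (0 : 'rV[R]_p) 0 j| <= bd] `*`
  [set v : 'rV[R]_q | forall j, `|v 0 j - (0 : 'rV[R]_q) 0 j| <= bz] `*`
  [set v : 'rV[R]_m | forall j, `|v 0 j - (0 : 'rV[R]_m) 0 j| <= bu].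
have cK : compact K.
  by apply: compact_setX; [apply: compact_setX|]; exact: box_compact.
have [|M M0 HM] := @compact_bounded_fun R _ K (fun y => enorm (f y)) cK.
  apply: continuous_subspaceT => y.
  by apply: (@continuous_comp _ _ _ f (@enorm R m)); [exact: cf|exact: enorm_continuous].
exists M => // dl zt u h1 h2 h3; rewrite -[leLHS]ger0_norm ?enorm_ge0//; apply: HM.
by split; [split|] => j; rewrite /= mxE subr0.
Qed.

Variables (m n p q : nat) (sigma c T : R).
Variables (alpha N : R -> R) (al : nat -> R -> R).
Local Notation V := 'rV[R]_m.
Hypothesis c0 : 0 < c.
Hypothesis al_derive : forall (l : nat) (s : R), (l < n)%N -> 0 <= s < 1 ->
  is_derive s 1 (al l) (al l.+1 s).
Hypothesis al_cont : forall (l : nat) (s : R), (l <= n)%N -> 0 <= s < 1 ->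
  {for s, continuous (al l)}.
Hypothesis al0 : forall s : R, 0 <= s < 1 -> alpha s = al 0%N s.
Hypothesis al_ge : forall s : R, 0 <= s < 1 -> c * n.+2%:R <= al 0%N s.
Hypothesis al_large : forall K : R, exists2 s0 : R, 0 <= s0 < 1 &
  forall s, s0 <= s < 1 -> K <= al 0%N s.
Hypothesis abij : set_bij `[0, 1[ `[c * n.+2%:R, +oo[ alpha.
Hypothesis calpha : {within `[0, 1[, continuous alpha}.
Hypothesis hN : {within `[0, +oo[, continuous N}.
Hypothesis hNs : set_surj `[0, +oo[ [set: R] N.
Variables (d : R -> 'rV[R]_p) (f : 'rV[R]_p * 'rV[R]_q * V -> V).
Variable (Top : (R -> 'rV[R]_(n.+1 * m)) -> R -> 'rV[R]_q).
Variables yref y0 : nat -> R -> V.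
Hypotheses (m0 : (0 < m)%N) (sigma0 : 0 <= sigma) (hTop : op_class sigma Top) (hd : Linf `[0, +oo[ d).
Hypotheses (cf : continuous f) (hgf : high_gain f).
Hypothesis cyref : forall i, (i <= n)%N -> {within `[0, T[, continuous (yref i)}.
Variable My : R.
Hypothesis My0 : 0 <= My.
Hypothesis yref_lip : forall i b j, (i <= n)%N -> 0 <= b < T -> lipon 0 b My (fun t => yref i t 0 j).
Hypothesis yref_bd : forall i t j, (i <= n)%N -> 0 <= t < T -> `|yref i t 0 j| <= My.
Hypothesis yref_derive : {ae mu, forall t, 0 < t < T -> forall i j, (i <= n)%N ->
       is_derive t 1 (fun t : R => yref i t 0 j) (yref i.+1 t 0 j)}.
Hypothesis yref_last : {ae mu, forall t, 0 <= t < T -> forall j, `|yref n.+1 t 0 j| <= My}.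
Hypothesis cy0 : forall i, (i <= n)%N -> {within `[- sigma, 0], continuous (y0 i)}.

Lemma al_ge0 s : 0 <= s < 1 -> 0 <= alpha s.
Proof. by move=> s01; apply: le_trans (alpha_ge abij s01); rewrite mulr_ge0// ltW. Qed.

Local Notation sol := (is_solution sigma d f Top y0 alpha N c T yref).
Local Notation fb x := (feedback n.+1 alpha N c T yref x).
Local Notation z x t := (ee c T alpha t (fun i => x i t - yref i t)).

Variables (om : R) (x : nat -> R -> V).
Hypothesis xsol : sol om x.

Lemma om0 : 0 < om. Proof. by case: xsol => /andP[]. Qed.
Lemma omT : om <= T. Proof. by case: xsol => /andP[]. Qed.

Lemma z_lt1 k t : (k <= n)%N -> 0 <= t < om -> enorm (z x t k) < 1.
Proof. by move=> kn tom; case: xsol => _ _ _ H _; exact: (H k.+1 t). Qed.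

Lemma sol_cont i b : (i <= n)%N -> 0 <= b < om -> {within `[- sigma, b], continuous (x i)}.
Proof.
move=> ni /andP[b0 bom]; have [_ xy xac _ _] := xsol.
apply: (within_itv_glue _ b0); first by rewrite oppr_le0.
  apply: (subspace_eq_continuous (f := y0 i)); last exact: cy0.
  by move=> t; rewrite inE/= in_itv/= => ht; exact: esym (xy i t ni ht).
exact: abs_continuous_cont (xac i b ni bom).
Qed.

Lemma stack_cont tau : 0 <= tau < om ->
  {within `[- sigma, +oo[, continuous (fun s => stack n.+1 x (Num.min s tau))}.
Proof.
move=> ht; have /andP[t0 _] := ht.
have st : - sigma <= tau by rewrite (le_trans _ t0)// oppr_le0.
apply: (subspace_eq_continuous (f := fun s => stack n.+1 x (clampr (- sigma) tau s))).
  move=> s; rewrite inE/= in_itv/= andbT => ss; congr (stack _ _ _).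
  by rewrite /clampr minC max_r// le_min st ss.
apply: continuous_subspaceT; apply: rV_continuous => k; case/mxvec_indexP: k => i j.
under eq_fun do rewrite stack_coord.
apply: coord_cont; apply: within_clamp_continuous => //.
by apply: sol_cont => //; rewrite -ltnS.
Qed.

Lemma fb_cont b : 0 <= b < om -> {within `[0, b], continuous (fb x)}.
Proof.
move=> /andP[b0 bom]; apply/subspace_continuousP => t /=; rewrite in_itv/= => tb.
have /andP[t0 tb'] := tb; have tom := le_lt_trans tb' bom; have tT := lt_le_trans tom omT.
apply: (@FB_cvg R m n c T alpha N al c0 al_derive al_cont al0 al_ge0 hN R (within `[0, b] (nbhs t)) _ id t (fun s i => x i s - yref i s)).
- by rewrite lt_eqF.
- exact: cvg_within.
- move=> i ni; apply: cvgB.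
    have bom' : 0 <= b < om by rewrite b0.
    have H : {within `[0, b], continuous (x i)}.
      apply: continuous_subspaceW (sol_cont ni bom') => s; rewrite /= !in_itv/= => /andP[s0 ->].
      by rewrite andbT (le_trans _ s0)// oppr_le0.
    by move/subspace_continuousP: H; apply; rewrite /= in_itv.
  have H : {within `[0, b], continuous (yref i)}.
    apply: continuous_subspaceW (cyref ni) => s; rewrite /= !in_itv/= => /andP[-> sb].
    by rewrite (le_lt_trans sb)// (lt_le_trans bom omT).
  by move/subspace_continuousP: H; apply; rewrite /= in_itv.
- by move=> i ni; apply: z_lt1 => //; rewrite t0.
Qed.

(** The constants [bd] and [bz] only depend on the bound [Bx] for the trajectory. *)
Lemma sol_rep Bx : exists bd bz, [/\ 0 <= bd, 0 <= bz & forall b, 0 <= b < om ->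
  (forall i t, (i <= n)%N -> 0 <= t <= b -> enorm (x i t) <= Bx) ->
  {ae mu, forall t : R, 0 < t < b ->
    (forall i, (i < n)%N -> is_derive t 1 (x i) (x i.+1 t)) /\
    exists (dl : 'rV[R]_p) (zt : 'rV[R]_q), [/\ forall j, `|dl 0 j| <= bd, forall j, `|zt 0 j| <= bz
      & is_derive t 1 (x n) (f (dl, zt, fb x t))]}].
Proof.
have [_ Tbd _ _] := hTop; have [_ [bd dbd]] := hd; have [_ xy _ _ xd] := xsol.
have [Cy Cy0 HCy] : exists2 C, 0 <= C & forall i t, (i <= n)%N -> - sigma <= t <= 0 -> enorm (y0 i t) <= C.
  apply: uniform_bound_nat => i ni.
  by have [C _ HC] := compact_enorm_bound (cy0 ni); exists C.
pose c1 := (n.+1 * m)%:R * (Cy + `|Bx|) + 1.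
have c10 : 0 < c1 by rewrite /c1 ltr_wpDl// mulr_ge0// addr_ge0.
have [c2 c20 Hc2] := Tbd c1 c10.
exists `|bd|, c2; split; [by []|exact: ltW|].
move=> b hb xB; have /andP[b0 bom] := hb.
move: b0; rewrite le_eqVlt => /predU1P[b0|b0].
  by apply: aeW => t; rewrite -b0 => /andP[t0 /(lt_trans t0)]; rewrite ltxx.
have tb : 0 < b < om by rewrite b0.
apply: aeS2 (xd b tb) dbd => t H Hdt /andP[t0 tb'].
have {H}[H1 H2] := H (ltac:(by rewrite ltW)).
split; first by move=> i ni; apply: H1.
exists (d t), (Top (fun s => stack n.+1 x (Num.min s b)) t); split.
- move=> j; rewrite (le_trans (coord_le_enorm _ _))// (le_trans (Hdt _)) ?ler_norm//=.
  by rewrite in_itv/= ltW.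
- move=> j; rewrite (le_trans (coord_le_enorm _ _))//; apply: Hc2; last exact: ltW.
    exact: stack_cont.
  move=> s ss; apply: (@le_trans _ _ ((n.+1 * m)%:R * (Cy + `|Bx|))); last by rewrite lerDl.
  apply: enorm_le_bound; first by rewrite addr_ge0.
  move=> k; case/mxvec_indexP: k => i k; rewrite stack_coord.
  rewrite (le_trans (coord_le_enorm _ _))//; have ni : (i <= n)%N by rewrite -ltnS.
  have [s0|s0] := leP s 0.
    rewrite (min_idPl (le_trans s0 (ltW b0))) xy ?ss// (le_trans (HCy _ _ _ _)) ?ss ?lerDl//.
  rewrite (le_trans (xB i _ ni _))//.
    by rewrite le_min (ltW s0) (ltW b0)/= ge_min lexx orbT.
  by rewrite (le_trans (ler_norm _))// lerDr.
- exact: H2.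
Qed.

Lemma sol_lip Bx Bu : exists2 M, 0 <= M & forall b, 0 <= b < om ->
  (forall i t, (i <= n)%N -> 0 <= t <= b -> enorm (x i t) <= Bx) ->
  (forall t, 0 <= t <= b -> enorm (fb x t) <= Bu) ->
  (forall i j, (i <= n)%N -> lipon 0 b M (fun t => x i t 0 j)) /\
  {ae mu, forall t : R, 0 < t < b ->
    exists2 F, is_derive t 1 (x n) F & enorm F <= M}.
Proof.
have [bd [bz [bd0 bz0 rep]]] := sol_rep Bx.
have [M M0 HM] := cont_box_bounded bd bz Bu cf.
exists (Num.max Bx M); first by rewrite le_max M0 orbT.
have [_ _ xac _ _] := xsol.
move=> b hb xB uB; have /andP[b0 bom] := hb.
have HF : {ae mu, forall t : R, 0 < t < b ->
    (forall i, (i < n)%N -> is_derive t 1 (x i) (x i.+1 t)) /\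
    exists2 F, is_derive t 1 (x n) F & enorm F <= Num.max Bx M}.
  apply: aeS (rep b hb xB) => t H tb; have [H1 [dl [zt [h1 h2 h3]]]] := H tb.
  split=> //; exists (f (dl, zt, fb x t)) => //.
  rewrite le_max; apply/orP; right; apply: HM => // j.
  by rewrite (le_trans (coord_le_enorm _ _))// uB//; case/andP: tb => /ltW -> /ltW ->.
split; last by apply: aeS HF => t H /H[].
move=> i j ni; apply: acs_lipon; first exact: abs_continuous_coord (xac i b ni bom).
apply: aeS HF => t H tb; have [H1 [F H2 H3]] := H tb.
move: ni; rewrite leq_eqVlt => /predU1P[->|ni].
  exists (F 0 j); first exact: is_derive_coord H2.
  exact: le_trans (coord_le_enorm _ _) H3.
exists (x i.+1 t 0 j); first exact: is_derive_coord (H1 i ni).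
rewrite (le_trans (coord_le_enorm _ _))// le_max xB//.
by case/andP: tb => /ltW -> /ltW ->.
Qed.

(** The derivatives of the tracking error; the last one is the derivative of [x n],
which exists almost everywhere. *)
Definition es (t : R) (i : nat) : V :=
  (if (i <= n)%N then x i t else derive1 (x n) t) - yref i t.

Lemma ee_es t k : (k <= n)%N -> ee c T alpha t (es t) k = z x t k.
Proof. by move=> kn; apply: ee_ext => i ik; rewrite /es (leq_trans ik). Qed.

Lemma es_lip b : 0 <= b < om -> forall i j, (i <= n)%N -> lipx 0 b (fun t => es t i 0 j).
Proof.
move=> hb i j ni; have /andP[b0 bom] := hb.
have [Bu Bu0 HBu] := compact_enorm_bound (fb_cont hb).
have [Bx _ HBx] : exists2 Bx, 0 <= Bx & forall i t, (i <= n)%N -> 0 <= t <= b -> enorm (x i t) <= Bx.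
  have [_ _ xac _ _] := xsol; apply: uniform_bound_nat => i' ni'.
  by have [C _ HC] := compact_enorm_bound (abs_continuous_cont (xac i' b ni' bom)); exists C.
have [M M0 HM] := sol_lip Bx Bu; have [H _] := HM b hb HBx HBu.
have E : forall t, 0 <= t <= b -> x i t 0 j - yref i t 0 j = es t i 0 j.
  by move=> t _; rewrite /es ni !mxE.
apply: lipx_eq E _; apply: lipx_add; first by exists M; exact: H.
by apply: lipx_opp; exists My; apply: yref_lip => //; rewrite b0 (lt_le_trans bom omT).
Qed.

Lemma sol_derive : {ae mu, forall t : R, 0 < t < om ->
  (forall i, (i < n)%N -> is_derive t 1 (x i) (x i.+1 t)) /\
  is_derive t 1 (x n) (derive1 (x n) t)}.
Proof.
have [_ _ _ _ xd] := xsol; apply: ae_exhaust => b bom.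
have [b0|b0] := leP b 0.
  by apply: aeW => t /andP[t0 tb]; have := lt_le_trans (lt_trans t0 tb) b0; rewrite ltxx.
have tb : 0 < b < om by rewrite b0.
apply: aeS (xd b tb) => t H /andP[t0 tb'].
have {H}[H1 H2] := H (ltac:(by rewrite ltW)); split; first by move=> i ni; exact: H1.
by case: H2 => /= dx _; rewrite derive1E; apply: derivableP.
Qed.

Lemma es_derive : {ae mu, forall t : R, 0 < t < om -> forall i j, (i <= n)%N ->
  is_derive t 1 (fun s => es s i 0 j) (es t i.+1 0 j)}.
Proof.
apply: aeS2 sol_derive yref_derive => t H1 H2 tom i j ni.
have tT : 0 < t < T by case/andP: tom => -> /lt_le_trans -> //; exact: omT.
have {H1}[H1 H3] := H1 tom; have {}H2 := H2 tT i j ni.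
have -> : (fun s => es s i 0 j) = (fun s => x i s 0 j - yref i s 0 j).
  by apply/funext => s; rewrite /es ni !mxE.
have -> : es t i.+1 0 j = (if (i < n)%N then x i.+1 t else derive1 (x n) t) 0 j - yref i.+1 t 0 j.
  by rewrite /es !mxE.
apply: is_deriveB; case: ifPn => [ii|]; first exact: is_derive_coord (H1 i ii).
rewrite -leqNgt => nn; have -> : i = n by apply/eqP; rewrite eqn_leq ni.
exact: is_derive_coord H3.
Qed.

Lemma es_z_lt1 t k : (k <= n)%N -> 0 <= t < om -> enorm (ee c T alpha t (es t) k) < 1.
Proof. by move=> kn ht; rewrite ee_es//; exact: z_lt1. Qed.

Lemma es_bigO i j : (i <= n)%N -> bigOphi c T om (-1) (fun t => es t i 0 j).
Proof.
exact: (e_bigOphi c0 al_derive al_cont al0 al_ge al_large om0 omT es_lip es_derive es_z_lt1).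
Qed.

Lemma sol_bounded : exists2 Bx, 0 <= Bx & forall i t, (i <= n)%N -> 0 <= t < om -> enorm (x i t) <= Bx.
Proof.
apply: uniform_bound_nat => i ni.
have [|C C0 HC] := @uniform_bound R 'I_m R (fun t => 0 <= t < om) (fun j t => `|x i t 0 j|).
  move=> j; have [|C _ HC] := bigOphi_le c0 om0 omT (w' := 0) _ (es_bigO j ni); first by [].
  exists (C + My) => t ht; have tT : 0 <= t < T by case/andP: ht => -> /lt_le_trans -> //; exact: omT.
  have -> : x i t 0 j = es t i 0 j + yref i t 0 j by rewrite /es ni !mxE subrK.
  rewrite (le_trans (ler_normD _ _))// lerD ?yref_bd//.
  by have := HC t ht; rewrite expr0z mulr1.
by exists (m%:R * C) => t ht; apply: enorm_le_bound => // j; exact: HC.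
Qed.

(** The trajectory is bounded, hence so is the memory term.  The velocity of e_r is phi
times [f] plus bounded terms, and in the band of [high_gain_level] the part of [f]
along e_r dominates them, whatever the size of phi. *)
Lemma last_z : exists2 q0 : R, 0 <= q0 < 1 & forall t, 0 <= t < om -> enorm (z x t n) <= q0.
Proof.
have [Bx Bx0 HBx] := sol_bounded.
have [bd [bz [bd0 bz0 rep]]] := sol_rep Bx.
have [C C0 HC] : exists2 C : R, 0 <= C & forall t j, 0 <= t < om ->
    `|gsum c T al n.+1 t (ee c T alpha t (es t)) n j| <= C.
  have [|C C0 HC] := @uniform_bound R 'I_m R (fun t => 0 <= t < om)
      (fun j t => `|gsum c T al n.+1 t (ee c T alpha t (es t)) n j|).
    move=> j; have [|C _ HC] := bigOphi_le c0 om0 omT (w' := 0) _ (gsum_z_bigOphi c0 al_derive al_cont al0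
      al_ge al_large om0 omT es_lip es_derive es_z_lt1 (K := n.+1) j (leqnn n) (leqnSn n) (leqnn _)); first by lia.
    by exists C => t ht; have := HC t ht; rewrite expr0z mulr1.
  by exists C => // t j; exact: HC.
(* Bound for the terms of the velocity of e_r / phi other than f. *)
pose Bg := c + m%:R * (My + C).
have zom : 0 <= (0 : R) < om by rewrite lexx om0.
have V0d : 0 <= enorm (z x 0 n) ^+ 2 < 1 by apply: enorm2_dom; exact: z_lt1.
have cK : 0 <= c * n.+2%:R by rewrite mulr_ge0// ltW.
have [V1 [V2 [V01 V12 V21 hg]]] := high_gain_level m0 cf hgf cK abij calpha hN hNs Bg bd0 bz0 V0d.
have V10 : 0 <= V1 by case/andP: V0d => /le_trans H _; exact: H V01.
have bar : {ae mu, forall t, 0 < t < om -> V1 < enorm (ee c T alpha t (es t) n) ^+ 2 < V2 ->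
    dotp (ee c T alpha t (es t) n) (zrhs c T alpha al es n t) <= 0}.
  have rep' : {ae mu, forall t : R, 0 < t < om ->
      exists (dl : 'rV[R]_p) (zt : 'rV[R]_q), [/\ forall j, `|dl 0 j| <= bd,
       forall j, `|zt 0 j| <= bz & is_derive t 1 (x n) (f (dl, zt, fb x t))]}.
    apply: ae_exhaust => b bom; have [b0|b0] := ltP b 0.
      by apply: aeW => t /andP[t0 tb]; have := lt_trans (lt_trans t0 tb) b0; rewrite ltxx.
    have hb : 0 <= b < om by rewrite b0.
    have Hb i t : (i <= n)%N -> 0 <= t <= b -> enorm (x i t) <= Bx.
      by move=> ni /andP[t0 tb]; apply: HBx; rewrite ?t0 ?(le_lt_trans tb).
    by apply: aeS (rep b hb Hb) => t H tb; have [] := H tb.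
  apply: aeS2 rep' yref_last => t H Hy tom; have [dl [zt [h1 h2 h3]]] := H tom => hV.
  have tom' : 0 <= t < om by case/andP: tom => /ltW -> ->.
  have tT : 0 <= t < T by case/andP: tom' => -> /lt_le_trans -> //; exact: omT.
  have pt : 0 < phi c T t by apply: (phi_gt0 c0 omT); case/andP: tom.
  have nn : (n <= n)%N by [].
  have hgt := hg dl zt _ h1 h2 hV; rewrite ee_es// in hgt hV *.
  have fE : N (alpha (enorm (z x t n) ^+ 2)) *: z x t n = fb x t by [].
  rewrite fE in hgt.
  rewrite /zrhs ee_es// dotpDr !dotpZr -enorm2.
  have -> : c * phi c T t * enorm (z x t n) ^+ 2 + phi c T t * dotp (z x t n)
     (es t n.+1 + (\row_j gsum c T al n.+1 t (ee c T alpha t (es t)) n j)) =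
     phi c T t * (c * enorm (z x t n) ^+ 2 + dotp (z x t n)
     (es t n.+1 + (\row_j gsum c T al n.+1 t (ee c T alpha t (es t)) n j))) by ring.
  rewrite pmulr_rle0// dotpDr.
  have -> : es t n.+1 = f (dl, zt, fb x t) - yref n.+1 t.
    rewrite /es ltnn; congr (_ - _); rewrite derive1E.
    by case: h3.
  rewrite dotpDr.
  have z1 : enorm (z x t n) <= 1 by apply: ltW; exact: z_lt1.
  have h4 : c * enorm (z x t n) ^+ 2 <= c.
    by rewrite ler_piMr ?(ltW c0)// exprn_ile1// enorm_ge0.
  have dl1 (w : V) (B : R) : 0 <= B -> (forall j, `|w 0 j| <= B) -> dotp (z x t n) w <= m%:R * B.
    move=> B0 wB; apply: le_trans (cauchy_schwarz _ _) _.
    rewrite (le_trans (ler_wpM2r (enorm_ge0 _) z1))// mul1r.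
    exact: enorm_le_bound.
  have h5 : dotp (z x t n) (- yref n.+1 t) <= m%:R * My.
    by apply: dl1 => // j; rewrite mxE normrN; exact: Hy.
  have h6 : dotp (z x t n) (\row_j gsum c T al n.+1 t (ee c T alpha t (es t)) n j) <= m%:R * C.
    by apply: dl1 => // j; rewrite mxE; exact: HC.
  move: hgt h4 h5 h6; rewrite /Bg mulrDr.
  move: (dotp _ (f _)) (dotp _ (- _)) (dotp _ (\row_j _)) (c * _ ^+ 2) (m%:R * My) (m%:R * C).
  by move=> r1 r2 r3 r4 r5 r6; lra.
have nn : (n <= n)%N by [].
have init : enorm (ee c T alpha 0 (es 0) n) ^+ 2 <= V1 by rewrite ee_es.
have H t : 0 <= t < om -> enorm (z x t n) ^+ 2 <= V1.
  move=> ht; rewrite -ee_es//.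
  exact: (z_barrier c0 al_derive al_cont al0 omT es_lip es_derive es_z_lt1 nn V12 bar init ht).
exists (Num.sqrt V1).
  by rewrite sqrtr_ge0/= -sqrtr1 ltr_sqrt// (lt_trans V12).
move=> t ht; rewrite -[leLHS]ger0_norm ?enorm_ge0// -sqrtr_sqr ler_wsqrtr//.
exact: H.
Qed.

Lemma sol_uniform : exists2 q0 : R, 0 <= q0 < 1 &
  forall k t, (k <= n)%N -> 0 <= t < om -> enorm (z x t k) <= q0.
Proof.
have [q1 /andP[q10 q11] H1] := last_z.
have [q2 /andP[q20 q21] H2] := z_uniform c0 al_derive al_cont al0 al_large
  om0 omT es_lip es_derive es_z_lt1.
exists (Num.max q1 q2); first by rewrite le_max q10 gt_max q11 q21.
move=> k t; rewrite leq_eqVlt => /predU1P[->|kn] ht; rewrite le_max; first by rewrite H1.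
by rewrite -ee_es ?(ltnW kn)// H2 ?orbT.
Qed.

Lemma fb_bounded : exists2 Bu, 0 <= Bu & forall t, 0 <= t < om -> enorm (fb x t) <= Bu.
Proof.
have [q1 /andP[q10 q11] H1] := last_z.
have q2 : q1 ^+ 2 < 1 by rewrite expr_lt1.
have [M1 M10 HM1] : exists2 M, 0 <= M & forall t, 0 <= t <= q1 ^+ 2 -> `|alpha t| <= M.
  apply: segment_bounded; apply: continuous_subspaceW calpha => t.
  by rewrite /= !in_itv/= => /andP[-> /le_lt_trans]; exact.
have [M2 M20 HM2] : exists2 M, 0 <= M & forall t, 0 <= t <= M1 -> `|N t| <= M.
  apply: segment_bounded; apply: continuous_subspaceW hN => t.
  by rewrite /= !in_itv/= => /andP[->].
exists M2 => // t ht; rewrite (_ : fb x t = N (alpha (enorm (z x t n) ^+ 2)) *: z x t n)//.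
have zq := H1 t ht; have z0 := enorm_ge0 (z x t n).
have z2 : 0 <= enorm (z x t n) ^+ 2 <= q1 ^+ 2 by rewrite exprn_ge0//= lerXn2r// nnegrE.
have z21 : 0 <= enorm (z x t n) ^+ 2 < 1 by case/andP: z2 => -> /le_lt_trans ->.
rewrite enormZ -[leRHS]mulr1 ler_pM//.
  by apply: HM2; rewrite al_ge0// (le_trans (ler_norm _))// HM1.
by rewrite (le_trans zq)// ltW.
Qed.

(** The Lipschitz constant does not depend on [b], so that the trajectory extends
continuously to the closed interval. *)
Lemma sol_global : exists2 M, 0 <= M &
  (forall b i j, 0 <= b < om -> (i <= n)%N -> lipon 0 b M (fun t => x i t 0 j)) /\
  {ae mu, forall t : R, 0 < t < om -> exists2 F, is_derive t 1 (x n) F & enorm F <= M}.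
Proof.
have [Bx Bx0 HBx] := sol_bounded; have [Bu Bu0 HBu] := fb_bounded.
have [M M0 HM] := sol_lip Bx Bu; exists M => //.
have H b : 0 <= b < om -> (forall i j, (i <= n)%N -> lipon 0 b M (fun t => x i t 0 j)) /\
    {ae mu, forall t : R, 0 < t < b -> exists2 F, is_derive t 1 (x n) F & enorm F <= M}.
  move=> hb; have /andP[b0 bom] := hb; apply: HM => //.
    by move=> i t ni /andP[t0 tb]; apply: HBx; rewrite ?t0 ?(le_lt_trans tb).
  by move=> t /andP[t0 tb]; apply: HBu; rewrite ?t0 ?(le_lt_trans tb).
split; first by move=> b i j hb ni; have [H1 _] := H b hb; exact: H1.
apply: ae_exhaust => b bom; have [b0|b0] := ltP b 0.
  by apply: aeW => t /andP[t0 tb]; have := lt_trans (lt_trans t0 tb) b0; rewrite ltxx.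
have hb : 0 <= b < om by rewrite b0.
by have [] := H b hb.
Qed.

Lemma sol_closure : exists xi : nat -> R -> V,
  [/\ forall i t, t < om -> xi i t = x i t,
      forall i j, (i <= n)%N -> lipx 0 om (fun t => xi i t 0 j),
      forall i, (i <= n)%N -> {within `[- sigma, om], continuous (xi i)}
    & {ae mu, forall t : R, 0 < t < om ->
        (forall i, (i < n)%N -> is_derive t 1 (xi i) (xi i.+1 t)) /\
        is_derive t 1 (xi n) (derive1 (x n) t)}].
Proof.
have [M M0 [HM _]] := sol_global; have o0 := om0; have [_ xy _ _ _] := xsol.
have Hl i j : exists l, (i <= n)%N -> lipon 0 om M (fun t => if t < om then x i t 0 j else l).
  have [ni|ni] := leqP i n; last by exists 0.
  by have [l Hl] := lip_limit om0 M0 (fun b hb => HM b i j hb ni); exists l.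
have Hl' i : exists l : 'I_m -> R, forall j, (i <= n)%N ->
    lipon 0 om M (fun t => if t < om then x i t 0 j else l j).
  by have [l Hl1] := choice (Hl i); exists l.
have {Hl Hl'}[l Hl] := choice Hl'.
pose xi i t := if t < om then x i t else \row_j l i j.
have xiE i t : t < om -> xi i t = x i t by move=> tom; rewrite /xi tom.
have lxi i j : (i <= n)%N -> lipx 0 om (fun t => xi i t 0 j).
  move=> ni; exists M; apply: lipon_eq (Hl i j ni) => t _.
  by rewrite /xi; case: ifP => // _; rewrite mxE.
exists xi; split => //.
  move=> i ni; apply: (within_itv_glue _ (ltW o0)); first by rewrite oppr_le0.
    apply: (subspace_eq_continuous (f := y0 i)); last exact: cy0.
    move=> t; rewrite inE/= in_itv/= => ht; apply: esym; change (xi i t = y0 i t).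
    by rewrite xiE ?xy//; case/andP: ht => _ /le_lt_trans; apply.
  by apply: lip_within => j; exact: lxi.
apply: aeS sol_derive => t H tom; have [H1 H2] := H tom; have /andP[_ t1] := tom.
have E i : \forall s \near t, x i s = xi i s.
  by apply: filterS (lt_nbhsl t1) => s s1; rewrite xiE.
split; last exact: (near_eq_is_derive (E n)).
by move=> i ni; rewrite xiE//; apply: (near_eq_is_derive (E i)); exact: H1.
Qed.

(** If [om < T], the errors at [om] are limits of errors of norm at most [q0 < 1], so
that the closure of the trajectory can be continued. *)
Lemma maximal_omega : ~ (exists omega' x',
       [/\ om < omega', sol omega' x'
         & forall i t, (i < n.+1)%N -> - sigma <= t < om -> x' i t = x i t]) -> om = T.
Proof.
move=> maxi; apply/eqP; rewrite eq_le omT leNgt; apply/negP => oT; apply: maxi.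
have o0 := om0; have [_ xy _ _ xd] := xsol.
have [xi [xiE lxi cxi _]] := sol_closure.
have [q0 /andP[q00 q01] Hq] := sol_uniform.
have zE k t : t < om -> z xi t k = z x t k by move=> tom; apply: z_ext => i _; exact: xiE.
have zom k : (k <= n)%N -> enorm (z xi om k) <= q0.
  elim/ltn_ind: k => k IH kn.
  have C : (fun t => z xi t k) @ om^'- --> z xi om k.
    have idl : (fun t : R => t) @ om^'- --> om.
      by apply: (@within_cvg_left _ _ 0 om id o0); apply: continuous_subspaceT => t; exact: cvg_id.
    apply: (@ee_cvg R m c T alpha al n c0 al_derive al_cont al0 R (at_left om) _ id om
      (fun s i => xi i s - yref i s) (fun i => xi i om - yref i om)) => //.
    - exact: leqW.
    - by rewrite lt_eqF.
    - move=> i ik; have ni := leq_trans ik kn; apply: cvgB.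
        apply: (@within_cvg_left _ _ (- sigma)); last exact: cxi.
        by rewrite (le_lt_trans _ o0)// oppr_le0.
      apply: (@within_cvg_left _ _ 0 om _ o0).
      apply: continuous_subspaceW (cyref ni) => s; rewrite /= !in_itv/= => /andP[-> sb].
      exact: le_lt_trans oT.
    - move=> i ik; apply: le_lt_trans q01; apply: IH => //.
      by rewrite ltnW// (leq_trans ik).
  have Cn := cvg_comp _ _ C (@enorm_continuous R m (z xi om k)).
  rewrite leNgt; apply/negP => qz; move/cvgr_gt: Cn => /(_ _ qz) H.
  have H2 := near_left o0.
  have [t [h1 /andP[t0 t1]]] := filter_ex (filterI H H2).
  by move: h1; rewrite /= zE// ltNge Hq// t1 ltW.
have omI : 0 <= om < T by rewrite ltW.
have [om' [x' [h1 h2 h3]]] : exists om' x', [/\ om < om', sol om' x' &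
    forall i t, (i <= n)%N -> - sigma <= t <= om -> x' i t = xi i t].
  apply: (continue_solution c0 al_derive al_cont al0 al_ge0 hN sigma0 hTop hd cf cyref omI) => //.
  - move=> i t ni ht; have /andP[_ t0] := ht.
    by rewrite xiE ?xy// (le_lt_trans t0).
  - move=> k t kn /andP[t0 tom]; have [t1|t1] := ltP t om.
      by rewrite zE// z_lt1// t0.
    have -> : t = om by apply/eqP; rewrite eq_le tom.
    exact: le_lt_trans (zom k kn) q01.
  - move=> b hb; have /andP[b0 bom] := hb.
    have -> : (fun s => stack n.+1 xi (Num.min s b)) = (fun s => stack n.+1 x (Num.min s b)).
      apply/funext => s; apply/rowP => k; case/mxvec_indexP: k => i j.
      by rewrite !stack_coord xiE// gt_min bom orbT.
    apply: aeS2 (ae_neq 0) (xd b hb) => t nt0 H ht; have /andP[t0 tb] := ht.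
    have [H1 H2] := H ht; have tom := lt_trans tb bom.
    have E i : \forall s \near t, x i s = xi i s.
      by apply: filterS (lt_nbhsl tom) => s s1; rewrite xiE.
    split.
      by move=> i ni; rewrite xiE//; apply: (near_eq_is_derive (E i)); exact: H1.
    rewrite (@fb_ext R m n c T alpha N yref xi x t); last by move=> i _; rewrite xiE.
    exact: (near_eq_is_derive (E n)).
exists om', x'; split => // i t ni /andP[st tom].
by rewrite h3 ?st ?(ltW tom)// xiE.
Qed.

(** * Regularity and performance *)

Lemma fb_Linf : Linf `[0, om[ (fb x).
Proof.
split; last first.
  have [Bu _ HBu] := fb_bounded; exists Bu; apply: aeW => t.
  by rewrite /= in_itv/=; exact: HBu.
exists (fb x); split; last exact: aeW.
have cfb : {within `[0, om[, continuous (fb x)} by apply: within_itvco => t; exact: fb_cont.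
by move=> j; apply: subspace_continuous_measurable_fun; [exact: measurable_itv|exact: within_coord].
Qed.

Lemma sol_winf : Winf n.+1 `[0, om[ (x 0%N).
Proof.
have [xi [xiE lxi _ dxi]] := sol_closure; have o0 := om0.
pose G i t := if (i <= n)%N then xi i t else derive1 (x n) t.
have sub : `[0, om[%classic `<=` `[0, om] by move=> t; rewrite /= !in_itv/= => /andP[-> /ltW].
have dxi' i : (i < n.+1)%N -> {ae mu, forall t : R, 0 < t < om -> is_derive t 1 (G i) (G i.+1 t)}.
  rewrite ltnS => ni; apply: aeS dxi => t H tom; have [H1 H2] := H tom.
  have -> : G i = xi i by apply/funext => s; rewrite /G ni.
  rewrite /G; case: ifPn => [/H1//|nn].
  by have -> : i = n by apply/eqP; rewrite eqn_leq ni leqNgt.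
exists G; split; last by move=> t; rewrite /= in_itv/= /G leq0n => /andP[_ ?]; rewrite xiE.
have lG i j : (i < n.+1)%N -> lipx 0 om (fun t => G i t 0 j).
  by rewrite ltnS => ni; apply: lipx_eq (lxi i j ni) => t _; rewrite /G ni.
apply: (winf_of_lip (ltW o0) sub (measurable_itv _) lG dxi').
exact: (Linf_derive (ltW o0) sub (measurable_itv _) (fun j => lG n j (ltnSn n)) (dxi' n (ltnSn n))).
Qed.

Hypothesis hy0 : Ck_jet n `[- sigma, 0] y0.

Lemma y0_lipx i j : (i < n)%N -> lipx (- sigma) 0 (fun t => y0 i t 0 j).
Proof.
move=> ni; have [C C0 HC] := compact_enorm_bound (cy0 ni).
apply: (@lipx_C1 _ (- sigma) 0 C _ (fun t => y0 i.+1 t 0 j)).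
- by apply: within_coord; apply: cy0; exact: ltnW.
- by move=> t ht; apply: is_derive_coord; exact: Ck_jet_derive hy0 ni ht.
- by move=> t ht; rewrite (le_trans (coord_le_enorm _ _))// HC.
Qed.

Lemma past_closure : exists xi : nat -> R -> V,
  [/\ forall i t, t < om -> xi i t = x i t,
      forall i t, (i <= n)%N -> - sigma <= t <= 0 -> xi i t = y0 i t,
      forall i j, (i <= n)%N -> lipx 0 om (fun t => xi i t 0 j),
      forall i, (i <= n)%N -> {within `[- sigma, om], continuous (xi i)}
    & (forall i j, (i < n)%N -> lipx (- sigma) om (fun t => xi i t 0 j)) /\
      (forall i, (i < n)%N -> {ae mu, forall t : R, - sigma < t < om -> is_derive t 1 (xi i) (xi i.+1 t)}) /\
      {ae mu, forall t : R, 0 < t < om -> is_derive t 1 (xi n) (derive1 (xi n) t)}].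
Proof.
have [xi [xiE lxi cxi dxi]] := sol_closure; have o0 := om0; have [_ xy _ _ _] := xsol.
have xiy i t : (i <= n)%N -> - sigma <= t <= 0 -> xi i t = y0 i t.
  by move=> ni ht; rewrite xiE ?xy//; case/andP: ht => _ /le_lt_trans; apply.
exists xi; split => //; split; [|split].
- move=> i j ni; apply: (@lipx_glue _ (- sigma) 0); last by apply: lxi; exact: ltnW.
  by apply: lipx_eq (y0_lipx j ni) => t ht; rewrite xiy// ltnW.
- move=> i ni; apply: aeS2 (ae_neq 0) dxi => t t0 H /andP[st tom].
  have [tn|tp] := ltP t 0.
    rewrite xiy ?(ltW st) ?(ltW tn)//; apply: (@near_eq_is_derive _ _ _ (y0 i)).
      apply: filterS (filterI (lt_nbhsr st) (lt_nbhsl tn)) => s [s1 s2].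
      by rewrite xiy ?(ltW s1) ?(ltW s2)// ltnW.
    by apply: Ck_jet_derive hy0 ni _; rewrite st.
  have tp' : 0 < t by rewrite lt_neqAle tp andbT eq_sym; apply/eqP.
  by have [H1 _] := H (ltac:(by rewrite tp')); exact: H1.
- apply: aeS dxi => t H tom; have [_ [/= dx _]] := H tom.
  by rewrite derive1E; exact: derivableP.
Qed.

Lemma sol_winf_past : Winf n `[- sigma, om[ (x 0%N).
Proof.
have [xi [xiE _ _ cxi [lxi [dxi _]]]] := past_closure; have o0 := om0.
have so : - sigma <= om by rewrite (le_trans _ (ltW o0))// oppr_le0.
have sub : `[- sigma, om[%classic `<=` `[- sigma, om] by move=> t; rewrite /= !in_itv/= => /andP[-> /ltW].
exists xi; split; last by move=> t; rewrite /= in_itv/= => /andP[_ ?]; rewrite xiE.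
apply: (winf_of_lip so sub (measurable_itv _) lxi dxi).
by apply: Linf_cont sub (measurable_itv _) (cxi _ _).
Qed.

(** By induction, the weak derivatives of [y0 0] are the entries of the jet: both are
continuous, and they agree almost everywhere.  For [sigma = 0] the interval is a point
and the entries of the jet are unrelated. *)
Lemma past_last_lip : 0 < sigma -> Winf n.+1 `[- sigma, 0] (y0 0%N) ->
  forall j, lipx (- sigma) 0 (fun t => y0 n t 0 j) /\
  {ae mu, forall t : R, - sigma < t < 0 -> derivable (fun t => y0 n t 0 j) t 1}.
Proof.
move=> s0 [G [wG G0]] j.
have ms : - sigma < 0 by rewrite oppr_lt0.
have GL i : (i <= n)%N -> exists M, (forall j, lipon (- sigma) 0 M (fun t => G i t 0 j)) /\
    forall j, {ae mu, forall t : R, - sigma < t < 0 -> is_derive t 1 (fun t => G i t 0 j) (G i.+1 t 0 j)}.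
  move=> ni; have [M M0 H] := winf_lip (measurable_itv _) wG (ni : (i < n.+1)%N).
  have {}H := H (- sigma) 0 (ltW ms) (@subset_refl _ _).
  by exists M; split => k; have [] := H k.
have GE i : (i <= n)%N -> forall t, - sigma <= t <= 0 -> G i t = y0 i t.
  elim: i => [_ t ht|i IH ni t ht]; first by apply: G0; rewrite /= in_itv.
  have {}IH := IH (ltnW ni); have [M [_ dG]] := GL i (ltnW ni).
  have [cG _ _] := wG.
  apply/rowP => k; apply: (@cont_ae_eq R (- sigma) 0 (fun t => G i.+1 t 0 k) (fun t => y0 i.+1 t 0 k) ms _ _ _ t ht).
  - by apply: within_coord; apply: cG.
  - by apply: within_coord; apply: cy0.
  - apply: aeS (dG k) => u H hu; have {}H := H hu.
    have Hy := is_derive_coord k (Ck_jet_derive hy0 ni hu).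
    have /andP[u1 u2] := hu.
    have : is_derive u 1 (fun t => G i t 0 k) (y0 i.+1 u 0 k).
      apply: (@near_eq_is_derive _ _ _ (fun t => y0 i t 0 k)) => //.
      apply: filterS (filterI (lt_nbhsr u1) (lt_nbhsl u2)) => s [s1 s2].
      by rewrite IH// !ltW.
    by move=> [_ <-]; case: H => _ <-.
have [M [lG dG]] := GL n (leqnn n); split.
  by exists M; apply: lipon_eq (lG j) => t ht; rewrite GE.
apply: aeS (dG j) => t H ht; have /andP[t1 t2] := ht.
suff [] : is_derive t 1 (fun t => y0 n t 0 j) (G n.+1 t 0 j) by [].
apply: near_eq_is_derive (H ht).
apply: filterS (filterI (lt_nbhsr t1) (lt_nbhsl t2)) => s [h1 h2].
by rewrite GE// !ltW.
Qed.

Lemma sol_winf_full : Winf n.+1 `[- sigma, 0] (y0 0%N) -> Winf n.+1 `[- sigma, om[ (x 0%N).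
Proof.
have := sigma0; rewrite le_eqVlt => /predU1P[<- _|s0 wy].
  by rewrite oppr0; exact: sol_winf.
have [xi [xiE xiy lxi0 cxi [lxi [dxi dlast]]]] := past_closure; have o0 := om0.
have so : - sigma <= om by rewrite (le_trans _ (ltW o0))// oppr_le0.
have sub : `[- sigma, om[%classic `<=` `[- sigma, om] by move=> t; rewrite /= !in_itv/= => /andP[-> /ltW].
pose G i t := if (i <= n)%N then xi i t else derive1 (xi n) t.
have GE i : (i <= n)%N -> G i = xi i by move=> ni; apply/funext => s; rewrite /G ni.
have lG i j : (i < n.+1)%N -> lipx (- sigma) om (fun t => G i t 0 j).
  rewrite ltnS leq_eqVlt => /predU1P[->|ni]; last by rewrite (GE i (ltnW ni)); exact: lxi.
  rewrite (GE n)//; apply: (@lipx_glue _ (- sigma) 0); last exact: lxi0.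
  have [H _] := past_last_lip s0 wy j.
  by apply: lipx_eq H => t ht; rewrite xiy.
have dG i : (i < n.+1)%N -> {ae mu, forall t : R, - sigma < t < om -> is_derive t 1 (G i) (G i.+1 t)}.
  rewrite ltnS leq_eqVlt => /predU1P[->|ni]; last first.
    by rewrite (GE i (ltnW ni)) (GE i.+1 ni); exact: dxi.
  have Gn : G n.+1 = derive1 (xi n) by apply/funext => t; rewrite /G ltnn.
  rewrite (GE n)// Gn.
  have dy : {ae mu, forall t : R, forall j, - sigma < t < 0 -> derivable (fun t => y0 n t 0 j) t 1}.
    by apply: ae_ord => j; have [] := past_last_lip s0 wy j.
  apply: aeS2 (ae_neq 0) (aeI dlast dy) => t t0 [H1 H2] /andP[st tom].
  have [tn|tp] := ltP t 0; last first.
    by apply: H1; rewrite tom andbT lt_neqAle tp andbT eq_sym; apply/eqP.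
  have D : is_derive t 1 (xi n) (\row_j 'D_1 (fun t => y0 n t 0 j) t).
    apply: rV_is_derive => j; rewrite mxE.
    apply: (@near_eq_is_derive _ _ _ (fun t => y0 n t 0 j)).
      apply: filterS (filterI (lt_nbhsr st) (lt_nbhsl tn)) => s [s1 s2].
      by rewrite xiy// !ltW.
    by apply: derivableP; apply: H2; rewrite st.
  by case: D => dx _; rewrite derive1E; exact: derivableP.
exists G; split; last by move=> t; rewrite /= in_itv/= => /andP[_ ?]; rewrite GE// xiE.
apply: (winf_of_lip so sub (measurable_itv _) lG dG).
exact: (Linf_derive so sub (measurable_itv _) (fun j => lG n j (ltnSn n)) (dG n (ltnSn n))).
Qed.

Lemma sol_funnel t : 0 <= t < om -> phi c T t * enorm (x 0%N t - yref 0%N t) < 1.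
Proof.
move=> ht; have := z_lt1 (leq0n n) ht; rewrite /ee /= big_ord0 scaler0 addr0 enormZ.
by rewrite ger0_norm// ltW// (phi_gt0 c0 omT)//; case/andP: ht.
Qed.

Lemma sol_exact i : om = T -> (i <= n)%N -> (fun t => enorm (x i t - yref i t)) @ T^'- --> (0 : R).
Proof.
move=> oT ni.
have Hj (j : 'I_m) : exists C : R, 0 <= C /\ forall t, 0 <= t < om -> `|es t i 0 j| <= C * (c * (T - t)).
  have [C C0 HC] := es_bigO j ni; exists C; split => // t ht.
  rewrite (le_trans (HC t ht))// /phi -invr_expz expr1z invfM !invrK//.
have {Hj}[C HC] := choice Hj; pose K := \sum_j (C j * c).
have T0 : 0 < T by rewrite -oT om0.
have lin : (fun t => K * (T - t)) @ T^'- --> (0 : R).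
  have -> : (0 : R) = K * (T - T) by rewrite subrr mulr0.
  apply: (@within_cvg_left _ _ 0 T (fun t => K * (T - t)) T0).
  apply: continuous_subspaceT => t; apply: cvgM; first exact: cvg_cst.
  by apply: cvgB; [exact: cvg_cst|exact: cvg_id].
apply: (squeeze_cvgr _ (cvg_cst 0) lin); apply: filterS (near_left T0) => t /andP[t0 tT].
rewrite enorm_ge0/=; apply: le_trans (enorm_le_sum _) _; rewrite /K mulr_suml.
apply: ler_sum => j _; have [_ H] := HC j; have := H t; rewrite oT (ltW t0) tT => /(_ isT).
by rewrite /es ni mulrA.
Qed.

Lemma maximal_solution_properties : ~ (exists omega' x',
       [/\ om < omega', sol omega' x'
         & forall i t, (i < n.+1)%N -> - sigma <= t < om -> x' i t = x i t]) ->
  [/\ om = T,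
      [/\ Linf `[0, T[ (fb x), Winf n.+1 `[0, T[ (x 0%N), Winf n `[- sigma, T[ (x 0%N)
        & Winf n.+1 `[- sigma, 0] (y0 0%N) -> Winf n.+1 `[- sigma, T[ (x 0%N)],
      forall t, 0 <= t < T -> phi c T t * enorm (x 0%N t - yref 0%N t) < 1
    & forall i, (i < n.+1)%N -> (fun t => enorm (x i t - yref i t)) @ T^'- --> (0 : R)].
Proof.
move=> /maximal_omega oT; split => //.
- by have := (fb_Linf, sol_winf, sol_winf_past, sol_winf_full); rewrite oT => -[[[]]].
- by have := sol_funnel; rewrite oT.
- by move=> i; exact: sol_exact.
Qed.

End Solution.

(** * Output tracking with exact reference at the final time *)

Theorem theorem3p1 (R : realType) (m r : nat) (hm : (0 < m)%N) (hr : (0 < r)%N)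
    (sigma : R) (hsigma : 0 <= sigma)
    (p q : nat) (d : R -> 'rV[R]_p)
    (f : 'rV[R]_p * 'rV[R]_q * 'rV[R]_m -> 'rV[R]_m)
    (Top : (R -> 'rV[R]_(r * m)) -> R -> 'rV[R]_q)
    (hsys : sys_class sigma d f Top)
    (y0 : nat -> R -> 'rV[R]_m) (hy0 : Ck_jet r.-1 `[- sigma, 0] y0)
    (T : R) (hT : 0 < T)
    (yref : nat -> R -> 'rV[R]_m) (hyref : Winf_jet r `[0, T[ yref)
    (c : R) (hc : 0 < c)
    (alpha : R -> R) (halpha : Ck r.-1 `[0, 1[ alpha)
    (halpha_bij : set_bij `[0, 1[ `[c * (r%:R + 1), +oo[ alpha)
    (N : R -> R) (hN : {within `[0, +oo[, continuous N})
    (hN_surj : set_surj `[0, +oo[ [set: R] N)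
    (hinit : forall k, (0 < k <= r)%N -> enorm (err alpha c T yref y0 k 0) < 1) :
  (exists omega x, is_solution sigma d f Top y0 alpha N c T yref omega x) /\
  (forall omega x,
     is_maximal_solution sigma d f Top y0 alpha N c T yref omega x ->
     [/\ omega = T,
         [/\ Linf `[0, T[ (feedback r alpha N c T yref x),
             Winf r `[0, T[ (x 0%N),
             Winf r.-1 `[- sigma, T[ (x 0%N)
           & Winf r `[- sigma, 0] (y0 0%N) -> Winf r `[- sigma, T[ (x 0%N)],
         forall t, 0 <= t < T -> phi c T t * enorm (x 0%N t - yref 0%N t) < 1
       & forall i, (i < r)%N ->
           (fun t => enorm (x i t - yref i t)) @ T^'- --> (0 : R)]).
Proof.
case: r hr Top hsys hy0 hyref halpha halpha_bij hinit => // n _ {}Top [hd cf hgf hTop] hy0 hyref ha.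
rewrite natr1 => abij hinit.
have [al [al_derive al_cont al0 ca]] := alpha_jet ha.
have al_ge s : 0 <= s < 1 -> c * n.+2%:R <= al 0%N s.
  by move=> hs; rewrite -al0//; exact: alpha_ge abij _ hs.
have al_large K : exists2 s0, 0 <= s0 < 1 & forall s, s0 <= s < 1 -> K <= al 0%N s.
  have [s0 hs0 H] := alpha_large abij ca K; exists s0 => // s hs; rewrite -al0 ?H//.
  by case/andP: hs hs0 => s0s -> /andP[/le_trans ->].
have al_ge0 s : 0 <= s < 1 -> 0 <= alpha s.
  by move=> hs; apply: le_trans (alpha_ge abij hs); rewrite mulr_ge0// ltW.
have [My [My0 yl yb yd ylast]] := yref_props hT hyref.
have cyref i : (i <= n)%N -> {within `[0, T[, continuous (yref i)}.
  by move=> ni; have [H _ _] := hyref; exact: H.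
have cy0 i : (i <= n)%N -> {within `[- sigma, 0], continuous (y0 i)} by exact: hy0.1.
split.
  (* The past alone is a trajectory on the degenerate interval [- sigma, 0]. *)
  have T0 : 0 <= (0 : R) < T by rewrite lexx.
  have y0_lip i j : (i <= n)%N -> lipx 0 0 (fun t => y0 i t 0 j).
    move=> _; exists 0 => s t /andP[s0 s1] /andP[t0 t1].
    have -> : s = t by apply/eqP; rewrite eq_le (le_trans s1) ?(le_trans t1).
    by rewrite !subrr normr0 mulr0.
  have y0_dom k t : (k <= n)%N -> 0 <= t <= 0 ->
      enorm (ee c T alpha t (fun i => y0 i t - yref i t) k) < 1.
    move=> kn /andP[t0 t1]; have -> : t = 0 by apply/eqP; rewrite eq_le t0 t1.
    exact: (hinit k.+1).
  have y0_ode b : 0 < b < 0 -> {ae @lebesgue_measure R, forall t : R, 0 <= t < b ->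
     (forall i, (i.+1 < n.+1)%N -> is_derive t 1 (y0 i) (y0 i.+1 t)) /\
     is_derive t 1 (y0 n) (f (d t, Top (fun s => stack n.+1 y0 (Num.min s b)) t,
       feedback n.+1 alpha N c T yref y0 t))}.
    by move=> /andP[b0 /(lt_trans b0)]; rewrite ltxx.
  have [om' [x [_ xsol _]]] := continue_solution hc al_derive al_cont al0
    al_ge0 hN hsigma hTop hd cf cyref T0 (fun i t _ _ => erefl) cy0 y0_lip y0_dom y0_ode.
  by exists om', x.
move=> om x [xsol maxi].
exact: (maximal_solution_properties hc al_derive al_cont al0 al_ge al_large abij ca hN hN_surj
  hm hsigma hTop hd cf hgf cyref My0 yl yb yd ylast cy0 xsol hy0 maxi).
Qed.
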